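(* Let $d\ge 1$, $N=d+1$, and let $\sigma>0$, $a>0$, $c>0$, $\alpha\in(0,1]$, $\beta\in(0,1]$, $\gamma\in(0,1]$ be constants. Let $X=\{X(x,t),(x,t)\in\mathbb{R}^d\times\mathbb{R}\}$ be a centered stationary real-valued Gaussian random field with covariance function $\mathbb{E}[X(x+y,t+s)X(y,s)]=C(x,t)$, where $$C(x,t)=\frac{\sigma^2}{(1+a|t|^{2\alpha})^{\beta N/2}}\exp\Big(-\frac{c|x|^{2\gamma}}{(1+a|t|^{2\alpha})^{\beta\gamma}}\Big).$$ Let $p\ge1$ be an integer and $\mathbf{X}=(X_1,\dots,X_p)$, where $X_1,\dots,X_p$ are independent copies of $X$. Then, with probability $1$, $$\dim\mathbf{X}([0,1]^{d+1})=\min\Big\{p,\ \frac d\gamma+\frac1\alpha\Big\}.$$ If $0<\alpha\le\gamma<1$, then, with probability $1$, $$\dim\mathrm{Gr}\,\mathbf{X}([0,1]^{d+1})=\begin{cases}d+1+(1-\alpha)p&\text{if }p<\frac1\alpha,\\ d+\frac\gamma\alpha+(1-\gamma)p&\text{if }\frac1\alpha\le p<\frac1\alpha+\frac d\gamma,\\ \frac1\alpha+\frac d\gamma&\text{if }p\ge\frac1\alpha+\frac d\gamma.\end{cases}$$ If $0<\gamma\le\alpha<1$, then, with probability $1$, $$\dim\mathrm{Gr}\,\mathbf{X}([0,1]^{d+1})=\begin{cases}d+1+(1-\gamma)p&\text{if }p<\frac d\gamma,\\ \frac{d\alpha}\gamma+1+(1-\alpha)p&\text{if }\frac d\gamma\le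 p<\frac1\alpha+\frac d\gamma,\\ \frac1\alpha+\frac d\gamma&\text{if }p\ge\frac1\alpha+\frac d\gamma.\end{cases}$$
   Context: $\dim$ denotes Hausdorff dimension. $\mathbf{X}([0,1]^{d+1})=\{\mathbf{X}(x,t):(x,t)\in[0,1]^{d+1}\}$ and $\mathrm{Gr}\,\mathbf{X}([0,1]^{d+1})=\{((x,t),\mathbf{X}(x,t)):(x,t)\in[0,1]^{d+1}\}\subset\mathbb{R}^{d+1+p}$. $|\cdot|$ is the Euclidean norm. Sample functions are taken almost surely continuous. *)

(* Defs.v *)
From HB Require Import structures.
From mathcomp Require Import all_boot all_order all_algebra.
From mathcomp Require Import all_classical all_reals all_analysis.

Set Implicit Arguments.
Unset Strict Implicit.
Unset Printing Implicit Defensive.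

Import Order.TTheory GRing.Theory Num.Theory.
Import numFieldNormedType.Exports.

Local Open Scope classical_set_scope.
Local Open Scope ring_scope.

Section EuclideanHausdorff.
Context {R : realType} {n : nat}.
Implicit Types (x : 'rV[R]_n) (A U : set 'rV[R]_n) (s : R).

(* The norm [`|x|] that the library puts on row vectors is the sup norm. *)
Definition enorm x : R := Num.sqrt (\sum_(i < n) x ord0 i ^+ 2).

(* [0] is added so that the empty set has diameter [0] instead of [-oo]. *)
Definition ediam U : \bar R :=
  ereal_sup (0%E |` [set (enorm (x - y))%:E | x in U & y in U]).

(* diam(U)^s, with value 0 on the empty set also when s = 0 *)
Definition hausdorff_gauge s U : \bar R :=
  if U == set0 then 0%E else poweR (ediam U) s.

Definition delta_cover (delta : R) A : set (nat -> set 'rV[R]_n) :=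
  [set U | A `<=` \bigcup_k U k /\ forall k, (ediam (U k) <= delta%:E)%E].

Definition hausdorff_premeasure s (delta : R) A : \bar R :=
  ereal_inf [set (\sum_(0 <= k <oo) hausdorff_gauge s (U k))%E
            | U in delta_cover delta A].

Definition hausdorff_measure s A : \bar R :=
  ereal_sup [set hausdorff_premeasure s delta A
            | delta in [set delta : R | 0 < delta]].

Definition hausdorff_dim A : \bar R :=
  ereal_inf [set s%:E | s in [set s : R | 0 <= s /\ hausdorff_measure s A = 0%E]].

End EuclideanHausdorff.

Section RandomFields.
Context {R : realType}.

(* sigma-algebra on the space of all functions [I -> R] generated by the
   coordinate evaluations; the law of a random field lives on it *)
Definition cylinder_sets (I : Type) : set (set (I -> R)) :=
  <<s [set C | exists z : I, exists2 B : set R,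
         measurable B & C = [set f | B (f z)]] >>.

Definition field_event (T I : Type) (X : I -> T -> R) (C : set (I -> R)) :
  set T := [set w | C (fun z => X z w)].

Definition same_law (disp disp' : measure_display) (T : measurableType disp)
    (T' : measurableType disp') (P : probability T R) (P' : probability T' R)
    (I : Type) (X : I -> T -> R) (Y : I -> T' -> R) : Prop :=
  forall C, cylinder_sets C -> P (field_event X C) = P' (field_event Y C).

Context (disp : measure_display) (T : measurableType disp)
        (P : probability T R).

Definition independent_fields (I : Type) (p : nat)
    (Xs : 'I_p -> I -> T -> R) : Prop :=
  forall C : 'I_p -> set (I -> R), (forall i, cylinder_sets (C i)) ->
    P (\bigcap_i field_event (Xs i) (C i)) =
    (\prod_(i < p) P (field_event (Xs i) (C i)))%E.

(* [normal_prob m 0] is a junk value of the library, and a Gaussian variable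
   with standard deviation 0 is almost surely equal to its mean. *)
Definition gaussian_rv (Y : T -> R) : Prop :=
  exists m s : R, 0 <= s /\
    forall B : set R, measurable B ->
      P (Y @^-1` B) = if s == 0 then \d_m B else normal_prob m s B.

Definition gaussian_field (I : Type) (X : I -> T -> R) : Prop :=
  forall (k : nat) (z : 'I_k -> I) (b : 'I_k -> R),
    gaussian_rv (fun w => \sum_(j < k) b j * X (z j) w).

Definition centered_field (I : Type) (X : I -> T -> R) : Prop :=
  forall z, ('E_P[X z] = 0)%E.

Definition stationary_field (V : zmodType) (X : V -> T -> R) : Prop :=
  forall h : V, same_law P P (fun z => X (z + h)) X.

Definition continuous_samples (I : topologicalType) (X : I -> T -> R) : Prop :=
  {ae P, forall w, continuous (fun z => X z w)}.

End RandomFields.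

Section SpaceTime.
Context {R : realType} (d : nat).

Definition cov_fun (sigma a c alpha beta gamma : R) (x : 'rV[R]_d) (t : R) : R :=
  let D := 1 + a * `|t| `^ (2 * alpha) in
  sigma ^+ 2 / D `^ (beta * d.+1%:R / 2) *
  expR (- (c * enorm x `^ (2 * gamma) / D `^ (beta * gamma))).

Definition unit_cube : set ('rV[R]_d * R) :=
  [set z : 'rV[R]_d * R | (forall i, 0 <= z.1 ord0 i <= 1) /\ 0 <= z.2 <= 1].

Context (T : Type) (p : nat) (Xs : 'I_p -> 'rV[R]_d * R -> T -> R).

Definition vector_field (z : 'rV[R]_d * R) (w : T) : 'rV[R]_p :=
  \row_(i < p) Xs i z w.

Definition cube_image (w : T) : set 'rV[R]_p :=
  [set vector_field z w | z in unit_cube].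

Definition cube_graph (w : T) : set 'rV[R]_(d + 1 + p) :=
  [set row_mx (row_mx z.1 (const_mx z.2)) (vector_field z w) | z in unit_cube].

End SpaceTime.

(* Main.v *)
(* Upper bounds: a Gaussian tail bound and chaining over dyadic grids show that, for every e < 1,
   almost surely X oscillates by O(h^e) on boxes with sides h^(1/gamma) in space and h^(1/alpha) in
   time. Subdividing such boxes, and the range of X over them, to cubes of side h^theta with theta
   in {1, 1/gamma, 1/alpha} yields the covers. Lower bounds: the variance of X(y) - X(z) is at least
   of order |x_i|^(2 gamma) for each space coordinate x_i and |t|^(2 alpha) for the time coordinate
   of y - z, so that P(|X(y) - X(z)| <= r) is at most (C r / q)^p, q being any of the |x_i|^gamma
   and |t|^alpha. Hence the expected s-energies of the images of the uniform measures on finer and finer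
   grids are bounded, by Fatou's lemma they are almost surely bounded along a subsequence, and
   compactness turns this into a mass distribution argument on finite grids. *)
From HB Require Import structures.
Require Import Defs.
From mathcomp Require Import all_boot all_order all_algebra.
From mathcomp Require Import all_classical all_reals all_analysis.
From mathcomp Require Import measurable_realfun ring lra.

Set Implicit Arguments.
Unset Strict Implicit.
Unset Printing Implicit Defensive.

Import Order.TTheory GRing.Theory Num.Theory.
Import numFieldNormedType.Exports.

Local Open Scope classical_set_scope.
Local Open Scope ring_scope.

(** * Gaussian variables *)

Section Gaussian.
Context {R : realType}.
Implicit Types (m s u r v x : R).

(** For the graph, both bounds are optimisation problems with a common value. Between consecutive
    points among 1, 1/gamma and 1/alpha the exponent of the cover is affine in 1/theta, so its
    minimum lies at one of these points. On the other side, the decay r^p of the small ball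
    probability is shared out, s1 to each space coordinate and st to time, and d + 1 + (1 - gamma) d
    s1 + (1 - alpha) st is maximised under d s1 + st <= p, s1 < 1/gamma, st < 1/alpha. The greedy
    solution first fills the direction of smaller exponent; hence the two orders of alpha and gamma
    and the thresholds of p. For the image the quantity to maximise is d s1 + st, and boundedness of
    the range adds the bound p. The energies are finite sums of indicators of events, so
    expectations are taken term by term. A hypothetical cheap cover is made open and finite by
    compactness; a single grid, finer than all its sets and of bounded energy, then contradicts
    it. *)

Lemma normal_peak_le s : 0 < s -> normal_peak s <= (2 * s)^-1.
Proof.
move=> s0; rewrite /normal_peak lef_pV2 ?posrE ?mulr_gt0//; last first.
  by rewrite sqrtr_gt0 mulrn_wgt0// mulr_gt0 ?pi_gt0// exprn_gt0.
rewrite -[leLHS]ger0_norm; last by rewrite mulr_ge0// ltW.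
rewrite -sqrtr_sqr ler_wsqrtr// exprMn -mulrnAr mulrC ler_wpM2l ?sqr_ge0//.
by have := @pi_ge2 R; lra.
Qed.

Lemma normal_prob_small_ball m s r : 0 < s -> 0 <= r ->
  (normal_prob m s [set x : R | (`|x| <= r)%R] <= (r / s)%:E)%E.
Proof.
move=> s0 r0.
have -> : [set x : R | (`|x| <= r)%R] = `[-r, r]%classic.
  by apply/seteqP; split => x /=; rewrite in_itv/= ler_norml.
rewrite /normal_prob.
apply: (@le_trans _ _ (\int[lebesgue_measure]_(x in `[(- r)%R, r]) ((2 * s)^-1)%R%:E)%E).
  apply: ge0_le_integral => //=.
  - by move=> x _; rewrite lee_fin normal_pdf_ge0.
  - by apply/measurable_EFinP; apply: measurable_funTS; exact: measurable_normal_pdf.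
  - move=> x _; rewrite lee_fin (le_trans (normal_pdf_ub _ _ _)) ?gt_eqF//.
    exact: normal_peak_le.
rewrite integral_cst//= lebesgue_measure_itv/= lte_fin.
case: ltP => [rr|_]; last by rewrite mule0 lee_fin divr_ge0// ltW.
rewrite -EFinB -EFinM lee_fin invfM opprK.
rewrite (_ : _ * _ = r / s)//; field.
by rewrite gt_eqF.
Qed.

(** Doubling the deviation quarters the exponent; the remaining three quarters,
    [3 (x - m)^2 / (8 s^2)], exceed [u^2 / (4 s^2)]. The tail integral is thereby compared with the
    total mass of a normal law of deviation [2 s]. *)
Lemma normal_fun_scale_le m s u x : 0 < s -> 0 <= u -> u <= `|x - m| ->
  normal_fun m s x <= expR (- (u ^+ 2 / (4 * s ^+ 2))) * normal_fun m (2 * s) x.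
Proof.
move=> s0 u0 ux; rewrite /normal_fun -expRD ler_expR.
have ux2 : u ^+ 2 <= (x - m) ^+ 2.
  by rewrite -[leRHS]real_normK ?num_real// ler_sqr ?nnegrE.
have s2 : 0 < s ^+ 2 by rewrite exprn_gt0.
rewrite exprMn -(ler_pM2r s2).
rewrite (_ : _ / (s ^+ 2 *+ 2) * _ = - (x - m) ^+ 2 / 2); last by field; rewrite gt_eqF.
rewrite mulrDl (_ : _ / (2 ^+ 2 * s ^+ 2 *+ 2) * _ = - (x - m) ^+ 2 / 8); last first.
  by field; rewrite gt_eqF.
rewrite (_ : - (u ^+ 2 / _) * _ = - u ^+ 2 / 4); last by field; rewrite gt_eqF.
by move: ux2 (sqr_ge0 (x - m)); lra.
Qed.

Lemma measurable_dist_ge m u : measurable [set x : R | u <= `|x - m|].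
Proof.
rewrite (_ : [set _ | _] = (fun x => `|x - m|) @^-1` `[u, +oo[%classic); last first.
  by apply/seteqP; split => x /=; rewrite in_itv/= andbT.
rewrite -[X in measurable X]setTI.
have mf : measurable_fun [set: R] (fun x => `|x - m|).
  by apply: measurableT_comp => //; exact: measurable_funB.
exact: mf.
Qed.

Lemma measurable_norm_ball r : measurable [set x : R | `|x| <= r].
Proof.
rewrite (_ : [set _ | _] = `[- r, r]%classic)//.
by apply/seteqP; split => x /=; rewrite in_itv/= ler_norml.
Qed.

Lemma normal_prob_tail m s u : 0 < s -> 0 <= u ->
  (normal_prob m s [set x : R | (u <= `|x - m|)%R]
   <= (2 * expR (- (u ^+ 2 / (4 * s ^+ 2))))%:E)%E.
Proof.
move=> s0 u0.
have s20 : 0 < 2 * s by rewrite mulr_gt0.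
pose K := 2 * expR (- (u ^+ 2 / (4 * s ^+ 2))).
have K0 : 0 <= K by rewrite mulr_ge0// expR_ge0.
have mA := measurable_dist_ge m u.
apply: (@le_trans _ _ (\int[lebesgue_measure]_x (K * normal_pdf m (2 * s) x)%R%:E)%E).
  apply: (@le_trans _ _ (\int[lebesgue_measure]_(x in [set x : R | (u <= `|x - m|)%R])
      (K * normal_pdf m (2 * s) x)%R%:E)%E).
    apply: ge0_le_integral => //=.
    - by move=> x _; rewrite lee_fin normal_pdf_ge0.
    - by apply/measurable_EFinP; apply: measurable_funTS; exact: measurable_normal_pdf.
    - apply/measurable_EFinP; apply: measurable_funTS; apply: measurable_funM => //.
      exact: measurable_normal_pdf.
    - move=> x ux; rewrite lee_fin !normal_pdfE ?gt_eqF//.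
      (* The halved peak is the origin of the factor 2 in [K]. *)
      have -> : normal_peak (2 * s) = normal_peak s / 2.
        rewrite /normal_peak exprMn -mulrA -mulrnAr sqrtrM ?sqr_ge0//.
        by rewrite sqrtr_sqr ger0_norm// invfM mulrC.
      rewrite (_ : K * _ = normal_peak s *
        (expR (- (u ^+ 2 / (4 * s ^+ 2))) * normal_fun m (2 * s) x)); last first.
        by rewrite /K; field.
      rewrite ler_wpM2l ?normal_peak_ge0//.
      exact: normal_fun_scale_le.
  apply: ge0_subset_integral => //=.
    apply/measurable_EFinP; apply: measurable_funM => //.
    exact: measurable_normal_pdf.
  by move=> x _; rewrite lee_fin mulr_ge0 ?normal_pdf_ge0.
under eq_integral do rewrite EFinM.
rewrite ge0_integralZl//; last 2 first.
- by apply/measurable_EFinP; exact: measurable_normal_pdf.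
- by move=> x _; rewrite lee_fin normal_pdf_ge0.
by rewrite integral_normal_pdf mule1.
Qed.

End Gaussian.

Section GaussianVariable.
Context {R : realType} {disp : measure_display} {T : measurableType disp}.
Variables (P : probability T R) (Y : {RV P >-> R}).
Local Open Scope ereal_scope.

Lemma measurable_RV_preimage (Z : {RV P >-> R}) (B : set R) : measurable B ->
  measurable (Z @^-1` B).
Proof.
by move=> mB; rewrite -[X in measurable X]setTI; exact: measurable_funPT.
Qed.

Lemma Lfun2_RV (v : R) : 'E_P[(fun w => Y w ^+ 2)%R] = v%:E ->
  (Y : T -> R) \in Lfun P 2%:E.
Proof.
move=> EY2; rewrite inE; apply/andP; split; rewrite inE//=.
rewrite /finite_norm unlock /= poweR_lty//.
under eq_integral => x _ do rewrite -[2%R]/(2%:R)%R powR_mulrn// real_normK ?num_real//.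
by move: EY2; rewrite unlock => ->; rewrite ltry.
Qed.

Lemma expectation_sqr_dist (m v : R) : 'E_P[Y] = 0 ->
  'E_P[(fun w => Y w ^+ 2)%R] = v%:E ->
  'E_P[(fun w => (Y w - m) ^+ 2)%R] = (v + m ^+ 2)%:E.
Proof.
move=> EY EY2; have L2 := Lfun2_RV EY2.
have L1 : (Y : T -> R) \in Lfun P 1 by apply: Lfun_subset12 => //; exact: fin_num_measure.
have Lsq : (Y \* Y)%R \in Lfun P 1 by exact: Lfun2_mul_Lfun1.
have Lc : (cst (m ^+ 2)%R : T -> R) \in Lfun P 1 by exact: Lfun_cst.
have LZ : ((- 2 * m) \o* Y)%R \in Lfun P 1 by exact: Lfun_scale.
rewrite (_ : (fun w => _) = ((Y \* Y) \+ ((- 2 * m) \o* Y)) \+ cst (m ^+ 2))%R; last first.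
  by apply/funext => w /=; ring.
rewrite expectationD//; last by rewrite rpredD.
rewrite expectationD// expectationZl// EY mule0 adde0 expectation_cst.
by rewrite (_ : (Y \* Y)%R = (fun w => Y w ^+ 2)%R)// EY2.
Qed.

(** Layer-cake formula: the tail is at most [2 k] times the density of the exponential law of rate
    [1 / k], whose total mass is 1. *)
Lemma expectation_of_tail (W : {RV P >-> R}) (k : R) : (0 < k)%R ->
  (forall w, 0 <= W w)%R ->
  (forall r, (0 <= r)%R -> P [set w | (r <= W w)%R] <= (2 * expR (- (r / k)))%:E) ->
  'E_P[W] <= (2 * k)%:E.
Proof.
move=> k0 W0 Wtail; rewrite ge0_expectation_ccdf//.
have ki0 : (0 < k^-1)%R by rewrite invr_gt0.
have := @integral_exponential_pdf R k^-1%R ki0.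
move=> E1.
apply: (@le_trans _ _ (\int[lebesgue_measure]_x
   ((2 * k)%:E * (exponential_pdf k^-1 x)%:E))); last first.
  rewrite ge0_integralZl//; last 3 first.
  - by apply/measurable_EFinP; exact: measurable_exponential_pdf.
  - by move=> x _; rewrite lee_fin exponential_pdf_ge0// ltW.
  - by rewrite lee_fin mulr_ge0// ltW.
  by rewrite E1 mule1.
rewrite integral_mkcond; apply: ge0_le_integral => //=.
- by move=> x _; rewrite erestrict_ge0.
- apply/(measurable_restrictT _ _).1 => //; apply: measurable_funTS.
  exact: ccdf_measurable.
- by apply: emeasurable_funM => //; apply/measurable_EFinP; exact: measurable_exponential_pdf.
- move=> x _; rewrite patchE; case: ifPn => [|_]; last first.
    by rewrite -EFinM lee_fin mulr_ge0 ?exponential_pdf_ge0// ?mulr_ge0// ltW.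
  rewrite inE/= in_itv/= andbT => x0.
  apply: (@le_trans _ _ (P [set w | (x <= W w)%R])).
    rewrite /ccdf /distribution /pushforward le_measure ?inE//.
    - exact: measurable_RV_preimage.
    - rewrite (_ : [set _ | _] = W @^-1` `[x, +oo[%classic); last first.
        by apply/seteqP; split => w /=; rewrite in_itv/= andbT.
      exact: measurable_RV_preimage.
    - by move=> w /=; rewrite in_itv/= andbT => /ltW.
  apply: (le_trans (Wtail _ x0)).
  rewrite exponential_pdfE// -EFinM lee_fin/=.
  rewrite (_ : 2 * k * _ = 2 * expR (- k^-1 * x))%R; last first.
    by field; rewrite gt_eqF.
  by rewrite mulNr (mulrC k^-1%R).
Qed.

Lemma expectation_sqr_le (m s : R) : (0 < s)%R ->
  (forall B : set R, measurable B -> P (Y @^-1` B) = normal_prob m s B) ->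
  'E_P[(fun w => (Y w - m) ^+ 2)%R] <= (8 * s ^+ 2)%:E.
Proof.
move=> s0 lawY.
have mY : measurable_fun setT (fun w => (Y w - m) ^+ 2)%R.
  by apply: measurable_funX; exact: measurable_funB.
pose W : {RV P >-> R} := mfun_Sub (mem_set mY).
rewrite (_ : 8 * _ = 2 * (4 * s ^+ 2))%R; last by ring.
apply: (@expectation_of_tail W) => [|w|r r0]; rewrite ?sqr_ge0//.
  by rewrite mulr_gt0// exprn_gt0.
have := normal_prob_tail m s0 (sqrtr_ge0 r).
rewrite sqr_sqrtr// -lawY; last exact: measurable_dist_ge.
congr (P _ <= _); apply/seteqP; split => w /=.
  move=> h; rewrite -[leRHS]real_normK ?num_real//.
  by rewrite -{1}(sqr_sqrtr r0) ler_sqr ?nnegrE.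
by move=> h; rewrite -ler_sqr ?nnegrE// sqr_sqrtr// real_normK ?num_real.
Qed.

Lemma measurable_norm_le (r : R) : measurable [set w | (`|Y w| <= r)%R].
Proof.
exact: (@measurable_RV_preimage Y _ (measurable_norm_ball r)).
Qed.

Lemma measurable_norm_ge (m r : R) : measurable [set w | (r <= `|Y w - m|)%R].
Proof.
exact: (@measurable_RV_preimage Y _ (measurable_dist_ge m r)).
Qed.

Lemma measurable_norm_ge0 (r : R) : measurable [set w | (r <= `|Y w|)%R].
Proof.
by have := measurable_norm_ge 0 r; under eq_fun do rewrite subr0.
Qed.

Lemma chebyshev_sqr (v u : R) : (0 < u)%R -> 'E_P[(fun w => Y w ^+ 2)%R] = v%:E ->
  P [set w | (u <= `|Y w|)%R] <= (v / u ^+ 2)%:E.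
Proof.
move=> u0 EY2.
have u2 : (0 < u ^+ 2)%R by rewrite exprn_gt0.
rewrite EFinM lee_pdivlMr// -EY2 muleC.
have := @markov _ _ _ P Y (fun x => x ^+ 2)%R u u0.
rewrite (_ : ((fun x => x ^+ 2) \o (fun x => `|x|) \o Y)%R = (fun w => Y w ^+ 2)%R); last first.
  by apply/funext => w /=; rewrite real_normK ?num_real.
apply.
- by apply: measurable_funX.
- by move=> r _; rewrite sqr_ge0.
- by move=> x y x0 y0 xy; rewrite ler_sqr.
Qed.

(* [m] and [s] are not identified with [0] and [v ^ (1/2)]: the tail bound alone yields
   [E[(Y - m)^2] <= 8 s^2], which avoids the moments of the normal law. *)
Lemma gaussian_law_nondegenerate (v : R) : gaussian_rv P Y ->
  'E_P[Y] = 0 -> 'E_P[(fun w => Y w ^+ 2)%R] = v%:E -> (0 < v)%R ->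
  exists m s : R, [/\ (0 < s)%R, (v + m ^+ 2 <= 8 * s ^+ 2)%R &
    forall B : set R, measurable B -> P (Y @^-1` B) = normal_prob m s B].
Proof.
move=> [m [s [s0 lawY]]] EY EY2 v0.
have [s_eq0|sN0] := eqVneq s 0%R; last first.
  have {}s0 : (0 < s)%R by rewrite lt_neqAle eq_sym sN0.
  have {}lawY B : measurable B -> P (Y @^-1` B) = normal_prob m s B.
    by move=> mB; rewrite lawY// (negbTE sN0).
  exists m, s; split => //.
  by rewrite -lee_fin -(expectation_sqr_dist m EY EY2) expectation_sqr_le.
(* A point mass at [m] would make [E[(Y - m)^2] = v + m^2] vanish, against [0 < v]. *)
have Ym : P [set w | Y w <> m] = 0.
  have := lawY _ (measurableC (measurable_set1 m)).
  rewrite s_eq0 eqxx diracE/= memNset//=; exact.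
have aeYm : {ae P, forall w, (Y w - m) ^+ 2 = 0}%R.
  exists [set w | Y w <> m]; split => //.
    exact: (@measurable_RV_preimage Y _ (measurableC (measurable_set1 m))).
  by move=> w /= h Ywm; apply: h; rewrite Ywm subrr expr0n.
have : 'E_P[(fun w => (Y w - m) ^+ 2)%R] = 0.
  rewrite unlock (ae_eq_integral (cst 0)) ?integral0//.
  - by apply/measurable_EFinP; apply: measurable_funX; exact: measurable_funB.
  - by apply: filterS aeYm => w /= -> _.
rewrite (expectation_sqr_dist m EY EY2) => -[] /eqP.
by rewrite paddr_eq0 ?sqr_ge0 ?(ltW v0)// => /andP[/eqP v_eq0]; rewrite v_eq0 ltxx in v0.
Qed.

(** From [v + m^2 <= 8 s^2] the deviation [s] is at least [sqrt v / 3]; this is the 3 of the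
    bound. *)
Lemma gaussian_small_ball (v r : R) : gaussian_rv P Y ->
  'E_P[Y] = 0 -> 'E_P[(fun w => Y w ^+ 2)%R] = v%:E -> (0 < v)%R -> (0 <= r)%R ->
  P [set w | (`|Y w| <= r)%R] <= (3 * r / Num.sqrt v)%:E.
Proof.
move=> GY EY EY2 v0 r0.
have [m [s [s0 vms lawY]]] := gaussian_law_nondegenerate GY EY EY2 v0.
have := normal_prob_small_ball m s0 r0.
rewrite -lawY => [h|]; last exact: measurable_norm_ball.
apply: (le_trans h); rewrite lee_fin.
have sv : (0 < Num.sqrt v)%R by rewrite sqrtr_gt0.
rewrite ler_pdivrMr// mulrAC ler_pdivlMr//.
have : (Num.sqrt v <= 3 * s)%R.
  rewrite -ler_sqr ?nnegrE ?sqrtr_ge0 ?mulr_ge0 ?(ltW s0)// sqr_sqrtr ?(ltW v0)//.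
  by rewrite exprMn; move: vms (sqr_ge0 m) (sqr_ge0 s); lra.
by nra.
Qed.

(** This direction needs [s] from above and control of [m]. The constant 144 is [4 * 4 * 9]: half of
    [u] is lost to the mean, 4 comes from [normal_prob_tail], and [s^2 <= 9 v]. *)
Lemma gaussian_tail (v u : R) : gaussian_rv P Y ->
  'E_P[Y] = 0 -> 'E_P[(fun w => Y w ^+ 2)%R] = v%:E -> (0 < v)%R -> (0 <= u)%R ->
  P [set w | (u <= `|Y w|)%R] <= (16 * expR (- (u ^+ 2 / (144 * v))))%:E.
Proof.
move=> GY EY EY2 v0 u0.
have [m [s [s0 vms lawY]]] := gaussian_law_nondegenerate GY EY EY2 v0.
have sv : (0 < Num.sqrt v)%R by rewrite sqrtr_gt0.
(* Chebyshev leaves mass at least 3/4 within [2 sqrt v] of 0, where the normal law puts at most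
   [2 sqrt v / s]. *)
have sle : (s <= 3 * Num.sqrt v)%R.
  have P1 := normal_prob_small_ball m s0 (mulr_ge0 (ler0n R 2) (ltW sv)).
  rewrite -lawY in P1; last exact: measurable_norm_ball.
  have sv2 : (0 < 2 * Num.sqrt v)%R by rewrite mulr_gt0.
  have P2 := chebyshev_sqr sv2 EY2.
  rewrite exprMn sqr_sqrtr ?(ltW v0)// in P2.
  have : P setT <= (2 * Num.sqrt v / s)%:E + (v / (2 ^+ 2 * v))%:E.
    apply: le_trans (leeD P1 P2).
    rewrite (_ : setT = (Y @^-1` [set x | (`|x| <= 2 * Num.sqrt v)%R]) `|`
                [set w | (2 * Num.sqrt v <= `|Y w|)%R]); last first.
      apply/seteqP; split => w //= _.
      by case: (leP `|Y w|%R (2 * Num.sqrt v)%R) => [|/ltW]; [left|right].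
    apply: measureU2; first exact: measurable_norm_le.
    exact: measurable_norm_ge0.
  rewrite probability_setT -EFinD lee_fin.
  rewrite (_ : v / _ = 4^-1)%R; last by field; rewrite gt_eqF.
  move=> h; have : (3 / 4 <= 2 * Num.sqrt v / s)%R by move: h; lra.
  by rewrite ler_pdivlMr//; nra.
have s2v : (s ^+ 2 <= 9 * v)%R.
  rewrite -(sqr_sqrtr (ltW v0)) (_ : 9 = 3 ^+ 2)%R; last by ring.
  by rewrite -exprMn ler_sqr ?nnegrE// ltW// mulr_gt0.
(* If [u < 2 |m|], then [u^2 <= 288 v] and the bound is trivial, being at least
   [16 * expR (- 2) >= 1]. Otherwise [|Y| >= u] implies [|Y - m| >= u / 2]. *)
have [um|mu] := leP (2 * `|m|)%R u; last first.
  apply: (@le_trans _ _ 1); first exact/probability_le1/measurable_norm_ge0.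
  rewrite lee_fin expRN ler_pdivlMr ?expR_gt0// mul1r.
  have m2 : (`|m| ^+ 2 <= 72 * v)%R.
    by rewrite real_normK ?num_real//; move: vms s2v (ltW v0); lra.
  have u2 : (u ^+ 2 <= 288 * v)%R.
    have : (u ^+ 2 <= (2 * `|m|) ^+ 2)%R by rewrite ler_sqr ?nnegrE ?mulr_ge0// ltW.
    by rewrite exprMn; move: m2; lra.
  apply: (@le_trans _ _ (expR 2)).
    rewrite ler_expR ler_pdivrMr; last by rewrite mulr_gt0.
    by move: u2; lra.
  have e1 : (expR 2^-1 <= 2 :> R)%R.
    have := @expR_ge1Dx R (- 2^-1)%R.
    rewrite expRN -[leRHS]div1r ler_pdivlMr ?expR_gt0//.
    by have := expR_gt0 (2^-1 : R)%R; lra.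
  rewrite (_ : 2 = 4 * 2^-1)%R; last by field.
  rewrite expRM_natl (_ : 16 = 2 ^+ 4)%R; last by ring.
  by rewrite lerXn2r ?nnegrE ?expR_ge0.
apply: (@le_trans _ _ (P (Y @^-1` [set x | (u / 2 <= `|x - m|)%R]))).
  apply: le_measure; rewrite ?inE.
  - exact: measurable_norm_ge0.
  - exact: measurable_norm_ge.
  - move=> w /= h; have := lerB_dist (Y w) m; lra.
rewrite lawY; last exact: measurable_dist_ge.
have u20 : (0 <= u / 2)%R by rewrite divr_ge0.
apply: (le_trans (normal_prob_tail m s0 u20)); rewrite lee_fin.
apply: ler_pM; rewrite ?expR_ge0//; first by rewrite ler_nat.
rewrite ler_expR lerN2 expr_div_n.
have s2 : (0 < s ^+ 2)%R by rewrite exprn_gt0.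
rewrite ler_pdivlMr; last by rewrite mulr_gt0.
rewrite mulrAC ler_pdivrMr; last by rewrite mulr_gt0.
by have := sqr_ge0 u; nra.
Qed.

End GaussianVariable.

(** * The Euclidean norm *)

Section EuclideanNorm.
Context {R : realType} {d : nat}.
Implicit Types u x y : 'rV[R]_d.

Lemma enorm_coord_le u i : `|u ord0 i| <= enorm u.
Proof.
rewrite /enorm -sqrtr_sqr ler_wsqrtr// (bigD1 i)//= lerDl.
by rewrite sumr_ge0// => j _; rewrite sqr_ge0.
Qed.

Lemma enorm_le_coord u (h : R) : 0 <= h -> (forall i, `|u ord0 i| <= h) ->
  enorm u <= d%:R * h.
Proof.
move=> h0 uh; have dh : 0 <= d%:R * h by rewrite mulr_ge0.
rewrite /enorm -[leRHS]ger0_norm// -sqrtr_sqr ler_wsqrtr//.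
apply: (@le_trans _ _ (\sum_(i < d) h ^+ 2)).
  by apply: ler_sum => i _; rewrite -[leLHS]real_normK ?num_real// ler_sqr ?nnegrE.
rewrite sumr_const card_ord -[leLHS]mulr_natl exprMn ler_wpM2r ?sqr_ge0//.
rewrite -natrX ler_nat; case: (d) => // n.
by rewrite -[leqLHS]expn1 leq_pexp2l.
Qed.

Lemma enorm0 : enorm (0 : 'rV[R]_d) = 0.
Proof.
by rewrite /enorm big1 ?sqrtr0// => i _; rewrite mxE expr0n.
Qed.

Lemma enorm_eq0 u : enorm u = 0 -> forall i, u ord0 i = 0.
Proof.
by move=> u0 i; apply/normr0_eq0/le_anti; rewrite normr_ge0 -u0 enorm_coord_le.
Qed.

Lemma enormN x : enorm (- x) = enorm x.
Proof. by congr Num.sqrt; apply: eq_bigr => i _; rewrite mxE sqrrN. Qed.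

Lemma enorm_distC x y : enorm (x - y) = enorm (y - x).
Proof. by rewrite -enormN opprB. Qed.

Lemma enorm_triangle x y : enorm (x + y) <= enorm x + enorm y.
Proof.
pose a := enorm x; pose b := enorm y.
have a2 : a ^+ 2 = \sum_i x ord0 i ^+ 2 by rewrite sqr_sqrtr// sumr_ge0// => i _; rewrite sqr_ge0.
have b2 : b ^+ 2 = \sum_i y ord0 i ^+ 2 by rewrite sqr_sqrtr// sumr_ge0// => i _; rewrite sqr_ge0.
have a0 : 0 <= a by exact: sqrtr_ge0.
have b0 : 0 <= b by exact: sqrtr_ge0.
(* Cauchy-Schwarz, by expanding the sum of [(b x_i - a y_i)^2]; the case [a b = 0] is apart because
   the expansion is divided by [a b]. *)
have cs : \sum_i x ord0 i * y ord0 i <= a * b.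
  have [ab0|ab0] := eqVneq (a * b) 0.
    rewrite ab0 big1// => i _; move/eqP: ab0; rewrite mulf_eq0.
    by case/orP => /eqP/enorm_eq0/(_ i) ->; rewrite ?mul0r ?mulr0.
  have {}ab0 : 0 < a * b by rewrite lt_neqAle eq_sym ab0 mulr_ge0.
  have : 0 <= \sum_i (b * x ord0 i - a * y ord0 i) ^+ 2.
    by rewrite sumr_ge0// => i _; rewrite sqr_ge0.
  have -> : \sum_i (b * x ord0 i - a * y ord0 i) ^+ 2 =
      b ^+ 2 * (\sum_i x ord0 i ^+ 2) + a ^+ 2 * (\sum_i y ord0 i ^+ 2)
      - 2 * (a * b) * (\sum_i x ord0 i * y ord0 i).
    rewrite !mulr_sumr -big_split/= -sumrB; apply: eq_bigr => i _; ring.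
  rewrite -a2 -b2 => h.
  rewrite -(ler_pM2l ab0); move: h; set S := \sum_i _; nra.
rewrite -[leRHS]ger0_norm ?addr_ge0// -sqrtr_sqr ler_wsqrtr//.
have -> : \sum_i (x + y) ord0 i ^+ 2 = a ^+ 2 + b ^+ 2 + 2 * \sum_i x ord0 i * y ord0 i.
  rewrite a2 b2 mulr_sumr -!big_split/=; apply: eq_bigr => i _; rewrite !mxE; ring.
by rewrite -/a -/b sqrrD; move: cs; lra.
Qed.

End EuclideanNorm.

(** * Variance of the increments *)

Section Covariance.
Context {R : realType}.
Implicit Types (x y : R).

Lemma one_sub_expRN_ge y : 0 <= y -> y / (1 + y) <= 1 - expR (- y).
Proof.
move=> y0; have y1 : 0 < 1 + y by lra.
rewrite expRN lerBrDl -lerBrDr.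
rewrite (_ : 1 - _ = (1 + y)^-1); last by field; rewrite gt_eqF.
by rewrite lef_pV2 ?posrE ?expR_gt0// expR_ge1Dx.
Qed.

Lemma ln_one_add_ge y : 0 <= y -> y / (1 + y) <= ln (1 + y).
Proof.
move=> y0; have y1 : 0 < 1 + y by lra.
have := le_ln1Dx (x := (1 + y)^-1 - 1).
rewrite addrCA subrr addr0 lnV ?posrE// => h.
have : - ln (1 + y) <= (1 + y)^-1 - 1.
  by apply: h; rewrite ltrBrDl addrN invr_gt0.
rewrite (_ : y / _ = 1 - (1 + y)^-1); last by field; rewrite gt_eqF.
lra.
Qed.

Lemma ln_one_add_le y : 0 <= y -> ln (1 + y) <= y.
Proof. by move=> y0; apply: le_ln1Dx; lra. Qed.

Lemma ler_div1D y z : 0 <= y -> y <= z -> y / (1 + z) <= y / (1 + y).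
Proof.
by move=> y0 yz; rewrite ler_wpM2l// lef_pV2 ?posrE; lra.
Qed.

Lemma powR_le1 x r : 0 <= x <= 1 -> 0 <= r -> x `^ r <= 1.
Proof.
move=> /andP[x0 x1] r0.
by have := @ge0_ler_powR R r r0 x 1 x0 ler01 x1; rewrite powR1.
Qed.

Context {d : nat}.
Implicit Types u : 'rV[R]_d.

Variables sigma a c alpha beta gamma : R.
Hypotheses (hsigma : 0 < sigma) (ha : 0 < a) (hc : 0 < c).
Hypotheses (halpha : 0 < alpha) (hbeta : 0 < beta) (hgamma : 0 < gamma).

Definition incr_var u t := 2 * (sigma ^+ 2 - cov_fun sigma a c alpha beta gamma u t).

Lemma cov_fun0 : cov_fun sigma a c alpha beta gamma (0 : 'rV_d) 0 = sigma ^+ 2.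
Proof.
rewrite /cov_fun enorm0 normr0 !powR0 ?mulf_neq0 ?gt_eqF//.
by rewrite !mulr0 mul0r addr0 powR1 oppr0 expR0 divr1 mulr1.
Qed.

(** Once the power prefactor is moved into the exponential as a logarithm, all bounds on the
    increments reduce to [y / (1 + y) <= 1 - expR (- y) <= y]. *)
Lemma cov_fun_expR u t : cov_fun sigma a c alpha beta gamma u t =
  sigma ^+ 2 * expR (- (beta * d.+1%:R / 2 * ln (1 + a * `|t| `^ (2 * alpha)) +
    c * enorm u `^ (2 * gamma) /
      (1 + a * `|t| `^ (2 * alpha)) `^ (beta * gamma))).
Proof.
rewrite /cov_fun opprD expRD mulrA; congr (_ * _ * _).
have D0 : 0 < 1 + a * `|t| `^ (2 * alpha).
  by rewrite ltr_wpDr// mulr_ge0 ?powR_ge0// ltW.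
by rewrite /powR (gt_eqF D0) -expRN.
Qed.

Lemma incr_var_le : exists2 K : R, 0 < K & forall u t,
  incr_var u t <= K * (enorm u `^ (2 * gamma) + `|t| `^ (2 * alpha)).
Proof.
pose k := beta * d.+1%:R / 2.
have k0 : 0 < k by rewrite /k divr_gt0// mulr_gt0.
have s2 : 0 < sigma ^+ 2 by rewrite exprn_gt0.
exists (2 * sigma ^+ 2 * (k * a + c)).
  by rewrite mulr_gt0 ?addr_gt0 ?mulr_gt0.
move=> u t; rewrite /incr_var cov_fun_expR -/k.
set tau := `|t| `^ _; set E := enorm u `^ _.
have tau0 : 0 <= tau by exact: powR_ge0.
have E0 : 0 <= E by exact: powR_ge0.
have D1 : 1 <= 1 + a * tau by rewrite lerDl mulr_ge0// ltW.
set B := (1 + a * tau) `^ _.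
have B1 : 1 <= B by rewrite -(powRr0 (1 + a * tau)) ler_powR// mulr_ge0// ltW.
set y := k * _ + _.
have yle : y <= k * (a * tau) + c * E.
  rewrite /y lerD// ?ler_wpM2l ?(ltW k0)//.
    by apply: ln_one_add_le; rewrite mulr_ge0// ltW.
  by rewrite ler_pdivrMr ?ler_peMr ?mulr_ge0 ?(ltW hc)// (lt_le_trans _ B1).
have ey := expR_ge1Dx (- y).
rewrite -mulrA -mulrA ler_wpM2l//.
rewrite -{1}(mulr1 (sigma ^+ 2)) -mulrBr ler_wpM2l ?(ltW s2)//.
have : 0 <= k * a * E by rewrite !mulr_ge0// ltW.
have : 0 <= c * tau by rewrite mulr_ge0// ltW.
move: yle ey; rewrite mulrDl !mulrDr !mulrA; lra.
Qed.

(** Only the logarithm is kept, which leaves [u] arbitrary; since [tau <= 1], it is at least a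
    multiple of [tau]. *)
Lemma incr_var_ge_time : exists2 K : R, 0 < K & forall u t, `|t| <= 1 ->
  K * `|t| `^ (2 * alpha) <= incr_var u t.
Proof.
pose k := beta * d.+1%:R / 2.
have k0 : 0 < k by rewrite /k divr_gt0// mulr_gt0.
have s2 : 0 < sigma ^+ 2 by rewrite exprn_gt0.
have a1 : 0 < 1 + a by move: ha; lra.
pose q := k * a / (1 + a).
have q0 : 0 < q by rewrite /q divr_gt0// mulr_gt0.
exists (2 * sigma ^+ 2 * (q / (1 + q))).
  by rewrite !mulr_gt0// ?invr_gt0//; lra.
move=> u t t1; rewrite /incr_var cov_fun_expR -/k.
set tau := `|t| `^ _; set E := enorm u `^ _.
have tau0 : 0 <= tau by exact: powR_ge0.
have tau1 : tau <= 1.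
  by apply: powR_le1; rewrite ?normr_ge0 ?t1 ?mulr_ge0// ltW.
have E0 : 0 <= E by exact: powR_ge0.
have atau0 : 0 <= a * tau by rewrite mulr_ge0// ltW.
set B := (1 + a * tau) `^ _.
have B0 : 0 <= B by exact: powR_ge0.
set y := k * _ + _.
have yge : q * tau <= y.
  have cEB : 0 <= c * E / B by rewrite divr_ge0// mulr_ge0// ltW.
  apply: (@le_trans _ _ (k * ln (1 + a * tau))); last by rewrite /y lerDl.
  rewrite (_ : q * tau = k * (a * tau / (1 + a))); last by rewrite /q; ring.
  rewrite ler_wpM2l ?(ltW k0)//; apply: le_trans (ln_one_add_ge atau0).
  by apply: ler_div1D => //; rewrite ler_piMr// ltW.
have qt0 : 0 <= q * tau by rewrite mulr_ge0// ltW.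
have := one_sub_expRN_ge qt0.
have : expR (- y) <= expR (- (q * tau)) by rewrite ler_expR lerN2.
have : q * tau / (1 + q) <= q * tau / (1 + q * tau).
  by rewrite ler_wpM2l// lef_pV2 ?posrE; nra.
move=> h1 h2 h3.
rewrite -mulrA -mulrA ler_wpM2l//.
rewrite -{2}(mulr1 (sigma ^+ 2)) -mulrBr ler_wpM2l ?(ltW s2)//.
by rewrite mulrAC; lra.
Qed.

(** Only the spatial term is kept. [Bm] bounds its damping by time for [|t| <= 1], and [Em] bounds
    the power of [enorm u], so that [y / (1 + y)] is at least a multiple of [y]. *)
Lemma incr_var_ge_space : exists2 K : R, 0 < K & forall u t, `|t| <= 1 ->
  (forall i, `|u ord0 i| <= 1) -> forall i,
  K * `|u ord0 i| `^ (2 * gamma) <= incr_var u t.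
Proof.
have s2 : 0 < sigma ^+ 2 by rewrite exprn_gt0.
have a1 : 1 <= 1 + a by move: ha; lra.
pose Bm := (1 + a) `^ (beta * gamma).
have Bm0 : 0 < Bm by rewrite powR_gt0//; lra.
pose Em : R := d%:R `^ (2 * gamma).
have Em0 : 0 <= Em by exact: powR_ge0.
pose q := c / Bm.
have q0 : 0 < q by rewrite divr_gt0.
have qE : 0 <= q * Em by rewrite mulr_ge0// ltW.
exists (2 * sigma ^+ 2 * (q / (1 + q * Em))).
  by rewrite !mulr_gt0// ?invr_gt0//; lra.
move=> u t t1 u1 i; rewrite /incr_var cov_fun_expR.
set tau := `|t| `^ _; set E := enorm u `^ _.
have tau0 : 0 <= tau by exact: powR_ge0.
have tau1 : tau <= 1.
  by apply: powR_le1; rewrite ?normr_ge0 ?t1 ?mulr_ge0// ltW.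
have e0 : 0 <= enorm u by exact: sqrtr_ge0.
have g2 : 0 <= 2 * gamma by rewrite mulr_ge0// ltW.
have uE : `|u ord0 i| `^ (2 * gamma) <= E.
  by rewrite ge0_ler_powR ?nnegrE// enorm_coord_le.
have EEm : E <= Em.
  by rewrite ge0_ler_powR ?nnegrE//; have := enorm_le_coord ler01 u1; rewrite mulr1.
have E0 : 0 <= E by exact: powR_ge0.
have atau0 : 0 <= a * tau by rewrite mulr_ge0// ltW.
set B := (1 + a * tau) `^ _.
have B0 : 0 < B by rewrite powR_gt0//; lra.
have BBm : B <= Bm.
  rewrite ge0_ler_powR ?nnegrE ?mulr_ge0 ?(ltW hbeta) ?(ltW hgamma)//; try lra.
  by rewrite lerD2l ler_piMr// ltW.
set y := _ + c * E / B.
have yge : q * E <= y.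
  apply: (@le_trans _ _ (c * E / B)).
    rewrite /q mulrAC ler_wpM2l ?mulr_ge0// ?(ltW hc)//.
    by rewrite lef_pV2 ?posrE.
  rewrite /y lerDr mulr_ge0 ?ln_ge0 ?divr_ge0 ?mulr_ge0 ?(ltW hbeta)//; lra.
have qE0 : 0 <= q * E by rewrite mulr_ge0// ltW.
have := one_sub_expRN_ge qE0.
have : expR (- y) <= expR (- (q * E)) by rewrite ler_expR lerN2.
have : q * E / (1 + q * Em) <= q * E / (1 + q * E).
  have : q * E <= q * Em by rewrite ler_wpM2l// ltW.
  by move=> ?; rewrite ler_wpM2l// lef_pV2 ?posrE; lra.
move=> h1 h2 h3.
rewrite -mulrA -mulrA ler_wpM2l//.
rewrite -{2}(mulr1 (sigma ^+ 2)) -mulrBr ler_wpM2l ?(ltW s2)//.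
apply: (@le_trans _ _ (q * E / (1 + q * Em))); last lra.
by rewrite mulrAC ler_wpM2r ?invr_ge0 ?ler_wpM2l ?(ltW q0)//; lra.
Qed.

End Covariance.

(** * Increments of the field *)

Section CylinderEvents.
Context {R : realType} {I : Type}.

(** Both [same_law] and [independent_fields] speak of cylinder events; this makes them apply to
    increments. *)
Lemma cylinder_increment (y z : I) (B : set R) : measurable B ->
  cylinder_sets [set f : I -> R | B (f y - f z)].
Proof.
move=> mB.
pose G : set (set (I -> R)) := [set C | exists z : I, exists2 B : set R,
  measurable B & C = [set f | B (f z)]].
have meval (x : I) : measurable_fun [set: g_sigma_algebraType G]
    (fun f : g_sigma_algebraType G => (f : I -> R) x).
  move=> _ A mA; rewrite setTI; apply: sub_sigma_algebra.
  by exists x; exists A.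
have mdiff : measurable_fun [set: g_sigma_algebraType G]
    (fun f : g_sigma_algebraType G => (f : I -> R) y - (f : I -> R) z).
  exact: measurable_funB.
have := mdiff measurableT _ mB.
by rewrite setTI.
Qed.

End CylinderEvents.

Lemma lee_prod {R : realDomainType} (I : Type) (r : seq I) (F G : I -> \bar R) :
  (forall i, (0 <= F i <= G i)%E) -> (\prod_(i <- r) F i <= \prod_(i <- r) G i)%E.
Proof.
move=> FG; suff : ((0 <= \prod_(i <- r) F i)%E /\ (\prod_(i <- r) F i <= \prod_(i <- r) G i)%E).
  by case.
apply: (big_ind2 (fun x y : \bar R => (0 <= x)%E /\ (x <= y)%E)) => [|x y x' y' [? ?] [? ?]|i _].
- by rewrite lee01.
- by split; [exact: mule_ge0|exact: lee_pmul].
- by have /andP[] := FG i.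
Qed.

Section Increments.
Context {R : realType} {d : nat}.
Variables sigma a c alpha beta gamma : R.
Hypotheses (hsigma : 0 < sigma) (ha : 0 < a) (hc : 0 < c).
Hypotheses (halpha : 0 < alpha) (hbeta : 0 < beta) (hgamma : 0 < gamma).
Local Notation incr_var := (incr_var sigma a c alpha beta gamma).

Section GaussianField.
Context {disp : measure_display} {T : measurableType disp}.
Variables (P : probability T R) (X : 'rV[R]_d * R -> {RV P >-> R}).
Hypothesis hXgauss : gaussian_field P X.
Hypothesis hXcent : centered_field P X.
Hypothesis hXcov : forall (x y : 'rV[R]_d) (t s : R),
  ('E_P[(fun w => X (x + y, t + s) w * X (y, s) w)%R] =
   (cov_fun sigma a c alpha beta gamma x t)%:E)%E.
Implicit Types y z : 'rV[R]_d * R.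
Local Open Scope ereal_scope.

Let incr y z : {RV P >-> R} := (X y \- X z)%R.

Lemma field_covariance y z : 'E_P[(fun w => X y w * X z w)%R] =
  (cov_fun sigma a c alpha beta gamma (y.1 - z.1) (y.2 - z.2))%:E.
Proof.
rewrite -(hXcov _ z.1 _ z.2) !subrK.
by rewrite -!surjective_pairing.
Qed.

Lemma field_Lfun2 z : (X z : T -> R) \in Lfun P 2%:E.
Proof.
apply: (@Lfun2_RV _ _ _ _ _ (cov_fun sigma a c alpha beta gamma (0 : 'rV_d) 0)).
have := field_covariance z z; rewrite !subrr => <-.
by under eq_fun do rewrite expr2.
Qed.

Lemma incr_gaussian y z : gaussian_rv P (incr y z).
Proof.
have := hXgauss (fun j : 'I_2 => if j == ord0 then y else z)
               (fun j : 'I_2 => if j == ord0 then 1 else - 1)%R.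
rewrite (_ : (fun w => _) = incr y z :> (T -> R))//.
apply/funext => w; rewrite big_ord_recl big_ord_recl big_ord0 /=.
by rewrite mul1r mulN1r addr0.
Qed.

Lemma incr_mean y z : 'E_P[incr y z] = 0.
Proof.
have L1 x : (X x : T -> R) \in Lfun P 1.
  by apply: Lfun_subset12; [exact: fin_num_measure|exact: field_Lfun2].
by rewrite expectationB// !hXcent subee.
Qed.

Lemma incr_second_moment y z : 'E_P[(fun w => incr y z w ^+ 2)%R] =
  (incr_var (y.1 - z.1) (y.2 - z.2))%:E.
Proof.
have L2 := field_Lfun2.
have Lm x x' : (X x \* X x')%R \in Lfun P 1 by exact: Lfun2_mul_Lfun1.
have LZ : ((- 2) \o* (X y \* X z))%R \in Lfun P 1 by exact: Lfun_scale.
rewrite (_ : (fun w => _) =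
  ((X y \* X y) \+ ((- 2) \o* (X y \* X z))) \+ (X z \* X z))%R; last first.
  by apply/funext => w /=; ring.
rewrite expectationD//; last by rewrite rpredD.
rewrite expectationD// expectationZl//.
rewrite !field_covariance !subrr !cov_fun0// -EFinM -!EFinD.
by congr (_%:E); rewrite /incr_var; ring.
Qed.

End GaussianField.

Variables (disp0 : measure_display) (T0 : measurableType disp0).
Variables (P0 : probability T0 R) (X : 'rV[R]_d * R -> {RV P0 >-> R}).
Hypothesis hXgauss : gaussian_field P0 X.
Hypothesis hXcent : centered_field P0 X.
Hypothesis hXcov : forall (x y : 'rV[R]_d) (t s : R),
  ('E_P0[(fun w => X (x + y, t + s) w * X (y, s) w)%R] =
   (cov_fun sigma a c alpha beta gamma x t)%:E)%E.
Variables (p : nat) (disp : measure_display) (T : measurableType disp).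
Variables (P : probability T R) (Xs : 'I_p -> 'rV[R]_d * R -> {RV P >-> R}).
Hypothesis hXscopy : forall i, same_law P P0 (Xs i) X.
Hypothesis hXsindep : independent_fields P (fun i z => Xs i z).
Implicit Types y z : 'rV[R]_d * R.

(** The range of lags in which the lower bounds on the variance hold; any two points of the unit
    cube qualify. *)
Definition close_pair y z := (forall i, `|y.1 ord0 i - z.1 ord0 i| <= 1) /\
  `|y.2 - z.2| <= 1.

(** [q] is a lower bound for the anisotropic distance, the maximum of the [|x_i|^gamma] and
    [|t|^alpha]. The disjunction allows each coordinate to be exploited on its own. *)
Definition separated (q : R) y z := q <= `|y.2 - z.2| `^ alpha \/
  exists i, q <= `|y.1 ord0 i - z.1 ord0 i| `^ gamma.

Lemma incr_law i y z (B : set R) : measurable B ->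
  P [set w | B (Xs i y w - Xs i z w)] = P0 [set w | B (X y w - X z w)].
Proof.
by move=> mB; have := hXscopy i (cylinder_increment y z mB).
Qed.

Lemma incr_var_separated : exists2 K : R, 0 < K & forall y z (q : R), close_pair y z ->
  0 < q -> separated q y z -> K * q ^+ 2 <= incr_var (y.1 - z.1) (y.2 - z.2).
Proof.
have [K1 K10 hK1] := @incr_var_ge_time R d _ _ _ _ _ gamma hsigma ha hc halpha hbeta.
have [K2 K20 hK2] := @incr_var_ge_space R d _ _ _ _ _ _ hsigma ha hc halpha hbeta hgamma.
exists (Num.min K1 K2); first by rewrite lt_min K10 K20.
move=> y z q [yz1 yz2] q0 sepq.
have sq (b e : R) : 0 <= b -> (b `^ e) ^+ 2 = b `^ (2 * e).
  by move=> b0; rewrite -powR_mulrn ?powR_ge0// -powRrM mulrC.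
have u1 i : `|(y.1 - z.1) ord0 i| <= 1 by rewrite !mxE.
case: sepq => [qle|[i qle]].
- apply: le_trans (hK1 (y.1 - z.1) _ yz2).
  rewrite -sq// ler_pM ?sqr_ge0 ?le_min ?(ltW K10) ?(ltW K20)//.
    by rewrite ge_min lexx.
  by rewrite ler_sqr ?nnegrE ?powR_ge0// ltW.
- apply: le_trans (hK2 _ _ yz2 u1 i).
  rewrite -sq// ler_pM ?sqr_ge0 ?le_min ?(ltW K10) ?(ltW K20)//.
    by rewrite ge_min lexx orbT.
  by rewrite !mxE ler_sqr ?nnegrE ?powR_ge0// ltW.
Qed.

Lemma incr_joint_small_ball : exists2 C : R, 0 < C & forall y z (q r : R), close_pair y z ->
  0 < q -> separated q y z -> 0 <= r ->
  (P [set w | forall i, (`|Xs i y w - Xs i z w| <= r)%R] <= ((C * r / q) ^+ p)%:E)%E.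
Proof.
have [K K0 hK] := incr_var_separated.
exists (3 / Num.sqrt K); first by rewrite divr_gt0// sqrtr_gt0.
move=> y z q r cyz q0 sq r0.
have mB := measurable_norm_ball r.
have := hXsindep (C := fun _ => _) (fun i => cylinder_increment y z mB).
rewrite (_ : \bigcap_i _ = [set w | forall i, (`|Xs i y w - Xs i z w| <= r)%R]);
  last by apply/seteqP; split => w /= h i; [exact: (h i)|move=> _; exact: (h i)].
move=> ->.
have -> : (3 / Num.sqrt K * r / q) ^+ p = \prod_(i < p) (3 / Num.sqrt K * r / q).
  by rewrite prodr_const card_ord.
rewrite -prodEFin; apply: lee_prod => i; rewrite measure_ge0/=.
rewrite [X in (X <= _)%E](incr_law i y z mB).
have v0 : 0 < incr_var (y.1 - z.1) (y.2 - z.2).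
  by apply: lt_le_trans (hK _ _ _ cyz q0 sq); rewrite mulr_gt0// exprn_gt0.
apply: (le_trans (@gaussian_small_ball _ _ _ P0 (X y \- X z) _ r
  (incr_gaussian hXgauss y z) (incr_mean hXcent hXcov y z)
  (incr_second_moment hXcov y z) v0 r0)).
set sv := Num.sqrt _.
have sv0 : 0 < sv by rewrite sqrtr_gt0.
have sK0 : 0 < Num.sqrt K by rewrite sqrtr_gt0.
rewrite lee_fin (_ : _ * r / q = 3 * r / (Num.sqrt K * q)); last first.
  by field; rewrite !gt_eqF.
rewrite ler_wpM2l ?mulr_ge0//.
rewrite lef_pV2 ?posrE ?(mulr_gt0 sK0 q0)//.
rewrite -[leLHS]ger0_norm ?mulr_ge0 ?sqrtr_ge0 ?(ltW q0)// -sqrtr_sqr.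
by rewrite ler_wsqrtr// exprMn sqr_sqrtr ?(ltW K0)// hK.
Qed.

Lemma incr_tail : exists2 K : R, 0 < K & forall (h : R) y z, close_pair y z -> 0 < h ->
  (forall i, `|y.1 ord0 i - z.1 ord0 i| <= h `^ gamma^-1) ->
  `|y.2 - z.2| <= h `^ alpha^-1 -> forall i (u : R), 0 <= u ->
  (P [set w | (u <= `|Xs i y w - Xs i z w|)%R] <=
   (16 * expR (- (u ^+ 2 / (K * h ^+ 2))))%:E)%E.
Proof.
have [K1 K10 hK1] := @incr_var_le R d _ _ _ alpha _ _ hsigma ha hc hbeta hgamma.
have [K2 K20 hK2] := incr_var_separated.
pose K := K1 * (d%:R `^ (2 * gamma) + 1).
have K0 : 0 < K by rewrite mulr_gt0// ltr_wpDl// powR_ge0.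
exists (144 * K); first by rewrite mulr_gt0.
move=> h y z cyz h0 hx ht i u u0.
have mB : measurable [set x : R | u <= `|x|].
  by have := measurable_dist_ge (0 : R) u; under eq_fun do rewrite subr0.
rewrite [X in (X <= _)%E](incr_law i y z mB)/=.
(* At [y = z] the variance is 0 and [gaussian_tail] does not apply: the event is empty unless
   [u = 0], where the bound is 16. Distinct points are separated at some level [q], so their
   variance is positive. *)
have [yz|yz] := eqVneq y z.
  have [->|uN0] := eqVneq u 0.
    rewrite expr0n/= mul0r oppr0 expR0 mulr1.
    apply: (@le_trans _ _ 1%E); last by rewrite lee_fin ler1n.
    exact/probability_le1/(measurable_norm_ge0 (X y \- X z)).
  rewrite (_ : [set w | _] = set0) ?measure0 ?lee_fin ?mulr_ge0 ?expR_ge0//.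
  apply/seteqP; split => w //=; rewrite yz subrr normr0 => h'.
  by move: uN0; rewrite eq_le h' u0.
have [q q0 sq] : exists2 q, 0 < q & separated q y z.
  have [t0|t0] := eqVneq y.2 z.2; last first.
    exists (`|y.2 - z.2| `^ alpha); last by left.
    by rewrite powR_gt0// normr_gt0 subr_eq0.
  have [j xj] : exists j, y.1 ord0 j != z.1 ord0 j.
    apply/not_existsP => xx; move: yz; rewrite [y]surjective_pairing.
    rewrite [z]surjective_pairing t0 => /negP; apply; apply/eqP; congr pair.
    by apply/rowP => j; apply/eqP; apply: contrapT => /negP; exact: xx.
  exists (`|y.1 ord0 j - z.1 ord0 j| `^ gamma); last by right; exists j.
  by rewrite powR_gt0// normr_gt0 subr_eq0.
have v0 : 0 < incr_var (y.1 - z.1) (y.2 - z.2).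
  by apply: lt_le_trans (hK2 _ _ _ cyz q0 sq); rewrite mulr_gt0// exprn_gt0.
apply: (le_trans (@gaussian_tail _ _ _ P0 (X y \- X z) _ u
  (incr_gaussian hXgauss y z) (incr_mean hXcent hXcov y z)
  (incr_second_moment hXcov y z) v0 u0)).
rewrite lee_fin ler_wpM2l// ler_expR lerN2 ler_wpM2l ?sqr_ge0//.
have h2 : 0 < h ^+ 2 by rewrite exprn_gt0.
rewrite lef_pV2 ?posrE; last 2 first.
- exact: (mulr_gt0 (mulr_gt0 (ltr0n R 144) K0) h2).
- exact: (mulr_gt0 (ltr0n R 144) v0).
rewrite -mulrA ler_wpM2l//.
apply: (le_trans (hK1 _ _)).
rewrite /K -mulrA ler_wpM2l ?(ltW K10)// [leRHS]mulrDl [1 * _]mul1r.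
have hp (e : R) : 0 < e -> (h `^ e^-1) `^ (2 * e) = h ^+ 2.
  move=> e0; rewrite -powRrM (_ : _ * _ = 2); last by field; rewrite gt_eqF.
  by rewrite powR_mulrn// ltW.
apply: lerD; last first.
  rewrite -(hp _ halpha) ge0_ler_powR ?nnegrE ?powR_ge0//.
  by rewrite mulr_ge0// ltW.
rewrite -(hp _ hgamma) -powRM ?powR_ge0//.
rewrite ge0_ler_powR ?nnegrE ?mulr_ge0 ?powR_ge0 ?sqrtr_ge0// ?(ltW hgamma)//.
by apply: enorm_le_coord; [exact: powR_ge0|move=> j; rewrite !mxE; exact: hx].
Qed.

End Increments.

(** * Upper bounds for the Hausdorff dimension *)

Section HausdorffUpper.
Context {R : realType} {n : nat}.
Implicit Types (A U : set 'rV[R]_n) (s : R).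

Lemma ediam_ge0 U : (0 <= ediam U)%E.
Proof. by apply: ereal_sup_ubound; left. Qed.

Lemma ediam_le U (r : R) : 0 <= r ->
  (forall x y, U x -> U y -> enorm (x - y) <= r) -> (ediam U <= r%:E)%E.
Proof.
move=> r0 Ur; apply: ge_ereal_sup => _ [->|[x Ux [y Uy <-]]]; rewrite lee_fin//.
exact: Ur.
Qed.

Lemma ediam_ge U x y : U x -> U y -> ((enorm (x - y))%:E <= ediam U)%E.
Proof.
by move=> Ux Uy; apply: ereal_sup_ubound; right; exists x => //; exists y.
Qed.

Lemma hausdorff_gauge_ge0 s U : (0 <= hausdorff_gauge s U)%E.
Proof. by rewrite /hausdorff_gauge; case: ifP => // _; exact: poweR_ge0. Qed.

Lemma hausdorff_gauge_le s U (r : R) : 0 <= s -> 0 <= r -> (ediam U <= r%:E)%E ->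
  (hausdorff_gauge s U <= (r `^ s)%:E)%E.
Proof.
move=> s0 r0 Ur; rewrite /hausdorff_gauge; case: ifP => _.
  by rewrite lee_fin powR_ge0.
rewrite -poweR_EFin; apply: gt0_ler_poweR => //.
  by rewrite in_itv/= ediam_ge0 leey.
by rewrite in_itv/= lee_fin r0 leey.
Qed.

Lemma hausdorff_premeasure_ge0 s (delta : R) A :
  (0 <= hausdorff_premeasure s delta A)%E.
Proof.
apply: le_ereal_inf_tmp => _ [U _ <-].
by apply: nneseries_ge0 => k _ _; exact: hausdorff_gauge_ge0.
Qed.

Lemma hausdorff_measure_eq0 s A : (forall delta : R, 0 < delta ->
    (hausdorff_premeasure s delta A <= 0)%E) -> hausdorff_measure s A = 0%E.
Proof.
move=> H; apply/eqP; rewrite eq_le; apply/andP; split.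
  by apply: ge_ereal_sup => _ [delta /= d0 <-]; exact: H.
apply: (le_trans (hausdorff_premeasure_ge0 s 1 A)).
by apply: ereal_sup_ubound; exists 1 => /=.
Qed.

Lemma hausdorff_premeasure_le_fin (J : finType) (U : J -> set 'rV[R]_n) A s
    (delta r : R) : 0 <= s -> 0 <= r <= delta ->
  A `<=` \bigcup_j U j -> (forall j, (ediam (U j) <= r%:E)%E) ->
  (hausdorff_premeasure s delta A <= (#|J|%:R * r `^ s)%:E)%E.
Proof.
move=> s0 /andP[r0 rd] AU Ur.
(* The finite family is padded with empty sets, whose gauge is 0. *)
pose V k := nth set0 [seq U j | j <- enum J] k.
have diamV k : (ediam (V k) <= r%:E)%E.
  rewrite /V; have [kJ|Jk] := ltnP k (size [seq U j | j <- enum J]).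
    have /mapP[j _ ->] := mem_nth set0 kJ.
    exact: Ur.
  by rewrite nth_default//; apply: ediam_le.
have coverV : delta_cover delta A V.
  split => [x Ax|k]; last by rewrite (le_trans (diamV k)) ?lee_fin.
  have [j _ Ujx] := AU _ Ax; exists (enum_rank j) => //.
  rewrite /V (nth_map j); last by rewrite -cardE ltn_ord.
  by rewrite nth_enum_rank.
apply: (@le_trans _ _ (\sum_(0 <= k <oo) hausdorff_gauge s (V k))%E).
  by apply: ereal_inf_lbound; exists V.
rewrite (nneseries_split 0 #|J|); last by move=> k _; exact: hausdorff_gauge_ge0.
rewrite add0n [X in (_ + X)%E]eseries0 ?adde0; last first.
  move=> k Jk _; have -> : V k = set0 by rewrite /V nth_default// size_map -cardE.
  by rewrite /hausdorff_gauge eqxx.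
rewrite big_mkord.
apply: (@le_trans _ _ (\sum_(k < #|J|) (r `^ s)%:E)%E).
  by apply: lee_sum => k _; apply: hausdorff_gauge_le.
by rewrite sumEFin lee_fin sumr_const card_ord -[leLHS]mulr_natl.
Qed.

Lemma hausdorff_dim_le A (s0 : R) : 0 <= s0 ->
  (forall s, s0 < s -> hausdorff_measure s A = 0%E) ->
  (hausdorff_dim A <= s0%:E)%E.
Proof.
move=> s00 H; apply/lee_addgt0Pr => e e0; apply: ereal_inf_lbound.
exists (s0 + e) => //; split; first by rewrite addr_ge0// ltW.
by apply: H; rewrite ltrDl.
Qed.

(** The exponent 0 is apart because the energy argument reaches only [0 < s]; there, a set of the
    cover that contains a given point already has gauge 1. *)
Lemma hausdorff_dim_ge A (s0 : R) :
  (forall s, 0 < s < s0 -> hausdorff_measure s A <> 0%E) ->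
  hausdorff_measure 0 A <> 0%E -> (s0%:E <= hausdorff_dim A)%E.
Proof.
move=> H H0; apply: le_ereal_inf_tmp => _ [s [s_ge0 Hs] <-].
rewrite lee_fin leNgt; apply/negP => ss0.
move: s_ge0; rewrite le_eqVlt => /predU1P[s_eq0|s_gt0].
  by apply: H0; rewrite s_eq0.
by apply: (H s) => //; rewrite s_gt0.
Qed.

Lemma hausdorff_measure0_neq0 A : A !=set0 -> hausdorff_measure 0 A <> 0%E.
Proof.
move=> [x Ax] H.
suff : (1 <= hausdorff_measure 0 A)%E by rewrite H lee_fin ler10.
apply: (@le_trans _ _ (hausdorff_premeasure 0 1 A)); last first.
  by apply: ereal_sup_ubound; exists 1 => /=.
apply: le_ereal_inf_tmp => _ [U [AU _] <-].
have [k _ Ukx] := AU _ Ax.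
have gk : hausdorff_gauge 0 (U k) = 1%E.
  rewrite /hausdorff_gauge ifF ?poweRe0//; apply/negbTE/eqP => Uk0.
  by rewrite Uk0 in Ukx.
rewrite -gk.
have g0 j : (0 <= hausdorff_gauge 0 (U j))%E by exact: hausdorff_gauge_ge0.
rewrite (nneseries_split 0 k.+1)// add0n big_mkord big_ord_recr/=.
rewrite addeAC leeDr// adde_ge0//; first by rewrite sume_ge0.
by apply: nneseries_ge0.
Qed.

(** A cover is encoded as the fibres of an index map into a finite type. The factor [n + 1],
    positive even for [n = 0], pays for passing from coordinates to the Euclidean norm. *)
Lemma hausdorff_measure_fibers (Z : Type) (Phi : Z -> 'rV[R]_n) (D : set Z) s :
  0 < s -> (forall e delta : R, 0 < e -> 0 < delta ->
    exists (J : finType) (idx : Z -> J) (h : R), [/\ 0 <= h <= delta,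
      forall y z, D y -> D z -> idx y = idx z ->
        forall j, `|Phi y ord0 j - Phi z ord0 j| <= h &
      #|J|%:R * h `^ s <= e]) ->
  hausdorff_measure s (Phi @` D) = 0%E.
Proof.
move=> s0 H; apply: hausdorff_measure_eq0 => delta delta0.
have N0 : 0 < n%:R + 1 :> R by rewrite ltr_wpDl.
apply/lee_addgt0Pr => e e0; rewrite add0e.
have c0 : 0 < (n%:R + 1 :> R) `^ s by rewrite powR_gt0.
have [|J [idx [h [/andP[h0 hd] hidx hJ]]]] :=
  H (e / (n%:R + 1) `^ s) (delta / (n%:R + 1)) (divr_gt0 e0 c0).
  by rewrite divr_gt0.
have hs0 : 0 <= (n%:R + 1) * h by rewrite mulr_ge0// ltW.
apply: (@le_trans _ _ (#|J|%:R * ((n%:R + 1) * h) `^ s)%:E).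
  apply: (@hausdorff_premeasure_le_fin J
    (fun j => Phi @` (D `&` [set z | idx z = j]))) => //; first exact: ltW.
  - by rewrite hs0/= mulrC -ler_pdivlMr.
  - by move=> _ [z Dz <-]; exists (idx z) => //; exists z.
  - move=> j; apply: ediam_le => // _ _ [y [Dy yj] <-] [z [Dz zj] <-].
    apply: (@le_trans _ _ (n%:R * h)); last by rewrite ler_wpM2r// lerDl.
    apply: enorm_le_coord => // i; rewrite !mxE; apply: hidx => //.
    by rewrite yj zj.
rewrite lee_fin powRM// ?(ltW N0)// mulrCA mulrC.
by rewrite -ler_pdivlMr.
Qed.

End HausdorffUpper.

(** * Anisotropic dyadic grids *)

Section GridCover.
Context {R : realType}.

(** Number of cells per unit length at scale [2 ^ (- k A)]; the successor makes the cells strictly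
    shorter than that. Different [A] in space and time give the anisotropic boxes. *)
Definition mesh (A : R) (k : nat) : nat := (Num.truncn (2 `^ (k%:R * A))).+1.

Lemma pow2_ge1 (e : R) : 0 <= e -> 1 <= 2 `^ e.
Proof. by move=> e0; have := ler_powR (ler1n R 2) e0; rewrite powRr0. Qed.

Lemma mesh_gt (A : R) k : 2 `^ (k%:R * A) < (mesh A k)%:R.
Proof. exact: truncnS_gt. Qed.

Lemma mesh_le (A : R) k : 0 <= A -> (mesh A k)%:R <= 2 * 2 `^ (k%:R * A).
Proof.
move=> A0; have p1 : 1 <= 2 `^ (k%:R * A) :> R.
  by rewrite pow2_ge1// mulr_ge0.
have : (Num.truncn (2 `^ (k%:R * A)))%:R <= 2 `^ (k%:R * A) :> R.
  by rewrite truncn_le// powR_ge0.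
by rewrite /mesh -natr1; lra.
Qed.

Lemma mesh_gt0 (A : R) k : 0 < (mesh A k)%:R :> R.
Proof. by rewrite ltr0n. Qed.

Lemma eq_truncn_close (x y m : R) : 0 < m -> 0 <= x -> 0 <= y ->
  Num.truncn (m * x) = Num.truncn (m * y) -> `|x - y| <= m^-1.
Proof.
move=> m0 x0 y0 xy.
have /andP[x1 x2] := truncn_itv (mulr_ge0 (ltW m0) x0).
have /andP[y1 y2] := truncn_itv (mulr_ge0 (ltW m0) y0).
rewrite -[m^-1]mul1r ler_pdivlMr// -{1}(gtr0_norm m0) -normrM.
rewrite ler_norml; rewrite xy in x1 x2; rewrite -natr1 in x2 y2.
by rewrite mulrBl ![_ * m]mulrC; apply/andP; split; lra.
Qed.

Definition grid_floor (m : nat) (x : R) : R := (Num.truncn (m%:R * x))%:R / m%:R.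

Lemma grid_floor_dist (m : nat) (x : R) : (0 < m)%N -> 0 <= x -> 0 <= x - grid_floor m x <= m%:R^-1.
Proof.
move=> m0 x0; have mR : 0 < m%:R :> R by rewrite ltr0n.
have /andP[x1 x2] := truncn_itv (mulr_ge0 (ltW mR) x0).
rewrite /grid_floor; set N := Num.truncn _ in x1 x2 *.
rewrite -natr1 in x2; apply/andP; split.
  by rewrite subr_ge0 ler_pdivrMr// mulrC.
rewrite lerBlDr -[X in _ <= X + _]mul1r -mulrDl ler_pdivlMr// mulrC addrC.
exact: ltW.
Qed.

Lemma truncn_lt_of_le (x : R) (m : nat) : x <= m%:R -> (Num.truncn x < m.+1)%N.
Proof.
by move=> xm; rewrite ltnS truncn_le_nat (le_lt_trans xm)// ltr_nat.
Qed.

Context {d : nat}.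

Definition grid_proj (a b : R) (k : nat) (z : 'rV[R]_d * R) : 'rV[R]_d * R :=
  (\row_i grid_floor (mesh a k) (z.1 ord0 i), grid_floor (mesh b k) z.2).

(** The [.+1] leaves room for the coordinate 1, whose index is the mesh itself. *)
Definition grid_idx (a b : R) (k : nat) (z : 'rV[R]_d * R) :
    {ffun 'I_d -> 'I_(mesh a k).+1} * 'I_(mesh b k).+1 :=
  ([ffun i => inord (Num.truncn ((mesh a k)%:R * z.1 ord0 i))],
   inord (Num.truncn ((mesh b k)%:R * z.2))).

Definition grid_point (a b : R) (k : nat)
    (g : {ffun 'I_d -> 'I_(mesh a k).+1} * 'I_(mesh b k).+1) : 'rV[R]_d * R :=
  (\row_i ((g.1 i)%:R / (mesh a k)%:R), (g.2)%:R / (mesh b k)%:R).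

Lemma truncn_cube_lt (m : nat) (x : R) : 0 <= x <= 1 ->
  (Num.truncn (m%:R * x) < m.+1)%N.
Proof. by move=> /andP[x0 x1]; apply: truncn_lt_of_le; rewrite ler_piMr. Qed.

Lemma grid_pointK (a b : R) k z : unit_cube z ->
  grid_point (grid_idx a b k z) = grid_proj a b k z.
Proof.
move=> [z1 z2]; rewrite /grid_point /grid_proj /=; congr pair.
  by apply/rowP => i; rewrite !mxE ffunE inordK// truncn_cube_lt.
by rewrite inordK// truncn_cube_lt.
Qed.

Lemma grid_point_cube (a b : R) k (g : {ffun 'I_d -> 'I_(mesh a k).+1} * 'I_(mesh b k).+1) :
  unit_cube (grid_point g).
Proof.
have H (m : nat) (i : 'I_m.+1) : (0 < m)%N -> 0 <= (i%:R / m%:R : R) <= 1.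
  move=> m0; rewrite divr_ge0//= ler_pdivrMr ?ltr0n// mul1r ler_nat.
  by rewrite -ltnS.
by split => [i|] /=; rewrite ?mxE; exact: H.
Qed.

Lemma card_grid_le (a b : R) k : 0 <= a -> 0 <= b ->
  #|{: {ffun 'I_d -> 'I_(mesh a k).+1} * 'I_(mesh b k).+1}|%:R <=
  4 ^+ d.+1 * 2 `^ (k%:R * (d%:R * a + b)) :> R.
Proof.
move=> a0 b0; rewrite card_prod card_ffun !card_ord natrM natrX.
have H (c : R) : 0 <= c -> (mesh c k).+1%:R <= 4 * 2 `^ (k%:R * c) :> R.
  move=> c0; have := mesh_le k c0; have := mesh_gt0 c k.
  have p1 : 1 <= 2 `^ (k%:R * c) :> R.
    by rewrite pow2_ge1// mulr_ge0.
  by rewrite -natr1; lra.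
rewrite exprSr (_ : k%:R * (d%:R * a + b) = k%:R * a * d%:R + k%:R * b); last by ring.
rewrite powRD ?pnatr_eq0 ?implybT// mulrACA.
apply: ler_pM; rewrite ?exprn_ge0 ?ler0n//; last exact: H.
by rewrite powRrM powR_mulrn ?powR_ge0// -exprMn lerXn2r ?nnegrE ?mulr_ge0 ?powR_ge0 ?H.
Qed.

End GridCover.

(** * Covers from oscillation bounds *)

Section UpperBound.
Context {R : realType}.

Lemma pow2N_eventually_le (c kappa e : R) : 0 <= c -> 0 < kappa -> 0 < e ->
  exists k0 : nat, forall k, (k0 <= k)%N -> c * 2 `^ (- (k%:R * kappa)) <= e.
Proof.
move=> c0 kap0 e0.
have l2 : 0 < ln 2 :> R by rewrite ln_gt0// ltr1n.
have ekl : 0 < e * (kappa * ln 2) by rewrite !mulr_gt0.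
exists (Num.truncn (c / (e * (kappa * ln 2)))).+1 => k hk.
have kc : c / (e * (kappa * ln 2)) <= k%:R.
  by apply/ltW/(lt_le_trans (truncnS_gt _)); rewrite ler_nat.
have k0 : 0 < k%:R :> R by rewrite ltr0n (leq_trans _ hk).
have : k%:R * kappa * ln 2 <= 2 `^ (k%:R * kappa).
  have -> : 2 `^ (k%:R * kappa) = expR (k%:R * kappa * ln 2).
    by rewrite /powR pnatr_eq0.
  by apply: le_trans (expR_ge1Dx _); rewrite lerDr.
rewrite powRN ler_pdivrMr ?powR_gt0// => /(ler_wpM2l (ltW e0)).
apply: le_trans; move: kc; rewrite ler_pdivrMr//; lra.
Qed.

Section Osc.
Context {d p n : nat}.
Variables (F : 'I_p -> 'rV[R]_d * R -> R) (Phi : 'rV[R]_d * R -> 'rV[R]_n).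
Hypothesis Phi_close : forall (h : R) (y z : 'rV[R]_d * R),
  (forall i, `|y.1 ord0 i - z.1 ord0 i| <= h) ->
  `|y.2 - z.2| <= h -> (forall i, `|F i y - F i z| <= h) ->
  forall j, `|Phi y ord0 j - Phi z ord0 j| <= h.

(** Oscillation is measured from the lower corner of the box. [k0] and [C] may depend on the path,
    since Borel-Cantelli only gives a random rank. *)
Definition osc_bound (a b e : R) := exists (k0 : nat) (C : R), 0 <= C /\
  forall k z i, (k0 <= k)%N -> unit_cube z ->
  `|F i z - F i (grid_proj a b k z)| <= C * 2 `^ (- (k%:R * e)).

(** There are of order [2 ^ (k (d a + b))] boxes, of sides at most [h = 2 ^ (- k theta)] because
    [theta <= a] and [theta <= b]. Over each, the values lie in a cube of side of order
    [2 ^ (- k e)], cut into [2 ^ (k p (theta - e))] cubes of side [h]. The product with [h ^ s]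
    decays like [2 ^ (- k kap)]. *)
Lemma hausdorff_measure_osc (a b e theta s : R) : 0 < e <= theta ->
  theta <= a -> theta <= b -> 0 < s ->
  d%:R * a + b + p%:R * (theta - e) < theta * s -> osc_bound a b e ->
  hausdorff_measure s (Phi @` @unit_cube R d) = 0%E.
Proof.
move=> /andP[e0 eth] ha hb s0 hs [k0 [C [C0 osc]]].
have th0 : 0 < theta by apply: lt_le_trans eth.
have a0 : 0 <= a by rewrite ltW// (lt_le_trans th0).
have b0 : 0 <= b by rewrite ltW// (lt_le_trans th0).
apply: hausdorff_measure_fibers => // eps delta eps0 delta0.
pose c0 : R := 4 ^+ d.+1 * (2 * C + 1) ^+ p.
have c00 : 0 <= c0 by rewrite mulr_ge0// exprn_ge0// addr_ge0// mulr_ge0.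
pose kap := theta * s - (d%:R * a + b + p%:R * (theta - e)).
have kap0 : 0 < kap by rewrite subr_gt0.
have [k1 hk1] := pow2N_eventually_le c00 kap0 eps0.
have [k2 hk2] := pow2N_eventually_le ler01 th0 delta0.
pose k := maxn k0 (maxn k1 k2).
have kk0 : (k0 <= k)%N by rewrite leq_max leqnn.
have kk1 : (k1 <= k)%N by rewrite !leq_max leqnn orbT.
have kk2 : (k2 <= k)%N by rewrite !leq_max leqnn !orbT.
pose h : R := 2 `^ (- (k%:R * theta)).
have h0 : 0 < h by rewrite powR_gt0.
pose w : R := C * 2 `^ (- (k%:R * e)).
have w0 : 0 <= w by rewrite mulr_ge0// powR_ge0.
pose N := Num.truncn (2 * w / h).
(* Values are indexed relative to the corner of the box, and [w] makes them nonnegative. Points of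
   equal index share the corner, so relative values differ exactly as the values do. *)
pose idx z := (grid_idx a b k z, [ffun i => inord (Num.truncn
    (h^-1 * (F i z - F i (grid_proj a b k z) + w))) : 'I_N.+1]).
exists _, idx, h; split.
- by rewrite (ltW h0)/= -[h]mul1r; exact: hk2.
- have meshh (m : R) : theta <= m -> (mesh m k)%:R^-1 <= h.
    move=> thm; rewrite /h powRN lef_pV2 ?posrE ?powR_gt0 ?mesh_gt0//.
    apply/ltW/(le_lt_trans _ (mesh_gt m k)).
    by rewrite ler_powR ?ler1n// ler_wpM2l.
  move=> y z Dy Dz [] /ffunP yz1 /(congr1 val)/= yz2 /ffunP yz3 j.
  have [y1 y2] := Dy; have [z1 z2] := Dz.
  have x1 i : `|y.1 ord0 i - z.1 ord0 i| <= h.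
    apply: le_trans (meshh _ ha).
    have /andP[? _] := y1 i; have /andP[? _] := z1 i.
    apply: eq_truncn_close; rewrite ?mesh_gt0//.
    by have := yz1 i; rewrite !ffunE => /(congr1 val)/=; rewrite !inordK// truncn_cube_lt.
  have x2 : `|y.2 - z.2| <= h.
    apply: le_trans (meshh _ hb).
    have /andP[? _] := y2; have /andP[? _] := z2.
    apply: eq_truncn_close; rewrite ?mesh_gt0//.
    by move: yz2; rewrite !inordK// truncn_cube_lt.
  apply: Phi_close => // i.
  have pyz : grid_proj a b k y = grid_proj a b k z.
    rewrite -!grid_pointK//; congr grid_point; congr pair; first exact/ffunP.
    by apply: val_inj.
  have Fb u : unit_cube u -> 0 <= F i u - F i (grid_proj a b k u) + w <= 2 * w.
    move=> Du; have := osc k u i kk0 Du; rewrite -/w ler_norml => /andP[? ?].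
    by apply/andP; split; lra.
  have /andP[Fy0 Fyw] := Fb y Dy; have /andP[Fz0 Fzw] := Fb z Dz.
  have lt u : unit_cube u ->
      (Num.truncn (h^-1 * (F i u - F i (grid_proj a b k u) + w)) < N.+1)%N.
    move=> Du; rewrite ltnS; apply: le_truncn; rewrite mulrC.
    by rewrite ler_wpM2r ?invr_ge0 ?(ltW h0)//; have /andP[] := Fb u Du.
  have hV : 0 < h^-1 by rewrite invr_gt0.
  have := @eq_truncn_close R _ _ h^-1 hV Fy0 Fz0.
  rewrite invrK pyz; set u := F i y + _ + _; set v := F i z + _ + _.
  have -> : F i y - F i z = u - v by rewrite /u /v; ring.
  apply; have := yz3 i; rewrite !ffunE => /(congr1 val)/=.
  by rewrite !inordK ?lt// /u /v pyz.
- apply: le_trans (hk1 k kk1).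
  rewrite card_prod [#|{: {ffun _ -> 'I_N.+1}}|]card_ffun !card_ord natrM natrX.
  have NC : N.+1%:R <= (2 * C + 1) * 2 `^ (k%:R * (theta - e)) :> R.
    have N1 : N%:R <= 2 * w / h by rewrite truncn_le divr_ge0// ?mulr_ge0// ltW.
    have p1 : 1 <= 2 `^ (k%:R * (theta - e)) :> R.
      by rewrite pow2_ge1// mulr_ge0// subr_ge0.
    have E1 : 2 * w / h = 2 * C * 2 `^ (k%:R * (theta - e)).
      rewrite /w /h -powRN opprK -!mulrA -powRD ?pnatr_eq0 ?implybT//.
      by congr (_ * (_ * _ `^ _)); ring.
    by rewrite -natr1; move: N1; rewrite E1; lra.
  rewrite /c0 -mulrA (_ : - (k%:R * kap) = k%:R * (d%:R * a + b) +
      (k%:R * (theta - e) * p%:R + - (k%:R * theta) * s)); last first.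
    by rewrite /kap; ring.
  rewrite powRD ?pnatr_eq0 ?implybT// [_ `^ (_ + _ * s)]powRD ?pnatr_eq0 ?implybT//.
  rewrite [2 `^ (- _ * s)]powRrM -/h.
  rewrite [leRHS](_ : _ = (4 ^+ d.+1 * 2 `^ (k%:R * (d%:R * a + b))) *
    ((2 * C + 1) ^+ p * 2 `^ (k%:R * (theta - e) * p%:R) * h `^ s)); last by ring.
  apply: ler_pM; rewrite ?mulr_ge0 ?powR_ge0 ?exprn_ge0//.
    exact: card_grid_le.
  rewrite ler_wpM2r ?powR_ge0// powRrM powR_mulrn ?powR_ge0// -exprMn.
  by rewrite lerXn2r ?nnegrE// mulr_ge0 ?powR_ge0// addr_ge0// mulr_ge0.
Qed.

(** One level is enough: finitely many corner values, plus one oscillation. *)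
Lemma osc_bound_bounded (a b e : R) : osc_bound a b e ->
  exists2 M : R, 0 <= M & forall i z, unit_cube z -> `|F i z| <= M.
Proof.
move=> [k [C [C0 osc]]]; pose w : R := C * 2 `^ (- (k%:R * e)).
have w0 : 0 <= w by rewrite mulr_ge0// powR_ge0.
pose S := \sum_(i < p) \sum_g `|F i (@grid_point R d a b k g)|.
have S0 : 0 <= S by rewrite sumr_ge0// => i _; rewrite sumr_ge0.
exists (w + S); first by rewrite addr_ge0.
move=> i z Dz; rewrite -[F i z](subrK (F i (grid_proj a b k z))).
apply: (le_trans (ler_normD _ _)); apply: lerD; first exact: osc.
rewrite -grid_pointK// /S (bigD1 i)//= (bigD1 (grid_idx a b k z))//=.
rewrite -addrA lerDl addr_ge0// ?sumr_ge0// => *; exact: sumr_ge0.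
Qed.

End Osc.

Lemma hausdorff_measure_bounded (Z : Type) (D : set Z) (p : nat)
    (Phi : Z -> 'rV[R]_p) (M s : R) : 0 <= M -> 0 < s -> p%:R < s ->
  (forall z i, D z -> `|Phi z ord0 i| <= M) ->
  hausdorff_measure s (Phi @` D) = 0%E.
Proof.
move=> M0 s0 ps PhiM; apply: hausdorff_measure_fibers => // eps delta eps0 delta0.
pose c0 : R := (2 * M + 1) ^+ p.
have c00 : 0 <= c0 by rewrite exprn_ge0// addr_ge0// mulr_ge0.
have kap0 : 0 < s - p%:R by rewrite subr_gt0.
have [k1 hk1] := pow2N_eventually_le c00 kap0 eps0.
have [k2 hk2] := pow2N_eventually_le ler01 ltr01 delta0.
pose k := maxn k1 k2.
have kk1 : (k1 <= k)%N by rewrite !leq_max leqnn.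
have kk2 : (k2 <= k)%N by rewrite !leq_max leqnn !orbT.
pose h : R := 2 `^ (- k%:R).
have h0 : 0 < h by rewrite powR_gt0.
pose N := Num.truncn (2 * M / h).
pose idx z := [ffun i => inord (Num.truncn (h^-1 * (Phi z ord0 i + M))) : 'I_N.+1].
exists _, idx, h; split.
- by rewrite (ltW h0)/= -[h]mul1r /h -[k%:R]mulr1; exact: hk2.
- move=> y z Dy Dz /ffunP yz i.
  have Pb u : D u -> 0 <= Phi u ord0 i + M <= 2 * M.
    move=> Du; have := PhiM u i Du; rewrite ler_norml => /andP[? ?].
    by apply/andP; split; lra.
  have /andP[y0 _] := Pb y Dy; have /andP[z0 _] := Pb z Dz.
  have lt u : D u -> (Num.truncn (h^-1 * (Phi u ord0 i + M)) < N.+1)%N.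
    move=> Du; rewrite ltnS; apply: le_truncn; rewrite mulrC.
    by rewrite ler_wpM2r ?invr_ge0 ?(ltW h0)//; have /andP[] := Pb u Du.
  have hV : 0 < h^-1 by rewrite invr_gt0.
  have := @eq_truncn_close R _ _ h^-1 hV y0 z0.
  have -> : Phi y ord0 i - Phi z ord0 i = Phi y ord0 i + M - (Phi z ord0 i + M) by ring.
  rewrite invrK; apply; have := yz i; rewrite !ffunE => /(congr1 val)/=.
  by rewrite !inordK ?lt.
- apply: le_trans (hk1 k kk1).
  rewrite card_ffun !card_ord natrX.
  have NM : N.+1%:R <= (2 * M + 1) * 2 `^ k%:R :> R.
    have N1 : N%:R <= 2 * M / h by rewrite truncn_le divr_ge0// ?mulr_ge0// ltW.
    have p1 : 1 <= 2 `^ k%:R :> R by rewrite pow2_ge1.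
    have E1 : 2 * M / h = 2 * M * 2 `^ k%:R by rewrite /h -powRN opprK.
    by rewrite -natr1; move: N1; rewrite E1; lra.
  rewrite /c0 (_ : - (k%:R * (s - p%:R)) = k%:R * p%:R + - k%:R * s); last by ring.
  rewrite powRD ?pnatr_eq0 ?implybT// [2 `^ (- _ * s)]powRrM -/h mulrA.
  rewrite ler_wpM2r ?powR_ge0// powRrM powR_mulrn ?powR_ge0// -exprMn.
  by rewrite lerXn2r ?nnegrE// mulr_ge0 ?powR_ge0// addr_ge0// mulr_ge0.
Qed.

End UpperBound.

(** * Modulus of continuity by chaining *)

Section FiniteUnion.
Context {R : realType} {disp : measure_display} {T : measurableType disp}.
Variable P : probability T R.

Lemma measurable_fin_union (J : finType) (E : J -> set T) :
  (forall j, measurable (E j)) -> measurable (\bigcup_j E j).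
Proof.
by move=> mE; apply: fin_bigcup_measurable => //; exact: finite_finset.
Qed.

Lemma probability_fin_union_le (J : finType) (E : J -> set T) (c : R) :
  (forall j, measurable (E j)) -> (forall j, (P (E j) <= c%:E)%E) ->
  (P (\bigcup_j E j) <= (#|J|%:R * c)%:E)%E.
Proof.
move=> mE PE; pose E' n := if insub n is Some i then E (enum_val (i : 'I_#|J|)) else set0.
have mE' n : measurable (E' n) by rewrite /E'; case: insub.
have -> : \bigcup_j E j = \big[setU/set0]_(n < #|J|) E' n.
  rewrite -bigcup_mkord; apply/seteqP; split => w /=.
    move=> [j _ Ej]; exists (enum_rank j) => /=; first exact: ltn_ord.
    by rewrite /E' valK enum_rankK.
  by move=> [n /= nJ]; rewrite /E' insubT/= => h; exists (enum_val (Ordinal nJ)).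
apply: (le_trans (Boole_inequality _ (fun i _ => mE' i))).
apply: (@le_trans _ _ (\sum_(i < #|J|) c%:E)%E).
  by apply: lee_sum => i _; rewrite /E' valK PE.
by rewrite sumEFin lee_fin sumr_const card_ord -[leLHS]mulr_natl.
Qed.

Lemma borel_cantelli_geometric (B : (set T)^nat) (c : R) : 0 <= c ->
  (forall k, measurable (B k)) -> (forall k, (P (B k) <= (c * 2^-1 ^+ k)%:E)%E) ->
  {ae P, forall w, exists k0, forall k, (k0 <= k)%N -> ~ B k w}.
Proof.
move=> c0 mB PB.
have sB : (\sum_(k <oo) P (B k) < +oo)%E.
  apply: (@le_lt_trans _ _ (c * 2)%:E); last exact: ltry.
  apply: lime_le; first by apply: is_cvg_nneseries.
  apply: nearW => n; rewrite big_mkord.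
  apply: (@le_trans _ _ (\sum_(i < n) (c * 2^-1 ^+ i)%:E)%E).
    by apply: lee_sum => i _.
  rewrite sumEFin lee_fin -mulr_sumr ler_wpM2l//.
  have -> : \sum_(i < n) (2^-1 : R) ^+ i = 2 - 2 * 2^-1 ^+ n.
    elim: n => [|n IH]; first by rewrite big_ord0 expr0; ring.
    by rewrite big_ord_recr/= IH exprSr; field.
  by rewrite lerBlDr lerDl mulr_ge0.
exists (lim_sup_set B); split.
- by apply: bigcap_measurable => // k _; apply: bigcup_measurable.
- exact: lim_sup_set_cvg0.
- move=> w /= nw k _ /=; apply: contrapT => h; apply: nw.
  by exists k => j kj Bj; apply: h; exists j.
Qed.

End FiniteUnion.

Section Chaining.
Context {R : realType} {d p : nat}.
Context {disp : measure_display} {T : measurableType disp}.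
Variables (P : probability T R) (Xs : 'I_p -> 'rV[R]_d * R -> {RV P >-> R}).
Variables alpha gamma K : R.
Hypotheses (halpha : 0 < alpha) (hgamma : 0 < gamma) (K0 : 0 < K).
Hypothesis Xs_tail : forall (h : R) (y z : 'rV[R]_d * R), close_pair y z -> 0 < h ->
  (forall i, `|y.1 ord0 i - z.1 ord0 i| <= h `^ gamma^-1) ->
  `|y.2 - z.2| <= h `^ alpha^-1 -> forall i (u : R), 0 <= u ->
  (P [set w | (u <= `|Xs i y w - Xs i z w|)%R] <=
   (16 * expR (- (u ^+ 2 / (K * h ^+ 2))))%:E)%E.
Hypothesis Xs_cont : forall i, continuous_samples P (Xs i).

(** A power suffices against the number of pairs of grid points, itself a power of [2 ^ k]. *)
Lemma expRN_le_pow (y : R) (q : nat) : 0 < y -> expR (- y) <= q.+1`!%:R / y ^+ q.+1.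
Proof.
move=> y0; rewrite expRN ler_pdivlMr ?exprn_gt0// mulrC ler_pdivrMr ?expR_gt0//.
have := expR_ge1Dxn q (ltW y0); have : 0 < q.+1`!%:R :> R by rewrite ltr0n fact_gt0.
move=> f0 h; rewrite mulrC -ler_pdivrMr//; apply: le_trans h.
by rewrite lerDr.
Qed.

Lemma grid_floor_close (m : R) (k l : nat) (x : R) : 0 <= m -> 0 <= x -> (k <= l)%N ->
  `|grid_floor (mesh m k) x - grid_floor (mesh m l) x| <= 2 `^ (- (k%:R * m)).
Proof.
move=> m0 x0 kl.
have H (j : nat) : (k <= j)%N -> (mesh m j)%:R^-1 <= 2 `^ (- (k%:R * m)).
  move=> kj; rewrite powRN lef_pV2 ?posrE ?powR_gt0 ?mesh_gt0//.
  apply/ltW/(le_lt_trans _ (mesh_gt m j)).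
  by rewrite ler_powR ?ler1n// ler_wpM2r// ler_nat.
have /andP[k1 k2] := @grid_floor_dist R (mesh m k) x isT x0.
have /andP[l1 l2] := @grid_floor_dist R (mesh m l) x isT x0.
have := H k (leqnn _); have := H l kl.
by rewrite ler_norml => *; apply/andP; split; lra.
Qed.

Lemma grid_proj_cvg (a b : R) (z : 'rV[R]_d * R) : 0 < a -> 0 < b -> unit_cube z ->
  grid_proj a b k z @[k --> \oo] --> z.
Proof.
move=> a0 b0 [z1 z2].
have H (m x e : R) : 0 < m -> 0 <= x -> 0 < e ->
    \forall k \near \oo, `|x - grid_floor (mesh m k) x| < e.
  move=> m0 x0 e0.
  have e20 : 0 < e / 2 by rewrite divr_gt0.
  have [k0 hk0] := pow2N_eventually_le ler01 m0 e20.
  exists k0 => // k /= kk0.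
  have /andP[k1 k2] := @grid_floor_dist R (mesh m k) x isT x0.
  rewrite ger0_norm//; apply: (le_lt_trans k2).
  apply: (@le_lt_trans _ _ (e / 2)); last by lra.
  apply: le_trans (hk0 k kk0); rewrite mul1r powRN lef_pV2 ?posrE ?powR_gt0 ?mesh_gt0//.
  exact/ltW/mesh_gt.
apply/cvg_ballP => e e0.
have H1 : \forall k \near \oo, forall i, `|z.1 ord0 i - grid_floor (mesh a k) (z.1 ord0 i)| < e.
  by apply: filter_forall => i; apply: H => //; have /andP[] := z1 i.
have H2 : \forall k \near \oo, `|z.2 - grid_floor (mesh b k) z.2| < e.
  by apply: H => //; have /andP[] := z2.
apply: filterS2 H1 H2 => k h1 h2; split => //=; split => // j i; rewrite mxE.
by rewrite /ball/= (ord1 j); exact: h1.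
Qed.

(** A jump of size [2 ^ (- k e)] between neighbouring corners, whose increment is of order
    [2 ^ (- k)], has probability at most [16 * expR (- 2 ^ (2 k (1 - e)) / K)]; this is where
    [e < 1] is used. *)
Lemma osc_bound_ae (a b e : R) : gamma^-1 <= a -> alpha^-1 <= b -> 0 < e < 1 ->
  {ae P, forall w, osc_bound (fun i z => Xs i z w) a b e}.
Proof.
move=> ha hb /andP[e0 e1].
have a0 : 0 < a by apply: lt_le_trans ha; rewrite invr_gt0.
have b0 : 0 < b by apply: lt_le_trans hb; rewrite invr_gt0.
pose G k : finType := ({ffun 'I_d -> 'I_(mesh a k).+1} * 'I_(mesh b k).+1)%type.
pose pt k (g : G k) : 'rV[R]_d * R := grid_point g.
pose near_pt k (g : G k) (g' : G k.+1) :=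
  (forall i, `|(pt k g).1 ord0 i - (pt k.+1 g').1 ord0 i| <= (2 `^ (- k%:R)) `^ gamma^-1)
  /\ `|(pt k g).2 - (pt k.+1 g').2| <= (2 `^ (- k%:R)) `^ alpha^-1.
(* The deterministic condition [near_pt] empties the event for distant corners, so that the union
   may run over all pairs. *)
pose E k (j : 'I_p * (G k * G k.+1)) : set T :=
  [set w | near_pt k j.2.1 j.2.2 /\
    2 `^ (- (k%:R * e)) <= `|Xs j.1 (pt k j.2.1) w - Xs j.1 (pt k.+1 j.2.2) w|].
have mE k j : measurable (E k j).
  rewrite /E; have [nj|nj] := pselect (near_pt k j.2.1 j.2.2).
    rewrite (_ : [set w | _] = [set w | 2 `^ (- (k%:R * e)) <=
      `|(Xs j.1 (pt k j.2.1) \- Xs j.1 (pt k.+1 j.2.2)) w|]).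
      exact: measurable_norm_ge0.
    by apply/seteqP; split => w //= -[].
  by rewrite (_ : [set w | _] = set0)//; apply/seteqP; split => w //= -[].
pose D := d%:R * a + b.
have D0 : 0 <= D by rewrite addr_ge0 ?mulr_ge0 ?(ltW a0) ?(ltW b0).
(* At level [k] there are of order [2 ^ (2 k D)] pairs of corners; a decay with exponent [2 D + 1]
   leaves [2 ^ (- k)] after the union, and the power [q + 1] of the exponential bound provides
   it. *)
pose q := Num.truncn ((2 * D + 1) / (2 * (1 - e))).
have q1 : (2 * D + 1) <= 2 * (1 - e) * q.+1%:R.
  rewrite [leRHS]mulrC -ler_pdivrMr ?mulr_gt0 ?subr_gt0//.
  exact/ltW/truncnS_gt.
pose c := p%:R * (4 ^+ d.+1 * (4 ^+ d.+1 * 2 `^ D)) * (16 * (q.+1`!%:R * K ^+ q.+1)).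
have c0 : 0 <= c.
  rewrite /c; do !(apply: mulr_ge0 => //); rewrite ?exprn_ge0 ?powR_ge0//.
  exact: ltW.
have PE k j : (P (E k j) <= (16 * (q.+1`!%:R * K ^+ q.+1) *
    2 `^ (- (k%:R * (2 * D + 1))))%:E)%E.
  have rhs0 : 0 <= 16 * (q.+1`!%:R * K ^+ q.+1) * 2 `^ (- (k%:R * (2 * D + 1))).
    by rewrite mulr_ge0 ?powR_ge0// !mulr_ge0// exprn_ge0// ltW.
  have [[n1 n2]|nj] := pselect (near_pt k j.2.1 j.2.2); last first.
    rewrite (_ : E k j = set0) ?measure0 ?lee_fin//.
    by apply/seteqP; split => w //= -[].
  have [gk1 gk2] := @grid_point_cube R d a b k j.2.1.
  have [gl1 gl2] := @grid_point_cube R d a b k.+1 j.2.2.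
  have cl (x y : R) : 0 <= x <= 1 -> 0 <= y <= 1 -> `|x - y| <= 1.
    by move=> /andP[? ?] /andP[? ?]; rewrite ler_norml; apply/andP; split; lra.
  have clp : close_pair (pt k j.2.1) (pt k.+1 j.2.2).
    by split => [i|]; apply: cl.
  have h0 : 0 < 2 `^ (- k%:R) :> R by rewrite powR_gt0.
  have u0 : 0 <= 2 `^ (- (k%:R * e)) :> R by rewrite powR_ge0.
  apply: (@le_trans _ _ (P [set w | 2 `^ (- (k%:R * e)) <=
      `|Xs j.1 (pt k j.2.1) w - Xs j.1 (pt k.+1 j.2.2) w|]%R)).
    apply: le_measure; rewrite ?inE//; last by move=> w [].
    exact: (measurable_norm_ge0 (Xs j.1 (pt k j.2.1) \- Xs j.1 (pt k.+1 j.2.2))).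
  apply: (le_trans (Xs_tail clp h0 n1 n2 j.1 u0)).
  rewrite lee_fin -mulrA ler_wpM2l//.
  have -> : (2 `^ (- (k%:R * e))) ^+ 2 / (K * (2 `^ (- k%:R)) ^+ 2) =
      2 `^ (k%:R * (2 * (1 - e))) / K :> R.
    rewrite invfM mulrCA mulrC; congr (_ / _).
    rewrite -!powR_mulrn ?powR_ge0// -!powRrM -powRN -powRD ?pnatr_eq0 ?implybT//.
    by congr (_ `^ _); ring.
  have y0 : 0 < 2 `^ (k%:R * (2 * (1 - e))) / K by rewrite divr_gt0// powR_gt0.
  apply: (le_trans (expRN_le_pow q y0)).
  rewrite -mulrA ler_wpM2l// expr_div_n invf_div ler_wpM2l ?exprn_ge0 ?(ltW K0)//.
  rewrite -powR_mulrn ?powR_ge0// -powRrM -powRN ler_powR ?ler1n// lerN2.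
  by rewrite -mulrA ler_wpM2l.
have PB k : (P (\bigcup_j E k j) <= (c * 2^-1 ^+ k)%:E)%E.
  apply: (le_trans (probability_fin_union_le (mE k) (PE k))).
  have -> : #|{: 'I_p * (G k * G k.+1)}|%:R = p%:R * (#|G k|%:R * #|G k.+1|%:R) :> R.
    by rewrite card_prod card_ord card_prod !natrM.
  rewrite lee_fin.
  have -> : c * 2^-1 ^+ k = p%:R * ((4 ^+ d.+1 * 2 `^ (k%:R * D)) *
    (4 ^+ d.+1 * 2 `^ (k.+1%:R * D))) * (16 * (q.+1`!%:R * K ^+ q.+1) *
    2 `^ (- (k%:R * (2 * D + 1)))).
    rewrite exprVn -powR_invn//.
    have -> : 2 `^ (- k%:R) = 2 `^ (k%:R * D) * (2 `^ (k.+1%:R * D) *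
        (2 `^ (- D) * 2 `^ (- (k%:R * (2 * D + 1))))) :> R.
      rewrite -!powRD ?pnatr_eq0 ?implybT//; congr (_ `^ _).
      by rewrite -natr1; ring.
    rewrite /c powRN; field.
    by rewrite gt_eqF// powR_gt0.
  rewrite ler_wpM2r//.
    by rewrite !mulr_ge0 ?powR_ge0 ?exprn_ge0// ltW.
  rewrite ler_wpM2l//; apply: ler_pM => //; apply: card_grid_le; exact: ltW.
have := borel_cantelli_geometric c0 (fun k => measurable_fin_union (mE k)) PB.
have : {ae P, forall w, forall i, continuous (fun z => Xs i z w)}.
  by apply: filter_forall => i; exact: Xs_cont.
apply: filterS2 => w cont [k0 hk0].
(* Ratio of the geometric series of the jumps; [(1 - rho)^-1] is its sum. *)
pose rho : R := 2 `^ (- e).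
have rho0 : 0 < rho by rewrite powR_gt0.
have rho1 : rho < 1.
  rewrite /rho powRN invf_lt1 ?powR_gt0//.
  have : 0 < e * ln 2 by rewrite mulr_gt0// ln_gt0// ltr1n.
  by rewrite /powR pnatr_eq0/= expR_gt1.
exists k0, (1 - rho)^-1; split; first by rewrite invr_ge0 subr_ge0 ltW.
move=> k z i kk0 Dz.
have [z1 z2] := Dz.
have step l : (k0 <= l)%N ->
    `|Xs i (grid_proj a b l z) w - Xs i (grid_proj a b l.+1 z) w| <= 2 `^ (- (l%:R * e)).
  move=> kl; apply/ltW; rewrite ltNge; apply/negP => hle; apply: (hk0 l kl).
  exists (i, (grid_idx a b l z, grid_idx a b l.+1 z)) => //.
  have gE m : pt m (grid_idx a b m z) = grid_proj a b m z by exact: grid_pointK.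
  have h2 : 2 `^ (- (l%:R * e)) <=
      `|Xs i (pt l (grid_idx a b l z)) w - Xs i (pt l.+1 (grid_idx a b l.+1 z)) w|.
    by rewrite !gE.
  have h1 : near_pt l (grid_idx a b l z) (grid_idx a b l.+1 z).
    have H (m x : R) : 0 < m -> 0 <= x -> forall g : R, g^-1 <= m ->
      `|grid_floor (mesh m l) x - grid_floor (mesh m l.+1) x| <= (2 `^ (- l%:R)) `^ g^-1.
      move=> m0 x0 g gm; apply: (le_trans (grid_floor_close (ltW m0) x0 (leqnSn l))).
      by rewrite -powRrM mulNr ler_powR ?ler1n// lerN2 ler_wpM2l.
    rewrite /near_pt !gE; split => [j|]; rewrite ?mxE; apply: H => //.
      by have /andP[] := z1 j.
    by have /andP[] := z2.
  by split.
have tele m : `|Xs i (grid_proj a b (k + m) z) w - Xs i (grid_proj a b k z) w| <=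
    (1 - rho ^+ m) / (1 - rho) * 2 `^ (- (k%:R * e)).
  elim: m => [|m IH]; first by rewrite addn0 subrr normr0 expr0 subrr !mul0r.
  rewrite addnS -[_ - _](subrKA (Xs i (grid_proj a b (k + m) z) w)).
  apply: (le_trans (ler_normD _ _)); rewrite distrC.
  have := step (k + m)%N (leq_trans kk0 (leq_addr _ _)).
  have -> : 2 `^ (- ((k + m)%:R * e)) = rho ^+ m * 2 `^ (- (k%:R * e)).
    rewrite /rho -powR_mulrn ?powR_ge0// -powRrM -powRD ?pnatr_eq0 ?implybT//.
    by congr (_ `^ _); rewrite natrD; ring.
  have -> : (1 - rho ^+ m.+1) / (1 - rho) * 2 `^ (- (k%:R * e)) =
    rho ^+ m * 2 `^ (- (k%:R * e)) + (1 - rho ^+ m) / (1 - rho) * 2 `^ (- (k%:R * e)).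
    by rewrite exprSr; field; rewrite gt_eqF// subr_gt0.
  by move=> h; apply: lerD.
(* Continuity carries the bound from the corners to [z]. *)
have cv : Xs i (grid_proj a b m z) w @[m --> \oo] --> Xs i z w.
  apply: (cvg_comp (fun m => grid_proj a b m z) (fun u => Xs i u w)).
    exact: grid_proj_cvg.
  exact: cont.
apply/ler_addgt0Pl => eta eta0.
have [m0 _ hm0] := (cvgrPdist_le _ _).1 cv eta eta0.
rewrite -[_ - _](subrKA (Xs i (grid_proj a b (k + m0) z) w)).
apply: (le_trans (ler_normD _ _)); apply: lerD.
  by apply: hm0 => /=; exact: leq_addl.
apply: (le_trans (tele m0)); rewrite ler_wpM2r ?powR_ge0//.
rewrite ler_piMl ?invr_ge0 ?subr_ge0 ?(ltW rho1)//.
by rewrite lerBlDr lerDl exprn_ge0// ltW.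
Qed.

End Chaining.

(** * Lower bounds for the Hausdorff dimension *)

(* A discrete [s]-energy of the uniform measure on [G l]: the kernel [dist ^ (- s)] is replaced by
   the sum of [2 ^ (k s)] over the scales [k < l] at which the two points are close. *)
Definition grid_energy {R : realType} {Z : Type} (G : nat -> finType)
    (pt : forall l, G l -> Z) (close : nat -> Z -> Z -> bool) (s : R) (l : nat) : R :=
  \sum_(k < l) 2 `^ (k%:R * s) / #|G l|%:R ^+ 2 *
    \sum_(g : G l) \sum_(h : G l) (close k (pt l g) (pt l h))%:R.

Section Frostman.
Context {R : realType} {n : nat}.

(** [j + 2] is the least [k] with [2^-1 ^+ k <= t]; [t <= 1/4] makes this [k] at least 2. *)
Lemma dyadic_bracket (t : R) : 0 < t <= 4^-1 ->
  exists j : nat, t < 2^-1 ^+ j.+1 /\ 2^-1 ^+ j <= 4 * t.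
Proof.
move=> /andP[t0 t4].
have ex : exists k : nat, (2^-1 : R) ^+ k <= t.
  have [k0 hk0] := pow2N_eventually_le ler01 ltr01 t0.
  exists k0; have := hk0 k0 (leqnn _).
  by rewrite mul1r mulr1 powR_invn// exprVn.
case: (ex_minnP ex) => -[|[|j]] hj minj.
- by move: (le_trans hj t4); rewrite expr0 => h; exfalso; lra.
- by move: (le_trans hj t4); rewrite expr1 => h; exfalso; lra.
- exists j; split.
    by rewrite ltNge; apply/negP => /minj; rewrite ltnn.
  by move: hj; rewrite !exprS; lra.
Qed.

Lemma powR_half (j : nat) (s : R) : ((2^-1 : R) ^+ j) `^ s = 2 `^ (- (j%:R * s)).
Proof.
by rewrite exprVn -powR_invn// -powRrM mulNr.
Qed.

Context {Z : topologicalType}.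
Variables (Phi : Z -> 'rV[R]_n) (D : set Z).
Hypothesis D_compact : cover_compact D.
Hypothesis Phi_open : forall (x : 'rV[R]_n) (r : R), open [set z | enorm (Phi z - x) < r].

(** Compactness needs open sets, so [U] is enlarged to a ball of dyadic radius about one of its
    points, at the price [4 ^ s]. The slack [c] is for sets of diameter 0, whose gauge allows no
    positive radius. *)
Lemma cover_thicken (U : set 'rV[R]_n) (s c : R) : 0 < s -> 0 < c ->
  (ediam U <= (4^-1)%:E)%E -> exists (V : set Z) (j : nat), [/\ open V,
    [set z | U (Phi z)] `<=` V,
    forall y z, V y -> V z -> enorm (Phi y - Phi z) <= 2^-1 ^+ j &
    ((2 `^ (- (j%:R * s)))%:E <= (4 `^ s)%:E * (hausdorff_gauge s U + c%:E))%E].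
Proof.
move=> s0 c0 Ud.
have Ufin : ediam U \is a fin_num.
  by rewrite ge0_fin_numE ?ediam_ge0// (le_lt_trans Ud) ?ltry.
pose dU := fine (ediam U).
have dU0 : 0 <= dU by rewrite fine_ge0 ?ediam_ge0.
have dU4 : dU <= 4^-1 by rewrite -lee_fin fineK.
(* Least size allowed: [e ^ s <= c] charges it to the slack, and 1/4 keeps it in the range of
   [dyadic_bracket]. *)
pose e := Num.min (c `^ s^-1) 4^-1.
have e0 : 0 < e by rewrite lt_min powR_gt0//= invr_gt0.
have es : e `^ s <= c.
  apply: (@le_trans _ _ ((c `^ s^-1) `^ s)).
    by rewrite ge0_ler_powR ?nnegrE ?(ltW s0) ?(ltW e0) ?powR_ge0// ge_min lexx.
  by rewrite -powRrM mulVf ?gt_eqF// powRr1// ltW.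
pose t := Num.max dU e.
have t04 : 0 < t <= 4^-1 by rewrite lt_max e0 orbT ge_max dU4 ge_min lexx orbT.
have [j [tj jt]] := dyadic_bracket t04.
have dUt : dU <= t by rewrite le_max lexx.
have jle : U !=set0 -> ((2 `^ (- (j%:R * s)))%:E <=
    (4 `^ s)%:E * (hausdorff_gauge s U + c%:E))%E.
  move=> /set0P/negbTE U0.
  rewrite /hausdorff_gauge U0 -[ediam U]fineK// poweR_EFin -EFinD -EFinM lee_fin.
  rewrite -powR_half; apply: (@le_trans _ _ ((4 * t) `^ s)).
    have t0 : 0 <= 4 * t by rewrite mulr_ge0// ltW//; case/andP: t04.
    by rewrite ge0_ler_powR ?nnegrE ?exprn_ge0 ?invr_ge0 ?(ltW s0).
  rewrite powRM//; last by rewrite ltW//; case/andP: t04.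
  rewrite ler_wpM2l ?powR_ge0// /t -/dU; case: (leP dU e) => _.
    by apply: (le_trans es); rewrite lerDr powR_ge0.
  by rewrite lerDl ltW.
have [U0|/set0P/negP/negPn/eqP U0] := pselect (U !=set0); last first.
  have e4 : 0 < e <= 4^-1 by rewrite e0 ge_min lexx orbT.
  have [i [_ ie]] := dyadic_bracket e4.
  exists set0, i; split => //.
  - exact: open0.
  - by move=> z /=; rewrite U0.
  - rewrite /hausdorff_gauge U0 eqxx add0e -EFinM lee_fin -powR_half.
    apply: (@le_trans _ _ ((4 * e) `^ s)).
      by rewrite ge0_ler_powR ?nnegrE ?exprn_ge0 ?invr_ge0 ?(ltW s0) ?mulr_ge0 ?(ltW e0).
    by rewrite powRM ?(ltW e0)// ler_wpM2l ?powR_ge0.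
have [x Ux] := U0.
exists [set z | enorm (Phi z - x) < 2^-1 ^+ j.+1], j; split => //; last exact: jle.
- move=> z /= Uz; apply: le_lt_trans tj; apply: le_trans dUt.
  by rewrite -lee_fin fineK// ediam_ge.
- move=> y z /= hy hz; rewrite -[Phi y - _](subrKA x).
  apply: (le_trans (enorm_triangle _ _)); rewrite (enorm_distC x).
  by move: hy hz; rewrite !exprS; lra.
Qed.

Variables (G : nat -> finType) (pt : forall l, G l -> Z).
Variable close : nat -> Z -> Z -> bool.
Hypothesis G_gt0 : forall l, (0 < #|G l|)%N.
Hypothesis pt_in : forall l (g : G l), D (pt g).
Hypothesis close_enorm : forall k y z,
  enorm (Phi y - Phi z) <= 2^-1 ^+ k -> close k y z.

(** By Markov's inequality at least half of the grid points are good, their potential [phi] being at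
    most twice the mean bound [M]. If [V k] contains a good point, all its points are close to that
    one at scale [j k], a scale present in the energy since [j k < l]; so [V k] has at most
    [2 M N 2 ^ (- j_k s)] good points. Summing over the cover counts half of the grid. *)
Lemma good_points_mass (s M : R) (l n0 : nat) (V : nat -> set Z) (j : nat -> nat) :
  0 < M -> grid_energy pt close s l <= M -> (forall k, (k < n0)%N -> (j k < l)%N) ->
  D `<=` \bigcup_(k in `I_n0) V k ->
  (forall k y z, V k y -> V k z -> enorm (Phi y - Phi z) <= 2^-1 ^+ j k) ->
  2^-1 <= 2 * M * \sum_(k < n0) 2 `^ (- ((j k)%:R * s)).
Proof.
move=> M0 eM jl DV Vsmall.
have N0 : 0 < #|G l|%:R :> R by rewrite ltr0n.
pose N : R := #|G l|%:R.
pose phi (g : G l) := \sum_(k < l) 2 `^ (k%:R * s) / N *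
  \sum_(h : G l) (close k (pt g) (pt h))%:R.
have phi0 g : 0 <= phi g.
  rewrite sumr_ge0// => k _; rewrite mulr_ge0 ?divr_ge0 ?powR_ge0 ?(ltW N0)//.
  by rewrite sumr_ge0.
have sphi : \sum_g phi g = N * grid_energy pt close s l.
  rewrite /grid_energy mulr_sumr exchange_big/=; apply: eq_bigr => k _.
  rewrite -mulr_sumr mulrA; congr (_ * _); rewrite -/N; field.
  by rewrite gt_eqF.
pose good g := phi g <= 2 * M.
have cgood : N / 2 <= \sum_(g | good g) 1.
  have : \sum_(g | ~~ good g) (2 * M) <= \sum_g phi g.
    rewrite [leRHS](bigID good)/= ler_wpDl ?sumr_ge0//.
    by apply: ler_sum => g; rewrite /good -ltNge => /ltW.
  rewrite sphi => h.
  have hN : N = \sum_(g | good g) 1 + \sum_(g | ~~ good g) 1.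
    have hc : \sum_(g : G l) (1 : R) = N by rewrite sumr_const.
    by rewrite -hc (bigID good).
  have : \sum_(g | ~~ good g) (2 * M) = (\sum_(g | ~~ good g) 1) * (2 * M).
    by rewrite mulr_suml; apply: eq_bigr => g _; rewrite mul1r.
  move=> hb; rewrite hb in h.
  have h2 : (\sum_(g | ~~ good g) 1) * (2 * M) <= N * M.
    by apply: (le_trans h); rewrite ler_wpM2l// ltW.
  have : \sum_(g | ~~ good g) 1 <= N / 2.
    by rewrite -(ler_pM2r M0); move: h2; lra.
  by move: hN; lra.
have cV k : (k < n0)%N ->
    \sum_(g | good g && `[< V k (pt g) >]) 1 <= 2 * M * N * 2 `^ (- ((j k)%:R * s)).
  move=> kn; have [g0 /andP[gg0 /asboolP Vg0]|none] :=
    pickP (fun g => good g && `[< V k (pt g) >]); last first.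
    by rewrite big_pred0// !mulr_ge0 ?powR_ge0// ltW.
  apply: (@le_trans _ _ (\sum_(h : G l) (close (j k) (pt g0) (pt h))%:R)).
    rewrite big_mkcond/=; apply: ler_sum => h _; case: ifP => // /andP[_ /asboolP Vh].
    by rewrite close_enorm//; exact: Vsmall Vg0 Vh.
  have := gg0; rewrite /good /phi (bigD1 (Ordinal (jl k kn)))//=.
  set S := \sum_h _; set rest := \sum_(i < l | _) _.
  have rest0 : 0 <= rest.
    rewrite sumr_ge0// => i _; rewrite mulr_ge0 ?divr_ge0 ?powR_ge0 ?(ltW N0)//.
    by rewrite sumr_ge0.
  move=> h; have {}h : 2 `^ ((j k)%:R * s) / N * S <= 2 * M by lra.
  rewrite powRN ler_pdivlMr ?powR_gt0// mulrC.
  by move: h; rewrite mulrAC ler_pdivrMr.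
have : N / 2 <= \sum_(k < n0) 2 * M * N * 2 `^ (- ((j k)%:R * s)).
  apply: (le_trans cgood).
  apply: (@le_trans _ _ (\sum_(k < n0) \sum_(g | good g && `[< V k (pt g) >]) 1)).
    under [leRHS]eq_bigr do rewrite big_mkcondr/=.
    rewrite exchange_big/=; apply: ler_sum => g _.
    have [k /= kn Vk] := DV _ (pt_in g).
    rewrite (bigD1 (Ordinal kn))//= asboolT// lerDl sumr_ge0// => i _.
    by case: ifP.
  by apply: ler_sum => k _; exact: cV.
rewrite -mulr_sumr; set S := \sum_(k < n0) _ => h.
have : N * 2^-1 <= N * (2 * M * S) by move: h; lra.
by rewrite ler_pM2l.
Qed.

Lemma frostman_discrete (s M : R) : 0 < s ->
  (forall l0, exists2 l, (l0 <= l)%N & grid_energy pt close s l <= M) ->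
  hausdorff_measure s (Phi @` D) <> 0%E.
Proof.
move=> s0 Henergy H0.
pose M1 := Num.max M 1.
have M10 : 0 < M1 by rewrite lt_max ltr01 orbT.
(* Then [2 * M1 * 4 ^ s * (eta + eta) = 1/8], below the 1/2 of [good_points_mass]. One [eta] pays
   for the cover, the other for the slacks [c k]. *)
pose eta := (32 * M1 * 4 `^ s)^-1.
have eta0 : 0 < eta by rewrite invr_gt0 !mulr_gt0 ?powR_gt0.
have : (hausdorff_premeasure s 4^-1 (Phi @` D) < eta%:E)%E.
  apply: (@le_lt_trans _ _ 0%E); last by rewrite lte_fin.
  by rewrite -H0; apply: ereal_sup_ubound; exists (4^-1) => //=; rewrite invr_gt0.
move=> /ereal_inf_lt[_ [U [DU Ud] <-] sU].
pose c k := eta * 2^-1 ^+ k.+1.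
have c0 k : 0 < c k by rewrite mulr_gt0// exprn_gt0// invr_gt0.
have /choice[V /choice[j hVj]] := fun k => cover_thicken s0 (c0 k) (Ud k).
have Vopen k : open (V k) by have [] := hVj k.
have [n0 hn0] : exists n0 : nat, D `<=` \bigcup_(k in `I_n0) V k.
  have DV : D `<=` cover setT V.
    move=> z Dz; have [k _ Ukz] := DU (Phi z) (ex_intro2 _ _ z Dz erefl).
    by exists k => //; have [_ UV _ _] := hVj k; exact: UV.
  have := D_compact (fun k (_ : setT k) => Vopen k) DV.
  move=> [D' _ D'V]; exists (\max_(k <- finmap.enum_fset D') k).+1 => z /D'V[k kD' Vkz].
  exists k => //=; rewrite ltnS.
  have := @leq_bigmax_seq _ (finmap.enum_fset D') xpredT id k kD' isT; exact.
(* Only now is the grid chosen: it has to see every scale of the finite cover, and bounded energies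
   recur at arbitrarily fine levels. *)
pose L := (\max_(k < n0) j k).+1.
have [l Ll el] := Henergy L.
have jl k : (k < n0)%N -> (j k < l)%N.
  move=> kn; apply: leq_trans Ll; rewrite ltnS.
  exact: (leq_bigmax (Ordinal kn)).
have eM1 : grid_energy pt close s l <= M1 by rewrite (le_trans el)// le_max lexx.
have := good_points_mass M10 eM1 jl hn0 (fun k y z => let: And4 _ _ h _ := hVj k in h y z).
set S := \sum_(k < n0) _ => hS.
have : (S%:E <= (4 `^ s)%:E * (eta%:E + eta%:E))%E.
  rewrite /S -sumEFin.
  apply: (@le_trans _ _ (\sum_(k < n0) (4 `^ s)%:E * (hausdorff_gauge s (U k) + (c k)%:E))%E).
    by apply: lee_sum => k _; have [] := hVj k.
  rewrite -ge0_sume_distrr; last first.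
    by move=> k _; rewrite adde_ge0 ?hausdorff_gauge_ge0// lee_fin ltW.
  rewrite lee_pmul2l ?lte_fin ?powR_gt0//.
  rewrite big_split/=; apply: leeD.
    apply: (le_trans _ (ltW sU)).
    rewrite (nneseries_split 0 n0); last by move=> k _; exact: hausdorff_gauge_ge0.
    rewrite add0n big_mkord leeDl//.
    by apply: nneseries_ge0 => k _ _; exact: hausdorff_gauge_ge0.
  rewrite sumEFin lee_fin /c -mulr_sumr ler_piMr ?(ltW eta0)//.
  have -> : \sum_(i < n0) (2^-1 : R) ^+ i.+1 = 1 - 2^-1 ^+ n0.
    elim: n0 {hn0 jl hS L Ll S} => [|m IH]; first by rewrite big_ord0 expr0 subrr.
    by rewrite big_ord_recr/= IH !exprSr; field.
  by rewrite lerBlDr lerDl exprn_ge0// invr_ge0.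
rewrite -EFinD -EFinM lee_fin => hS2.
have : 2 * M1 * S <= 2 * M1 * (4 `^ s * (eta + eta)).
  by rewrite ler_wpM2l// mulr_ge0// ltW.
have -> : 2 * M1 * (4 `^ s * (eta + eta)) = 8^-1.
  rewrite /eta; field; rewrite gt_eqF ?powR_gt0//= gt_eqF//.
by move: hS; lra.
Qed.

End Frostman.

(** * Sums of Riesz kernels over grids *)

Section KernelSum.
Context {R : realType}.

(** Discrete form of the derivative of [x ^ q], which makes sums of powers telescope; it rests on
    [(j / (j + 1)) ^ q <= expR (- q / (j + 1))]. *)
Lemma powR_diff_ge (q : R) (j : nat) : 0 < q <= 1 ->
  j.+1%:R `^ (q - 1) <= 2 / q * (j.+1%:R `^ q - j%:R `^ q).
Proof.
move=> /andP[q0 q1].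
have j0 : 0 < j.+1%:R :> R by rewrite ltr0n.
have qj0 : 0 <= q / j.+1%:R by rewrite divr_ge0// ltW.
have qj1 : q / j.+1%:R <= 1.
  by rewrite ler_pdivrMr// mul1r (le_trans q1)// ler1n.
have h1 : j%:R `^ q <= j.+1%:R `^ q * expR (- (q / j.+1%:R)).
  case: j j0 qj0 qj1 => [|j] j0 qj0 qj1.
    by rewrite powR0 ?gt_eqF// mulr_ge0 ?powR_ge0 ?expR_ge0.
  rewrite /powR !pnatr_eq0/= -expRD ler_expR.
  rewrite (_ : q * ln j.+2%:R + _ = q * (ln j.+2%:R - j.+2%:R^-1)); last by ring.
  rewrite ler_wpM2l ?(ltW q0)//.
  have j1 : 0 < j.+1%:R :> R by rewrite ltr0n.
  rewrite lerBrDl -lerBrDr -ln_div ?posrE//.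
  have -> : j.+2%:R / j.+1%:R = 1 + j.+1%:R^-1 :> R.
    by rewrite -[j.+2%:R]natr1; move: (j.+1%:R : R) j1 => y y0; field; rewrite gt_eqF.
  have ji0 : 0 <= j.+1%:R^-1 :> R by rewrite invr_ge0.
  apply: le_trans (ln_one_add_ge ji0).
  rewrite (_ : j.+1%:R^-1 / _ = j.+2%:R^-1)//.
  rewrite -[j.+2%:R]natr1; move: (j.+1%:R : R) j1 => y y0; field.
  by rewrite !gt_eqF// addr_gt0.
have h2 := one_sub_expRN_ge qj0.
have pj0 : 0 < j.+1%:R `^ q :> R by rewrite powR_gt0.
have -> : j.+1%:R `^ (q - 1) = j.+1%:R `^ q / j.+1%:R :> R.
  by rewrite powRB ?pnatr_eq0 ?implybT// powRr1.
have : q / j.+1%:R / 2 <= 1 - expR (- (q / j.+1%:R)).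
  apply: le_trans h2; move: (q / _) qj0 qj1 => y y0 y1.
  by rewrite ler_wpM2l// lef_pV2 ?posrE; lra.
move=> h3; rewrite mulrAC ler_pdivlMr//.
have := ler_wpM2l (ltW pj0) h3; move: h1; set E := expR _; set X := _ `^ q; set Y := _ `^ q.
rewrite (_ : Y * (q / j.+1%:R / 2) = Y / j.+1%:R * q / 2); last by ring.
rewrite mulrBr mulr1; move: (Y * E) (Y / _ * q) => u v ? ?.
lra.
Qed.

Lemma sum_powR_le (theta x : R) (n : nat) : 0 <= theta < 1 -> 0 <= x ->
  \sum_(j < n | j%:R <= x) (maxn j 1)%:R `^ (- theta) <=
  1 + 2 / (1 - theta) * x `^ (1 - theta).
Proof.
move=> /andP[th0 th1] x0.
have q0 : 0 < 1 - theta by rewrite subr_gt0.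
have q01 : 0 < 1 - theta <= 1 by rewrite q0 lerBlDr lerDl.
have c0 : 0 <= 2 / (1 - theta) by rewrite divr_ge0// ltW.
case: n => [|n]; first by rewrite big_ord0 addr_ge0// mulr_ge0// powR_ge0.
(* The minimum makes the induction bound stationary once the indices pass [x]. *)
suff H : \sum_(j < n.+1 | j%:R <= x) (maxn j 1)%:R `^ (- theta) <=
    1 + 2 / (1 - theta) * (Num.min n%:R x) `^ (1 - theta).
  apply: (le_trans H); rewrite lerD2l ler_wpM2l//.
  by rewrite ge0_ler_powR ?nnegrE ?(ltW q0) ?le_min ?ler0n ?x0// ge_min lexx orbT.
elim: n => [|n IH].
  rewrite big_mkcond big_ord1/= x0 powR1 lerDl.
  by rewrite mulr_ge0// powR_ge0.
rewrite big_mkcond big_ord_recr/= -big_mkcond/=.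
have [nx|xn] := leP n.+1%:R x.
  have nx' : n%:R <= x by rewrite (le_trans _ nx)// ler_nat.
  rewrite (min_idPl nx') in IH; rewrite /maxn/=.
  have := powR_diff_ge n q01.
  rewrite (_ : 1 - theta - 1 = - theta); last by ring.
  by move: IH; lra.
rewrite addr0; apply: (le_trans IH); rewrite lerD2l ler_wpM2l//.
rewrite ge0_ler_powR ?nnegrE ?(ltW q0) ?le_min ?ler0n ?x0//.
by rewrite ge_min lexx orbT.
Qed.

Definition absdiff (i j : nat) : nat := ((i - j) + (j - i))%N.

Lemma absdiffE (i j : nat) : `|i%:R - j%:R| = (absdiff i j)%:R :> R.
Proof.
rewrite /absdiff; have [ij|ji] := leqP i j.
  by rewrite (eqP ij) add0n distrC -natrB// ger0_norm.
by rewrite (eqP (ltnW ji)) addn0 -natrB ?(ltnW ji)// ger0_norm.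
Qed.

Lemma sum_pred_le1 (m : nat) (Q : pred 'I_m) :
  (forall i j, Q i -> Q j -> i = j) -> \sum_(i < m) (Q i)%:R <= 1 :> R.
Proof.
move=> Qinj; have [i Qi|Q0] := pickP Q; last first.
  by rewrite big1// => i _; rewrite Q0.
rewrite (bigD1 i)//= Qi big1 ?addr0// => j ji.
by have [/Qinj/(_ Qi)/eqP|//] := boolP (Q j); rewrite (negbTE ji).
Qed.

(** For fixed [i], each value of the difference is taken by at most two [j]. *)
Lemma sum_absdiff_le (m : nat) (F : nat -> R) : (forall j, 0 <= F j) ->
  \sum_(i < m) \sum_(j < m) F (absdiff i j) <= 2 * m%:R * \sum_(k < m) F k.
Proof.
move=> F0; set S := \sum_(k < m) F k.
suff H i : \sum_(j < m) F (absdiff (i : 'I_m) j) <= 2 * S.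
  apply: (le_trans (ler_sum _ (fun i _ => H i))).
  by rewrite sumr_const card_ord -[leLHS]mulr_natl mulrCA mulrA.
apply: (@le_trans _ _ (\sum_(j < m) \sum_(k < m)
    (((j + k == i)%N)%:R * F k + ((i + k == j)%N)%:R * F k))).
  apply: ler_sum => j _.
  have dm : (absdiff i j < m)%N.
    rewrite /absdiff; have [ij|ji] := leqP i j.
      by rewrite (eqP ij) add0n (leq_ltn_trans (leq_subr _ _)).
    by rewrite (eqP (ltnW ji)) addn0 (leq_ltn_trans (leq_subr _ _)).
  rewrite (bigD1 (Ordinal dm))//= ler_wpDr//.
    by rewrite sumr_ge0// => k _; rewrite addr_ge0// mulr_ge0.
  rewrite /absdiff; have [ij|ji] := leqP i j.
    rewrite (eqP ij) add0n subnKC// eqxx mul1r lerDr.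
    by rewrite mulr_ge0.
  rewrite (eqP (ltnW ji)) addn0 subnKC ?(ltnW ji)// eqxx mul1r lerDl.
  by rewrite mulr_ge0.
rewrite exchange_big/= /S mulr_sumr; apply: ler_sum => k _.
rewrite big_split/= -!mulr_suml -mulrDl ler_wpM2r//.
rewrite (_ : 2 = 1 + 1 :> R); last by ring.
apply: lerD; apply: sum_pred_le1 => a b /eqP ha /eqP hb; apply: val_inj => /=.
  by apply/eqP; rewrite -(eqn_add2r k) ha hb.
by rewrite -ha -hb.
Qed.

(** [(r / |x|^e)^s] at [x = j / m], cut off beyond [rr]; the singular value at [j = 0] is replaced
    by the value at one mesh step. *)
Definition riesz_kernel (e s r rr : R) (m j : nat) : R :=
  if j%:R / m%:R <= rr then (r / ((maxn j 1)%:R / m%:R) `^ e) `^ s else 0.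

Lemma riesz_kernel_ge0 (e s r rr : R) (m j : nat) : 0 <= riesz_kernel e s r rr m j.
Proof. by rewrite /riesz_kernel; case: ifP => // _; exact: powR_ge0. Qed.

(** Riemann sum of [|x|^(- e s)] over [|x| <= rr], integrable as [e * s < 1]; [1 / m <= rr] absorbs
    the diagonal into the power of [rr]. *)
Lemma sum_riesz_kernel_le (e s r rr : R) (m : nat) : 0 <= e * s < 1 -> 0 < r ->
  (0 < m)%N -> m%:R^-1 <= rr ->
  \sum_(i < m) \sum_(j < m) riesz_kernel e s r rr m (absdiff i j) <=
  m%:R ^+ 2 * (2 * (1 + 2 / (1 - e * s)) * r `^ s * rr `^ (1 - e * s)).
Proof.
move=> es r0 m0 mrr; have /andP[es0 es1] := es.
have mR : 0 < m%:R :> R by rewrite ltr0n.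
have q0 : 0 < 1 - e * s by rewrite subr_gt0.
have rr0 : 0 < rr by rewrite (lt_le_trans _ mrr)// invr_gt0.
apply: (le_trans (sum_absdiff_le _ (riesz_kernel_ge0 e s r rr m))).
have E (j : nat) : (r / ((maxn j 1)%:R / m%:R) `^ e) `^ s =
    r `^ s * m%:R `^ (e * s) * (maxn j 1)%:R `^ (- (e * s)).
  have M0 : 0 < (maxn j 1)%:R :> R by rewrite ltr0n leq_max orbT.
  rewrite powRM ?(ltW r0) ?invr_ge0 ?powR_ge0// -mulrA; congr (_ * _).
  rewrite -powRN -powRrM mulNr powRM ?(ltW M0) ?invr_ge0 ?ler0n// mulrC.
  by congr (_ * _); rewrite -powR_inv1// -powRrM mulN1r opprK.
rewrite /riesz_kernel -big_mkcond/=.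
under eq_bigr do rewrite E.
under eq_bigl do rewrite ler_pdivrMr//.
rewrite -mulr_sumr.
have rm0 : 0 <= rr * m%:R by rewrite mulr_ge0// ltW.
have S := sum_powR_le m es rm0.
have mrr1 : 1 <= rr * m%:R by rewrite -ler_pdivrMr// div1r.
have p1 : 1 <= (rr * m%:R) `^ (1 - e * s).
  by have := @ge0_ler_powR R _ (ltW q0) 1 (rr * m%:R) ler01 rm0 mrr1; rewrite powR1.
have S2 : \sum_(j < m | j%:R <= rr * m%:R) (maxn j 1)%:R `^ (- (e * s)) <=
    (1 + 2 / (1 - e * s)) * (rr * m%:R) `^ (1 - e * s).
  by apply: (le_trans S); rewrite [leRHS]mulrDl mul1r lerD2r.
have mm : m%:R `^ (e * s) * m%:R `^ (1 - e * s) = m%:R :> R.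
  rewrite -powRD ?pnatr_eq0 -?lt0n ?m0 ?implybT//.
  by rewrite addrC subrK powRr1.
rewrite powRM ?(ltW rr0)// in S2.
apply: (@le_trans _ _ (2 * m%:R * (r `^ s * m%:R `^ (e * s) *
   ((1 + 2 / (1 - e * s)) * (rr `^ (1 - e * s) * m%:R `^ (1 - e * s)))))).
  by rewrite ler_wpM2l ?mulr_ge0// ler_wpM2l// mulr_ge0 ?powR_ge0.
set A := 1 + _; set B := r `^ s; set C := rr `^ _.
rewrite (_ : 2 * _ * _ = 2 * m%:R * B * A * C *
  (m%:R `^ (e * s) * m%:R `^ (1 - e * s))); last by ring.
by rewrite mm le_eqVlt; apply/orP; left; apply/eqP; ring.
Qed.

Lemma sum_prod_pairs (d m : nat) (F : 'I_m -> 'I_m -> R) :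
  \sum_(g : {ffun 'I_d -> 'I_m}) \sum_(h : {ffun 'I_d -> 'I_m})
    \prod_(i < d) F (g i) (h i) = (\sum_(a < m) \sum_(b < m) F a b) ^+ d.
Proof.
under eq_bigr => g _.
  rewrite -(bigA_distr_bigA (fun i b => F (g i) b)) /=.
  over.
rewrite -(bigA_distr_bigA (fun (i : 'I_d) a => \sum_(b < m) F a b)) /=.
by rewrite prodr_const card_ord.
Qed.

End KernelSum.

(** * Energy of the field *)

Section MeanBound.
Context {R : realType} {disp : measure_display} {T : measurableType disp}.
Variable P : probability T R.

(** Measurability and nonnegativity are bundled in, so that the bound passes through sums and
    scalings. *)
Definition mean_le (f : T -> R) (b : R) := [/\ measurable_fun [set: T] f,
  forall w, 0 <= f w & (\int[P]_w (f w)%:E <= b%:E)%E].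

Lemma mean_le_sum (J : finType) (f : J -> T -> R) (b : J -> R) :
  (forall j, mean_le (f j) (b j)) ->
  mean_le (fun w => \sum_j f j w) (\sum_j b j).
Proof.
move=> H; have mf j : measurable_fun [set: T] (f j) by have [] := H j.
have f0 j w : 0 <= f j w by have [] := H j.
split.
- exact: measurable_sum.
- by move=> w; rewrite sumr_ge0.
- under eq_integral do rewrite -sumEFin.
  rewrite ge0_integral_sum//.
  + by rewrite -sumEFin; apply: lee_sum => j _; have [] := H j.
  + by move=> j; apply/measurable_EFinP.
  + by move=> j w _; rewrite lee_fin.
Qed.

Lemma mean_le_scale (f : T -> R) (b k : R) : 0 <= k -> mean_le f b ->
  mean_le (fun w => k * f w) (k * b).
Proof.
move=> k0 [mf f0 fb]; split.
- exact: measurable_funM.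
- by move=> w; rewrite mulr_ge0.
- under eq_integral do rewrite EFinM.
  rewrite ge0_integralZl//.
  + by rewrite EFinM lee_wpmul2l.
  + by apply/measurable_EFinP.
  + by move=> w _; rewrite lee_fin.
Qed.

Lemma mean_le_event (A : set T) (b : R) : measurable A -> (P A <= b%:E)%E ->
  mean_le (fun w => `[< A w >]%:R) b.
Proof.
move=> mA PA; have E : (fun w => `[< A w >]%:R) = \1_A :> (T -> R).
  by apply/funext => w; rewrite indicE; congr (nat_of_bool _)%:R; apply/asboolP/idP; rewrite inE.
rewrite E; split.
- exact: measurable_indic.
- by move=> w; rewrite indicE.
- by rewrite integral_indic// setIT.
Qed.

Lemma mean_le_ae_recurrent (f : nat -> T -> R) (B : R) :
  (forall l, mean_le (f l) B) ->
  {ae P, forall w, exists M, forall l0, exists2 l, (l0 <= l)%N & f l w <= M}.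
Proof.
move=> H; have mf l : measurable_fun [set: T] (f l) by have [] := H l.
have f0 l w : 0 <= f l w by have [] := H l.
pose F l w : \bar R := (f l w)%:E.
have mF l : measurable_fun [set: T] (F l) by apply/measurable_EFinP.
have F0 l w : (0 <= F l w)%E by rewrite lee_fin.
have fat := fatou P measurableT mF (fun l w _ => F0 l w).
have intF : (limn_einf (fun l => \int[P]_w F l w) <= B%:E)%E.
  rewrite limn_einf_lim; apply: lime_le; first exact: is_cvg_einfs.
  apply: nearW => l; apply: (@le_trans _ _ (\int[P]_w F l w)%E).
    by apply: ereal_inf_lbound; exists l => /=.
  by have [] := H l.
have mlim : measurable_fun [set: T] (fun w => limn_einf (F ^~ w)).
  rewrite (_ : (fun w => _) = (fun w => - limn_esup (fun l => - F l w))%E); last first.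
    by apply/funext => w; rewrite -[LHS]oppeK -limn_esupN.
  apply: measurableT_comp => //; apply: measurable_fun_limn_esup => l.
  exact: measurableT_comp.
have lim0 w : (0 <= limn_einf (F ^~ w))%E.
  rewrite limn_einf_lim; apply: lime_ge; first exact: is_cvg_einfs.
  by apply: nearW => l; apply: le_ereal_inf_tmp => _ [k _ <-].
have intlim : P.-integrable [set: T] (fun w => limn_einf (F ^~ w)).
  apply/integrableP; split => //.
  under eq_integral do rewrite gee0_abs//.
  by rewrite (le_lt_trans fat)// (le_lt_trans intF)// ltry.
have := integrable_ae measurableT intlim.
apply: filterS => w /(_ I) wfin.
(* Every tail infimum is at most the lower limit; the [+ 1] makes the comparison strict, so some
   index of the tail stays below it. *)
exists (fine (limn_einf (F ^~ w)) + 1) => l0.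
have : (einfs (F ^~ w) l0 < (fine (limn_einf (F ^~ w)) + 1)%:E)%E.
  apply: (@le_lt_trans _ _ (limn_einf (F ^~ w))).
    rewrite limn_einf_lim.
    have -> : limn (einfs (F ^~ w)) = ereal_sup (range (einfs (F ^~ w))).
      by apply/cvg_lim => //; exact: cvg_einfs_sup.
    by apply: ereal_sup_ubound; exists l0.
  by rewrite -{1}(fineK wfin) lte_fin ltrDl.
by move=> /ereal_inf_lt[_ [l /= l0l <-]]; rewrite lte_fin => /ltW; exists l.
Qed.

End MeanBound.

Section Energy.
Context {R : realType} {d p : nat}.
Context {disp : measure_display} {T : measurableType disp}.
Variables (P : probability T R) (Xs : 'I_p -> 'rV[R]_d * R -> {RV P >-> R}).
Variables alpha gamma C : R.
Hypotheses (halpha : 0 < alpha <= 1) (hgamma : 0 < gamma <= 1) (C1 : 1 <= C).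
Hypothesis p_gt0 : (0 < p)%N.
Hypothesis Xs_small_ball : forall (y z : 'rV[R]_d * R) (q r : R), close_pair y z ->
  0 < q -> separated alpha gamma q y z -> 0 <= r ->
  (P [set w | forall i, (`|Xs i y w - Xs i z w| <= r)%R] <= ((C * r / q) ^+ p)%:E)%E.

(** One step of this mesh, raised to [alpha] or to [gamma], is at most [2 ^ (- l)]: a single mesh
    resolves all scales [k < l] in space and in time. *)
Definition lower_mesh (l : nat) : nat := mesh (alpha^-1 + gamma^-1) l.

Definition lower_grid (l : nat) : finType :=
  ({ffun 'I_d -> 'I_(lower_mesh l)} * 'I_(lower_mesh l))%type.

Definition lower_point (l : nat) (g : lower_grid l) : 'rV[R]_d * R :=
  (\row_i ((g.1 i)%:R / (lower_mesh l)%:R), g.2%:R / (lower_mesh l)%:R).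

(* [graph] tells whether the parameters have to be close as well as the values. *)
Definition close_event (graph : bool) (k : nat) (y z : 'rV[R]_d * R) : set T :=
  [set w | (graph -> (forall i, `|y.1 ord0 i - z.1 ord0 i| <= 2^-1 ^+ k) /\
             `|y.2 - z.2| <= 2^-1 ^+ k) /\
           forall i, `|Xs i y w - Xs i z w| <= 2^-1 ^+ k].

Lemma lower_point_cube l (g : lower_grid l) : unit_cube (lower_point g).
Proof.
have H (i : 'I_(lower_mesh l)) : 0 <= (i%:R / (lower_mesh l)%:R : R) <= 1.
  by rewrite divr_ge0//= ler_pdivrMr ?mesh_gt0// mul1r ler_nat ltnW.
by split => [i|] /=; rewrite ?mxE; exact: H.
Qed.

Lemma card_lower_grid l : #|lower_grid l| = (lower_mesh l ^ d.+1)%N.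
Proof. by rewrite card_prod card_ffun !card_ord expnSr. Qed.

Lemma measurable_values_close (y z : 'rV[R]_d * R) (r : R) :
  measurable [set w | forall i, (`|Xs i y w - Xs i z w| <= r)%R].
Proof.
rewrite (_ : [set w | _] = \bigcap_i [set w | (`|(Xs i y \- Xs i z) w| <= r)%R]).
  by apply: fin_bigcap_measurable => [|i _]; [exact: finite_finset|exact: measurable_norm_le].
by apply/seteqP; split => w /= h i; [move=> _|]; exact: h.
Qed.

Lemma measurable_close_event graph k y z : measurable (close_event graph k y z).
Proof.
have [h|h] := pselect (graph -> (forall i, `|y.1 ord0 i - z.1 ord0 i| <= 2^-1 ^+ k) /\
             `|y.2 - z.2| <= 2^-1 ^+ k).
  rewrite (_ : close_event _ _ _ _ =
    [set w | forall i, (`|Xs i y w - Xs i z w| <= 2^-1 ^+ k)%R]).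
    exact: measurable_values_close.
  by apply/seteqP; split => w //= -[].
by rewrite (_ : close_event _ _ _ _ = set0)//; apply/seteqP; split => w //= -[].
Qed.

Lemma lower_mesh_fine (e : R) (k l : nat) : (k < l)%N -> 1 <= (alpha^-1 + gamma^-1) * e ->
  0 <= e -> ((lower_mesh l)%:R^-1) `^ e <= 2^-1 ^+ k.
Proof.
move=> kl he e0; rewrite exprVn -powR_inv1 ?ler0n// -powRrM mulN1r powRN.
rewrite lef_pV2 ?posrE ?exprn_gt0 ?powR_gt0 ?mesh_gt0//.
rewrite -powR_mulrn//.
apply: (@le_trans _ _ ((2 `^ (l%:R * (alpha^-1 + gamma^-1))) `^ e)).
  rewrite -powRrM ler_powR ?ler1n//.
  apply: (@le_trans _ _ l%:R); first by rewrite ler_nat ltnW.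
  by rewrite -mulrA ler_peMr.
by rewrite ge0_ler_powR ?nnegrE ?powR_ge0// ltW// mesh_gt.
Qed.

Lemma powR_rootK (x : R) : 0 <= x -> x = (x ^+ p) `^ p%:R^-1.
Proof.
move=> x0; rewrite -[x ^+ p]powR_mulrn// -powRrM mulfV ?powRr1//.
by rewrite pnatr_eq0 -lt0n.
Qed.

Lemma exponent_sum_ge1 (e : R) : e = alpha \/ e = gamma -> 1 <= (alpha^-1 + gamma^-1) * e.
Proof.
have /andP[a0 _] := halpha; have /andP[g0 _] := hgamma.
by case=> ->; rewrite mulrDl mulVf ?gt_eqF// ?lerDl ?lerDr mulr_ge0 ?invr_ge0// ltW.
Qed.

(** For the image, 1 is no restriction: coordinates in the unit cube differ by at most 1. *)
Definition cutoff (graph : bool) (k : nat) : R := if graph then 2^-1 ^+ k else 1.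

(* With [v = P ^ (1/p) <= 1], each coordinate difference gives [v <= C r / q], so that [P = v ^ p]
   is at most a product of powers [(C r / q) ^ s] of total exponent at most [p]; this decouples
   the coordinates. *)
Lemma close_event_prob_le graph (k l : nat) (s1 st : R) (g h : lower_grid l) :
  (k < l)%N -> 0 <= s1 -> 0 <= st -> d%:R * s1 + st <= p%:R ->
  (P (close_event graph k (lower_point g) (lower_point h)) <=
   (C `^ (d%:R * s1 + st) *
    (\prod_(i < d) riesz_kernel gamma s1 (2^-1 ^+ k) (cutoff graph k) (lower_mesh l)
        (absdiff (g.1 i) (h.1 i)) *
     riesz_kernel alpha st (2^-1 ^+ k) (cutoff graph k) (lower_mesh l) (absdiff g.2 h.2)))%:E)%E.
Proof.
move=> kl s10 st0 Sp; set r := 2^-1 ^+ k; set rr := cutoff graph k.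
have /andP[a0 a1] := halpha; have /andP[g0 g1] := hgamma.
have C0 : 0 < C by apply: lt_le_trans C1.
have r0 : 0 < r by rewrite exprn_gt0// invr_gt0.
set y := lower_point g; set z := lower_point h.
set m := lower_mesh l.
have mR : 0 < m%:R :> R by exact: mesh_gt0.
set A := close_event _ _ _ _.
have mA : measurable A by exact: measurable_close_event.
have rhs0 : 0 <= C `^ (d%:R * s1 + st) *
    (\prod_(i < d) riesz_kernel gamma s1 r rr m (absdiff (g.1 i) (h.1 i)) *
     riesz_kernel alpha st r rr m (absdiff g.2 h.2)).
  rewrite mulr_ge0 ?powR_ge0// mulr_ge0 ?riesz_kernel_ge0//.
  by rewrite prodr_ge0// => i _; exact: riesz_kernel_ge0.
have dist (i j : nat) : `|i%:R / m%:R - j%:R / m%:R| = (absdiff i j)%:R / m%:R :> R.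
  by rewrite -mulrBl normrM absdiffE ger0_norm// invr_ge0 ltW.
have d1 i : `|y.1 ord0 i - z.1 ord0 i| = (absdiff (g.1 i) (h.1 i))%:R / m%:R.
  by rewrite !mxE dist.
have d2 : `|y.2 - z.2| = (absdiff g.2 h.2)%:R / m%:R by rewrite /= dist.
have lt1 (i j : 'I_m) : (absdiff i j)%:R / m%:R <= 1 :> R.
  rewrite ler_pdivrMr// mul1r ler_nat /absdiff; have [ij|ji] := leqP i j.
    by rewrite (eqP ij) add0n (leq_trans (leq_subr _ _))// ltnW.
  by rewrite (eqP (ltnW ji)) addn0 (leq_trans (leq_subr _ _))// ltnW.
have clyz : close_pair y z by split => [i|]; rewrite ?d1 ?d2 lt1.
(* For the graph, a point of the event supplies the deterministic closeness that puts the
   differences below the cutoff. *)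
have [Aw|A0] := pselect (A !=set0); last first.
  have -> : A = set0 by apply/eqP/negPn/negP => /set0P.
  by rewrite measure0 lee_fin.
have [rr1 rr2] : (forall i, (absdiff (g.1 i) (h.1 i))%:R / m%:R <= rr) /\
    (absdiff g.2 h.2)%:R / m%:R <= rr.
  case: Aw => w [hw _]; rewrite /rr /cutoff; case: graph hw @rr A mA rhs0 => hw *; last first.
    by split => [i|]; exact: lt1.
  by have [h1 h2] := hw isT; split => [i|]; rewrite -?d1 -?d2.
have PA : P A \is a fin_num by exact: fin_num_measure.
pose x := fine (P A).
have x0 : 0 <= x by exact: fine_ge0.
have x1 : x <= 1 by rewrite -lee_fin fineK// probability_le1.
have pR : 0 < p%:R :> R by rewrite ltr0n.
pose v := x `^ p%:R^-1.
have v0 : 0 <= v by exact: powR_ge0.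
have v1 : v <= 1 by apply: powR_le1; rewrite ?x0// invr_ge0 ltW.
have xv : x = v `^ p%:R by rewrite -powRrM mulVf ?gt_eqF// powRr1.
have vq (q : R) : 0 < q -> separated alpha gamma q y z -> v <= C * r / q.
  move=> q0 sepq.
  have Cq0 : 0 <= C * r / q by rewrite divr_ge0 ?mulr_ge0// ltW.
  have xq : x <= (C * r / q) ^+ p.
    rewrite -lee_fin fineK//; apply: le_trans (Xs_small_ball clyz q0 sepq (ltW r0)).
    by apply: le_measure; rewrite ?inE//; [exact: measurable_values_close|move=> w []].
  have -> : C * r / q = ((C * r / q) ^+ p) `^ p%:R^-1.
    exact: powR_rootK.
  by rewrite ge0_ler_powR ?nnegrE ?invr_ge0 ?exprn_ge0// ltW.
have coord (e : R) (dd : nat) : 0 < e -> 1 <= (alpha^-1 + gamma^-1) * e ->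
    (forall q : R, 0 < q -> q <= (dd%:R / m%:R) `^ e -> separated alpha gamma q y z) ->
    v <= C * (r / ((maxn dd 1)%:R / m%:R) `^ e).
  move=> e0 e1 sepq; rewrite mulrA; case: dd sepq => [|dd] sepq.
    (* Equal coordinates separate nothing, but at one mesh step the right-hand side is already at
       least 1, and [v <= 1]. *)
    rewrite /maxn/= div1r; apply: (le_trans v1).
    have me := lower_mesh_fine kl e1 (ltW e0).
    have me0 : 0 < (m%:R^-1 : R) `^ e by rewrite powR_gt0// invr_gt0.
    rewrite ler_pdivlMr// mul1r; apply: (le_trans me).
    by rewrite ler_peMl// ltW.
  rewrite /maxn/=; apply: vq; last by apply: sepq => //; rewrite powR_gt0 ?divr_gt0.
  by rewrite powR_gt0// divr_gt0.
have v_le1 i : v <= C * (r / ((maxn (absdiff (g.1 i) (h.1 i)) 1)%:R / m%:R) `^ gamma).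
  apply: coord => //; first by apply: exponent_sum_ge1; right.
  by move=> q q0 qle; right; exists i; rewrite d1.
have v_let : v <= C * (r / ((maxn (absdiff g.2 h.2) 1)%:R / m%:R) `^ alpha).
  apply: coord => //; first by apply: exponent_sum_ge1; left.
  by move=> q q0 qle; left; rewrite d2.
rewrite -[P A]fineK// lee_fin -/x.
have [v_eq0|vN0] := eqVneq v 0.
  by rewrite xv v_eq0 powR0// gt_eqF.
have {}v0 : 0 < v by rewrite lt_neqAle eq_sym vN0.
apply: (@le_trans _ _ (v `^ (d%:R * s1 + st))).
  by rewrite xv; apply: ger_powR => //; rewrite v0.
have split_pow (u : R) : 0 < u -> u `^ (d%:R * s1 + st) = (\prod_(i < d) u `^ s1) * u `^ st.
  move=> u0; rewrite powRD ?(gt_eqF u0) ?implybT//; congr (_ * _).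
  by rewrite prodr_const card_ord mulrC powRrM powR_mulrn// powR_ge0.
rewrite !split_pow// mulrACA -big_split/=.
have kpow (e s : R) (dd : nat) : 0 <= s -> dd%:R / m%:R <= rr ->
    v <= C * (r / ((maxn dd 1)%:R / m%:R) `^ e) ->
    v `^ s <= C `^ s * riesz_kernel e s r rr m dd.
  move=> s0 ddr vle; rewrite /riesz_kernel ddr -powRM ?(ltW C0)//; last first.
    by rewrite divr_ge0 ?powR_ge0// ltW.
  rewrite ge0_ler_powR ?nnegrE ?(ltW v0)// mulr_ge0 ?(ltW C0)// divr_ge0 ?powR_ge0//.
  exact: ltW.
apply: ler_pM; rewrite ?prodr_ge0// ?powR_ge0//.
- by apply: ler_prod => i _; rewrite powR_ge0/= kpow.
- exact: kpow.
Qed.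

Lemma ler_exprM (F1 F2 M A1 A2 : R) (n : nat) : 0 <= F1 -> 0 <= F2 ->
  F1 <= M * A1 -> F2 <= M * A2 -> F1 ^+ n * F2 <= M ^+ n.+1 * (A1 ^+ n * A2).
Proof.
move=> F10 F20 h1 h2; rewrite exprSr mulrACA -exprMn.
apply: ler_pM; rewrite ?exprn_ge0//.
by rewrite lerXn2r ?nnegrE// (le_trans F10).
Qed.

(** Exponent of [2^-1 ^+ k] in the bound for the expected proportion of close pairs: [s1] and [st]
    come from the factors [r] of the kernels, and [1 - gamma s1], [1 - alpha st] from integrating
    them only up to the cutoff of the graph. *)
Definition energy_exponent (graph : bool) (s1 st : R) : R :=
  d%:R * s1 + st + (if graph then d%:R * (1 - gamma * s1) + (1 - alpha * st) else 0).

(** Pairs close at scale [k] have expected proportion at most [B0 2 ^ (- k tau)]; with the weight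
    [2 ^ (k s)] there remains a geometric series, bounded uniformly in [l] because [s < tau]. *)
Lemma mean_grid_energy graph (s s1 st : R) : 0 <= s1 -> 0 <= st ->
  gamma * s1 < 1 -> alpha * st < 1 -> d%:R * s1 + st <= p%:R ->
  s < energy_exponent graph s1 st ->
  exists B, forall l, mean_le P (fun w => grid_energy lower_point
    (fun k y z => `[< close_event graph k y z w >]) s l) B.
Proof.
move=> s10 st0 gs1 ast Sp stau.
have /andP[a0 a1] := halpha; have /andP[g0 g1] := hgamma.
have C0 : 0 < C by apply: lt_le_trans C1.
set tau := energy_exponent _ _ _ in stau.
pose K1 : R := 2 * (1 + 2 / (1 - gamma * s1)).
pose K2 : R := 2 * (1 + 2 / (1 - alpha * st)).
have K10 : 0 <= K1.
  by rewrite mulr_ge0// addr_ge0// divr_ge0// subr_ge0 ltW.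
have K20 : 0 <= K2.
  by rewrite mulr_ge0// addr_ge0// divr_ge0// subr_ge0 ltW.
pose B0 : R := C `^ (d%:R * s1 + st) * (K1 ^+ d * K2).
have B00 : 0 <= B0 by rewrite mulr_ge0 ?powR_ge0// mulr_ge0// exprn_ge0.
pose rho : R := 2 `^ (s - tau).
have rho0 : 0 <= rho by exact: powR_ge0.
have rho1 : rho < 1.
  have : 0 < (tau - s) * ln 2 by rewrite mulr_gt0 ?subr_gt0// ln_gt0// ltr1n.
  move=> h; rewrite /rho -opprB powRN invf_lt1 ?powR_gt0//.
  by rewrite /powR pnatr_eq0/= expR_gt1.
exists (B0 * (1 - rho)^-1) => l.
set m := lower_mesh l.
have mR : 0 < m%:R :> R by exact: mesh_gt0.
pose r (k : nat) : R := 2^-1 ^+ k.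
pose rr k := cutoff graph k.
pose b k (g h : lower_grid l) := C `^ (d%:R * s1 + st) *
    (\prod_(i < d) riesz_kernel gamma s1 (r k) (rr k) m (absdiff (g.1 i) (h.1 i)) *
     riesz_kernel alpha st (r k) (rr k) m (absdiff g.2 h.2)).
have [mf f0 mle] : mean_le P (fun w => grid_energy lower_point
    (fun k y z => `[< close_event graph k y z w >]) s l)
  (\sum_(k < l) 2 `^ (k%:R * s) / #|lower_grid l|%:R ^+ 2 *
    \sum_(g : lower_grid l) \sum_(h : lower_grid l) b k g h).
  rewrite /grid_energy; apply: mean_le_sum => k; apply: mean_le_scale.
    by rewrite divr_ge0 ?powR_ge0// exprn_ge0.
  apply: mean_le_sum => g; apply: mean_le_sum => h.
  apply: mean_le_event; first exact: measurable_close_event.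
  exact: close_event_prob_le.
split => //; apply: (le_trans mle); rewrite lee_fin.
have sum_b k : (k < l)%N -> \sum_(g : lower_grid l) \sum_(h : lower_grid l) b k g h <=
    #|lower_grid l|%:R ^+ 2 * (B0 * 2 `^ (- (k%:R * tau))).
  move=> kl.
  have r0 : 0 < r k by rewrite exprn_gt0// invr_gt0.
  have mrr : m%:R^-1 <= rr k.
    have mr : m%:R^-1 <= r k.
      have := @lower_mesh_fine 1 k l kl; rewrite powRr1 ?invr_ge0//; apply => //.
      rewrite mulr1 (le_trans (y := alpha^-1))//; first by rewrite invf_ge1.
      by rewrite lerDl invr_ge0 ltW.
    rewrite /rr /cutoff; case: (graph) => //; apply: (le_trans mr).
    by rewrite /r exprn_ile1// invf_le1// ler1n.
  have rr0 : 0 < rr k by rewrite (lt_le_trans _ mrr)// invr_gt0.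
  have m0 : (0 < m)%N by [].
  have S1 := @sum_riesz_kernel_le R gamma s1 (r k) (rr k) m _ r0 m0 mrr.
  have S2 := @sum_riesz_kernel_le R alpha st (r k) (rr k) m _ r0 m0 mrr.
  have gs10 : 0 <= gamma * s1 < 1 by rewrite gs1 mulr_ge0// ltW.
  have ast0 : 0 <= alpha * st < 1 by rewrite ast mulr_ge0// ltW.
  have {}S1 := S1 gs10; have {}S2 := S2 ast0.
  set F1 := \sum_(i < m) _ in S1; set F2 := \sum_(i < m) _ in S2.
  (* The bound is a product over coordinates, so the sum over pairs of grid points factors. *)
  have -> : \sum_(g : lower_grid l) \sum_(h : lower_grid l) b k g h =
      C `^ (d%:R * s1 + st) * (F1 ^+ d * F2).
    pose A (g h : {ffun 'I_d -> 'I_m}) := \prod_(i < d)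
      riesz_kernel gamma s1 (r k) (rr k) m (absdiff (g i) (h i)).
    pose K (i j : 'I_m) := riesz_kernel alpha st (r k) (rr k) m (absdiff i j).
    rewrite -[F1 ^+ d]sum_prod_pairs /F2 big_distrlr/= mulr_sumr.
    rewrite -(pair_bigA _ (fun g a => \sum_(h : lower_grid l)
      C `^ (d%:R * s1 + st) * (A g h.1 * K a h.2)))/=.
    apply: eq_bigr => g _; rewrite mulr_sumr; apply: eq_bigr => a _.
    rewrite -(pair_bigA _ (fun h b => C `^ (d%:R * s1 + st) * (A g h * K a b)))/=.
    rewrite big_distrlr/= mulr_sumr; apply: eq_bigr => h _.
    by rewrite mulr_sumr.
  have F10 : 0 <= F1.
    by rewrite sumr_ge0// => i _; rewrite sumr_ge0// => j _; exact: riesz_kernel_ge0.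
  have F20 : 0 <= F2.
    by rewrite sumr_ge0// => i _; rewrite sumr_ge0// => j _; exact: riesz_kernel_ge0.
  have S12 := ler_exprM d F10 F20 S1 S2.
  apply: (le_trans (ler_wpM2l (powR_ge0 C _) S12)).
  have rE (t : R) : r k `^ t = 2 `^ (- (k%:R * t)) by exact: powR_half.
  have rrE : (rr k `^ (1 - gamma * s1)) ^+ d * rr k `^ (1 - alpha * st) =
      2 `^ (- (k%:R * (if graph then d%:R * (1 - gamma * s1) + (1 - alpha * st) else 0))).
    rewrite /rr /cutoff; case: (graph); last by rewrite !powR1 expr1n mulr1 mulr0 oppr0 powRr0.
    rewrite !rE -powR_mulrn ?powR_ge0// -powRrM -powRD ?pnatr_eq0 ?implybT//.
    by congr (_ `^ _); ring.
  rewrite card_lower_grid natrX.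
  have -> : 2 `^ (- (k%:R * tau)) = ((r k `^ s1) ^+ d * r k `^ st) *
      ((rr k `^ (1 - gamma * s1)) ^+ d * rr k `^ (1 - alpha * st)).
    rewrite rrE !rE -powR_mulrn ?powR_ge0// -powRrM -!powRD ?pnatr_eq0 ?implybT//.
    by congr (_ `^ _); rewrite /tau /energy_exponent; ring.
  rewrite le_eqVlt; apply/orP; left; apply/eqP; rewrite /B0.
  rewrite -/K1 -/K2 -!exprM mulnC !exprMn.
  set x1 := m%:R ^+ _; set x2 := C `^ _; set x3 := K1 ^+ d; set x4 := _ `^ s1 ^+ d.
  by set x5 := _ ^+ d; ring.
apply: (@le_trans _ _ (\sum_(k < l) B0 * rho ^+ k)).
  apply: ler_sum => k _.
  have N0 : 0 < #|lower_grid l|%:R :> R.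
    by rewrite card_lower_grid ltr0n expn_gt0.
  apply: (@le_trans _ _ (2 `^ (k%:R * s) / #|lower_grid l|%:R ^+ 2 *
    (#|lower_grid l|%:R ^+ 2 * (B0 * 2 `^ (- (k%:R * tau)))))).
    by rewrite ler_wpM2l ?divr_ge0 ?powR_ge0 ?exprn_ge0 ?(ltW N0)// sum_b.
  rewrite -mulrA mulKf ?expf_neq0 ?gt_eqF// mulrCA ler_wpM2l//.
  rewrite -powRD ?pnatr_eq0 ?implybT// /rho -powR_mulrn ?powR_ge0// -powRrM.
  by rewrite le_eqVlt; apply/orP; left; apply/eqP; congr (_ `^ _); ring.
rewrite -mulr_sumr ler_wpM2l//.
have -> : \sum_(i < l) rho ^+ i = (1 - rho ^+ l) / (1 - rho).
  elim: l {m mR b mf f0 mle sum_b} => [|n IH]; first by rewrite big_ord0 expr0 subrr mul0r.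
  by rewrite big_ord_recr/= IH exprSr; field; rewrite gt_eqF// subr_gt0.
rewrite ler_piMl ?invr_ge0 ?subr_ge0 ?(ltW rho1)//.
by rewrite lerBlDr lerDl exprn_ge0.
Qed.

End Energy.

(** * Dimension of the image and of the graph *)

Lemma compact_cover_prod (U V : ptopologicalType) (D : set (U * V)) :
  compact D -> cover_compact D.
Proof.
move=> cD.
pose W : ptopologicalType := HB.pack (U * V)%type (Pointed.class (U * V)%type)
  (Topological.class (U * V)%type).
by rewrite -(compact_cover W).
Qed.

Section Assembly.
Context {R : realType} {d : nat}.
Local Notation Z := ('rV[R]_d * R)%type.

Lemma unit_cube_compact : compact (@unit_cube R d).
Proof.
have -> : @unit_cube R d =
    [set v : 'rV[R]_d | forall i, `[0, 1]%classic (v ord0 i)] `*` `[0, 1]%classic.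
  by apply/seteqP; split => -[x t] /= [h1 h2]; split => // i; have := h1 i;
    rewrite in_itv.
apply: compact_setX; last exact: segment_compact.
exact: (@rV_compact R d (fun=> `[0, 1]%classic) (fun=> @segment_compact R 0 1)).
Qed.

Lemma unit_cube_nonempty : @unit_cube R d !=set0.
Proof. by exists (0, 0); split => [i|] /=; rewrite ?mxE lexx ler01. Qed.

Lemma enorm_dist_open (n : nat) (Phi : Z -> 'rV[R]_n) :
  (forall j, continuous (fun z => Phi z ord0 j)) ->
  forall (x : 'rV[R]_n) (r : R), open [set z | enorm (Phi z - x) < r].
Proof.
move=> cPhi x r.
have c : continuous (fun z => enorm (Phi z - x)).
  move=> z; rewrite /enorm.
  apply: (@continuous_comp _ _ _ (fun z => \sum_(i < n) (Phi z - x) ord0 i ^+ 2) Num.sqrt);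
    last exact: sqrt_continuous.
  apply: cvg_big => [|i _]; first exact: add_continuous.
  under eq_fun do rewrite !mxE.
  rewrite !mxE.
  apply: (@continuous_comp _ _ _ (fun z => Phi z ord0 i - x ord0 i) (fun u => u ^+ 2));
    last exact: exprn_continuous.
  by apply: cvgB; [exact: cPhi|exact: cvg_cst].
exact: ((continuousP _).1 c _ (@open_lt _ r)).
Qed.

Context {p : nat}.
Implicit Types F : 'I_p -> Z -> R.

Definition image_map F (z : Z) : 'rV[R]_p := \row_(i < p) F i z.

Definition graph_map F (z : Z) : 'rV[R]_(d + 1 + p) :=
  row_mx (row_mx z.1 (const_mx z.2)) (image_map F z).

Lemma graph_map_coord F (j : 'I_(d + 1 + p)) :
  [\/ exists i, forall z, graph_map F z ord0 j = z.1 ord0 i,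
      forall z, graph_map F z ord0 j = z.2 |
      exists i, forall z, graph_map F z ord0 j = F i z].
Proof.
rewrite -(fintype.splitK j); case: (fintype.split j) => [k|i] /=.
  rewrite -(fintype.splitK k); case: (fintype.split k) => [i|i] /=.
    by apply: Or31; exists i => u; rewrite /graph_map !row_mxEl.
  by apply: Or32 => u; rewrite /graph_map row_mxEl row_mxEr mxE.
by apply: Or33; exists i => u; rewrite /graph_map row_mxEr mxE.
Qed.

Lemma image_map_continuous F : (forall i, continuous (F i)) ->
  forall j, continuous (fun z => image_map F z ord0 j).
Proof.
by move=> cF j; under eq_fun do rewrite mxE; exact: cF.
Qed.

Lemma graph_map_continuous F : (forall i, continuous (F i)) ->
  forall j, continuous (fun z => graph_map F z ord0 j).
Proof.
move=> cF j; have [[i E]|E|[i E]] := graph_map_coord F j.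
- under eq_fun do rewrite E.
  move=> z; apply: (@continuous_comp _ _ _ fst (fun v : 'rV[R]_d => v ord0 i)).
    exact: cvg_fst.
  exact: coord_continuous.
- by under eq_fun do rewrite E; move=> z; exact: cvg_snd.
- by under eq_fun do rewrite E; exact: cF.
Qed.

Lemma image_map_close F (h : R) (y z : Z) :
  (forall i, `|y.1 ord0 i - z.1 ord0 i| <= h) ->
  `|y.2 - z.2| <= h -> (forall i, `|F i y - F i z| <= h) ->
  forall j, `|image_map F y ord0 j - image_map F z ord0 j| <= h.
Proof. by move=> _ _ hF j; rewrite !mxE. Qed.

Lemma graph_map_close F (h : R) (y z : Z) :
  (forall i, `|y.1 ord0 i - z.1 ord0 i| <= h) ->
  `|y.2 - z.2| <= h -> (forall i, `|F i y - F i z| <= h) ->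
  forall j, `|graph_map F y ord0 j - graph_map F z ord0 j| <= h.
Proof.
move=> h1 h2 hF j; have [[i E]|E|[i E]] := graph_map_coord F j;
  by rewrite !E.
Qed.

Lemma image_map_enorm F (y z : Z) i :
  `|F i y - F i z| <= enorm (image_map F y - image_map F z).
Proof.
by apply: le_trans (enorm_coord_le _ i); rewrite !mxE.
Qed.

Lemma sub_coord (m : nat) (x y : 'rV[R]_m) j : (x - y) ord0 j = x ord0 j - y ord0 j.
Proof. by rewrite !mxE. Qed.

Lemma graph_map_enorm F (y z : Z) (e := enorm (graph_map F y - graph_map F z)) :
  [/\ forall i, `|y.1 ord0 i - z.1 ord0 i| <= e, `|y.2 - z.2| <= e &
      forall i, `|F i y - F i z| <= e].
Proof.
split => [i||i].
- apply: le_trans (enorm_coord_le _ (lshift p (lshift 1 i))).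
  by rewrite sub_coord /graph_map !row_mxEl.
- apply: le_trans (enorm_coord_le _ (lshift p (rshift d ord0))).
  by rewrite sub_coord /graph_map !row_mxEl !row_mxEr !mxE.
- apply: le_trans (enorm_coord_le _ (rshift (d + 1) i)).
  by rewrite sub_coord /graph_map !row_mxEr !mxE.
Qed.

Lemma grid_energy_mono (G : nat -> finType) (pt : forall l, G l -> Z)
    (close : nat -> Z -> Z -> bool) (s t : R) (l : nat) : s <= t ->
  grid_energy pt close s l <= grid_energy pt close t l.
Proof.
move=> st; apply: ler_sum => k _; rewrite ler_wpM2r//.
  by rewrite sumr_ge0// => g _; rewrite sumr_ge0.
rewrite ler_wpM2r ?invr_ge0 ?exprn_ge0//.
by rewrite ler_powR ?ler1n// ler_wpM2l.
Qed.

Variables alpha gamma : R.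
Hypotheses (halpha : 0 < alpha <= 1) (hgamma : 0 < gamma <= 1) (p_gt0 : (0 < p)%N).
Context {disp : measure_display} {T : measurableType disp}.
Variables (P : probability T R) (Xs : 'I_p -> Z -> {RV P >-> R}).
Variables (K C : R).
Hypotheses (K_gt0 : 0 < K) (C_ge1 : 1 <= C).
Hypothesis Xs_tail : forall (h : R) (y z : Z), close_pair y z -> 0 < h ->
  (forall i, `|y.1 ord0 i - z.1 ord0 i| <= h `^ gamma^-1) ->
  `|y.2 - z.2| <= h `^ alpha^-1 -> forall i (u : R), 0 <= u ->
  (P [set w | (u <= `|Xs i y w - Xs i z w|)%R] <=
   (16 * expR (- (u ^+ 2 / (K * h ^+ 2))))%:E)%E.
Hypothesis Xs_small_ball : forall (y z : Z) (q r : R), close_pair y z ->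
  0 < q -> separated alpha gamma q y z -> 0 <= r ->
  (P [set w | forall i, (`|Xs i y w - Xs i z w| <= r)%R] <= ((C * r / q) ^+ p)%:E)%E.
Hypothesis Xs_cont : forall i, continuous_samples P (Xs i).

Let path (w : T) : 'I_p -> Z -> R := fun i z => Xs i z w.

(** Countably many exponents tending to 1 share one null set; [n.+2] keeps them in [(0, 1)]. *)
Lemma ae_osc_bound (a b : R) : gamma^-1 <= a -> alpha^-1 <= b ->
  {ae P, forall w, forall n : nat, osc_bound (path w) a b (1 - n.+2%:R^-1)}.
Proof.
move=> ha hb; apply: ae_foralln => n.
have /andP[a0 _] := halpha; have /andP[g0 _] := hgamma.
apply: (osc_bound_ae a0 g0 K_gt0 Xs_tail Xs_cont ha hb).
have n0 : 0 < n.+2%:R^-1 :> R by rewrite invr_gt0.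
have n1 : n.+2%:R^-1 < 1 :> R by rewrite invf_lt1// ltr1n.
by rewrite subr_gt0 n1 ltrBlDr ltrDl n0.
Qed.

(** Limit [e -> 1] in [hausdorff_measure_osc]. The maxima are the least box exponents compatible
    with cubes of exponent [theta] and with the oscillation bound. *)
Lemma ae_dim_le (n : nat) (Phi : ('I_p -> Z -> R) -> Z -> 'rV[R]_n) (theta : R) :
  (forall F (h : R) (y z : Z), (forall i, `|y.1 ord0 i - z.1 ord0 i| <= h) ->
    `|y.2 - z.2| <= h -> (forall i, `|F i y - F i z| <= h) ->
    forall j, `|Phi F y ord0 j - Phi F z ord0 j| <= h) ->
  1 <= theta ->
  {ae P, forall w, (hausdorff_dim (Phi (path w) @` @unit_cube R d) <=
    ((d%:R * Num.max theta gamma^-1 + Num.max theta alpha^-1 +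
      p%:R * (theta - 1)) / theta)%:E)%E}.
Proof.
move=> Phi_close th1.
have th0 : 0 < theta by apply: lt_le_trans th1.
set a := Num.max theta gamma^-1; set b := Num.max theta alpha^-1.
have tha : theta <= a by rewrite le_max lexx.
have thb : theta <= b by rewrite le_max lexx.
have ga : gamma^-1 <= a by rewrite le_max lexx orbT.
have ab : alpha^-1 <= b by rewrite le_max lexx orbT.
have := ae_osc_bound ga ab; apply: filterS => w osc.
apply: hausdorff_dim_le.
  rewrite divr_ge0 ?(ltW th0)// !addr_ge0 ?mulr_ge0 ?subr_ge0//.
    by rewrite (le_trans _ tha)// ltW.
  by rewrite (le_trans _ thb)// ltW.
move=> s hs.
have s0 : 0 < s.
  apply: le_lt_trans hs; rewrite divr_ge0 ?(ltW th0)// !addr_ge0 ?mulr_ge0 ?subr_ge0//.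
    by rewrite (le_trans _ tha)// ltW.
  by rewrite (le_trans _ thb)// ltW.
rewrite ltr_pdivrMr// in hs.
set S := d%:R * a + b + p%:R * (theta - 1) in hs.
have gap : 0 < s * theta - S by rewrite subr_gt0.
(* Rank at which the loss [p (1 - e)] falls below the gap left by [s]. *)
pose n0 := Num.truncn (p%:R / (s * theta - S)).
have pn : p%:R * n0.+2%:R^-1 < s * theta - S.
  rewrite ltr_pdivrMr// mulrC -ltr_pdivrMr//.
  by apply: (lt_le_trans (truncnS_gt _)); rewrite ler_nat.
have n00 : 0 < n0.+2%:R^-1 :> R by rewrite invr_gt0.
have n01 : n0.+2%:R^-1 < 1 :> R by rewrite invf_lt1// ltr1n.
apply: (hausdorff_measure_osc (Phi_close (path w)) _ tha thb s0 _ (osc n0)).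
  by rewrite subr_gt0 n01 (le_trans _ th1)// lerBlDr lerDl ltW.
move: pn; rewrite /S; move: (n0.+2%:R^-1 : R) => x; rewrite (mulrC theta s) !mulrBr !mulr1.
by move=> pn; lra.
Qed.

Lemma ae_image_dim_le_p :
  {ae P, forall w, (hausdorff_dim (image_map (path w) @` @unit_cube R d) <= p%:R%:E)%E}.
Proof.
have := ae_osc_bound (lexx gamma^-1) (lexx alpha^-1); apply: filterS => w osc.
have [M M0 hM] := osc_bound_bounded (osc 0%N).
apply: hausdorff_dim_le => // s ps.
have s0 : 0 < s by rewrite (le_lt_trans _ ps).
apply: (hausdorff_measure_bounded M0 s0 ps) => z i Dz.
by rewrite mxE; exact: hM.
Qed.

(** The null set depends on the exponent, hence the sequence [sn] increasing to [s0]; monotonicity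
    of the energy in [s] then reaches every [s < s0]. *)
Lemma ae_dim_ge (graph : bool) (n : nat) (Phi : ('I_p -> Z -> R) -> Z -> 'rV[R]_n) (s0 : R) :
  (forall F, (forall i, continuous (F i)) -> forall j, continuous (fun z => Phi F z ord0 j)) ->
  (forall F (y z : Z) (e := enorm (Phi F y - Phi F z)),
    (graph -> (forall i, `|y.1 ord0 i - z.1 ord0 i| <= e) /\ `|y.2 - z.2| <= e) /\
    forall i, `|F i y - F i z| <= e) ->
  0 < s0 ->
  (forall s, s < s0 -> exists s1 st, [/\ 0 <= s1, 0 <= st, gamma * s1 < 1 /\ alpha * st < 1,
    d%:R * s1 + st <= p%:R & s < energy_exponent (d := d) alpha gamma graph s1 st]) ->
  {ae P, forall w, (s0%:E <= hausdorff_dim (Phi (path w) @` @unit_cube R d))%E}.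
Proof.
move=> Phi_cont Phi_enorm s00 Hs.
pose sn (m : nat) := s0 - m.+1%:R^-1.
pose E (w : T) (s : R) (l : nat) : R := grid_energy (@lower_point R d alpha gamma)
  (fun k y z => `[< close_event Xs graph k y z w >]) s l.
have ae1 : {ae P, forall w, forall m : nat, exists M, forall l0,
    exists2 l, (l0 <= l)%N & E w (sn m) l <= M}.
  apply: ae_foralln => m.
  have snm : sn m < s0 by rewrite ltrBlDr ltrDl invr_gt0.
  have [s1 [st [s10 st0 [gs as_] Sp lt]]] := Hs _ snm.
  have [B HB] := mean_grid_energy halpha hgamma C_ge1 p_gt0 Xs_small_ball
    s10 st0 gs as_ Sp lt.
  exact: (mean_le_ae_recurrent HB).
have ae2 : {ae P, forall w, forall i, continuous (path w i)}.
  by apply: filter_forall => i; exact: Xs_cont.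
apply: filterS2 ae1 ae2 => w Ew cw.
have nonempty : Phi (path w) @` @unit_cube R d !=set0.
  by have [z Dz] := unit_cube_nonempty; exists (Phi (path w) z); exists z.
apply: hausdorff_dim_ge => //; last exact: hausdorff_measure0_neq0.
move=> s /andP[s_gt0 ss0].
pose m := Num.truncn (s0 - s)^-1.
have ssn : s <= sn m.
  rewrite /sn lerBrDl -lerBrDr.
  have g0 : 0 < s0 - s by rewrite subr_gt0.
  rewrite -[leRHS]invrK lef_pV2 ?posrE ?invr_gt0//.
  exact/ltW/truncnS_gt.
have [M HM] := Ew m.
have frost := @frostman_discrete R n _ (Phi (path w)) (@unit_cube R d)
  (compact_cover_prod unit_cube_compact)
  (enorm_dist_open (Phi_cont _ cw)) (@lower_grid R d alpha gamma) (@lower_point R d alpha gamma)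
  (fun k y z => `[< close_event Xs graph k y z w >]).
apply: (frost _ _ _ s M s_gt0).
- by move=> l; rewrite card_lower_grid expn_gt0.
- by move=> l g; exact: lower_point_cube.
- move=> k y z hyz; apply/asboolP; have [h1 h2] := Phi_enorm (path w) y z.
  split => [/h1[h3 h4]|i]; last exact: le_trans (h2 i) hyz.
  by split => [i|]; [exact: le_trans (h3 i) hyz|exact: le_trans h4 hyz].
- move=> l0; have [l l0l hl] := HM l0; exists l => //.
  by apply: le_trans hl; exact: grid_energy_mono.
Qed.

End Assembly.

(** * Sharing out the decay *)

Section Exponents.
Context {R : realType} {d p : nat}.
Variables alpha gamma : R.
Hypotheses (d_gt0 : (0 < d)%N) (a0 : 0 < alpha) (g0 : 0 < gamma).

(* The decay [r ^ p] of the small ball probability is shared out: [s1] for each space coordinate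
   and [st] for time, with integrable kernels [|x|^(- gamma s1)] and [|t|^(- alpha st)]. *)
Definition admissible (graph : bool) (s : R) : Prop :=
  exists s1 st, [/\ 0 <= s1, 0 <= st, gamma * s1 < 1 /\ alpha * st < 1,
    d%:R * s1 + st <= p%:R & s < energy_exponent (d := d) alpha gamma graph s1 st].

Let Q : R := d%:R / gamma + 1 / alpha.

Let dR : 0 < d%:R :> R. Proof. by rewrite ltr0n. Qed.

Let Q_gt0 : 0 < Q.
Proof. by rewrite addr_gt0// divr_gt0. Qed.

(** Both kernels get the same singularity [lam], and the constraints reduce to [lam < 1] and
    [lam * Q <= p]. This serves the image and, the additional terms being nonnegative, the graph for
    large [p]. *)
Lemma admissible_proportional (graph : bool) (s : R) : s < p%:R -> s < Q ->
  admissible graph s.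
Proof.
move=> sp sQ; have [p_eq0|p_neq0] := eqVneq p 0%N.
  exists 0, 0; split => //; rewrite ?mulr0 ?add0r// ?ler0n//.
  move: sp; rewrite p_eq0 => /lt_le_trans; apply.
  by rewrite /energy_exponent !mulr0 !subr0 !add0r; case: graph => //; rewrite addr_ge0// mulr1.
have pR : 0 < p%:R :> R by rewrite ltr0n lt0n.
have mp : 0 < Num.min p%:R Q by rewrite lt_min pR Q_gt0.
have sm : s < Num.min p%:R Q by rewrite lt_min sp sQ.
(* A midpoint: positive, above [s] and strictly below [Q], so that [lam] lies in [(0, 1)]. *)
pose s' := (Num.max s 0 + Num.min p%:R Q) / 2.
have mm : Num.max s 0 < Num.min p%:R Q by rewrite gt_max sm mp.
have m0 : 0 <= Num.max s 0 by rewrite le_max lexx orbT.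
have ms : s <= Num.max s 0 by rewrite le_max lexx.
have [ss' s'm s'0] : [/\ s < s', s' < Num.min p%:R Q & 0 < s'].
  by rewrite /s'; split; lra.
move: s'm; rewrite lt_min => /andP[s'p s'Q].
pose lam := s' / Q.
have lam0 : 0 < lam by rewrite divr_gt0.
have lam1 : lam < 1 by rewrite ltr_pdivrMr// mul1r.
have lamQ : d%:R * (lam / gamma) + lam / alpha = s'.
  rewrite (_ : _ + _ = lam * Q); last first.
    by move: (lam) => l; rewrite /Q; field; rewrite !gt_eqF.
  by rewrite /lam divfK// gt_eqF.
have gE : gamma * (lam / gamma) = lam by rewrite mulrC divfK// gt_eqF.
have aE : alpha * (lam / alpha) = lam by rewrite mulrC divfK// gt_eqF.
exists (lam / gamma), (lam / alpha); split.
- by rewrite divr_ge0// ltW.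
- by rewrite divr_ge0// ltW.
- by rewrite gE aE.
- by rewrite lamQ ltW.
- rewrite /energy_exponent lamQ; apply: (lt_le_trans ss'); rewrite lerDl.
  case: graph => //; rewrite gE aE.
  by rewrite addr_ge0 ?mulr_ge0 ?subr_ge0// ltW.
Qed.

(** All the decay goes to time; [p < 1 / alpha] keeps that kernel integrable. *)
Lemma admissible_time (s : R) : p%:R < 1 / alpha ->
  s < d%:R + 1 + (1 - alpha) * p%:R -> admissible true s.
Proof.
move=> pa hs; exists 0, p%:R; split => //; rewrite ?mulr0 ?add0r//.
- by split => //; rewrite mulrC -ltr_pdivlMr.
- by rewrite /energy_exponent !mulr0; move: hs; lra.
Qed.

Lemma admissible_space (s : R) : p%:R < d%:R / gamma ->
  s < d%:R + 1 + (1 - gamma) * p%:R -> admissible true s.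
Proof.
move=> pg hs; exists (p%:R / d%:R), 0; split; rewrite ?divr_ge0 ?mulr0 ?addr0//.
- split => //; rewrite mulrA ltr_pdivrMr// mul1r mulrC -ltr_pdivlMr//.
- by rewrite mulrC divfK// gt_eqF.
- apply: (lt_le_trans hs); rewrite /energy_exponent !mulr0 le_eqVlt; apply/orP; left.
  by apply/eqP; field; rewrite gt_eqF.
Qed.

Lemma shrink_exists (x gap : R) : 0 <= x -> 0 < gap ->
  exists2 eta : R, 0 < eta <= 1 & eta * x < gap.
Proof.
move=> x0 gap0; exists (gap / (gap + x)).
  rewrite divr_gt0 ?ltr_wpDr//= ler_pdivrMr ?ltr_wpDr// mul1r lerDl//.
rewrite mulrAC ltr_pdivrMr ?ltr_wpDr//; rewrite ltr_pM2l// ltrDr//.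
Qed.

(** Time takes its full share [1 / alpha] and space the rest. The limit share is not integrable, so
    it is lowered by the factor [1 - eta], with [eta] small against the gap left by [s]. *)
Lemma admissible_time_full (s : R) : alpha <= 1 -> 1 / alpha <= p%:R -> p%:R < Q ->
  s < d%:R + gamma / alpha + (1 - gamma) * p%:R -> admissible true s.
Proof.
move=> a1 pa pQ hs.
have [eta /andP[eta0 eta1] hgap] : exists2 eta : R, 0 < eta <= 1 &
    eta * (1 / alpha) < d%:R + gamma / alpha + (1 - gamma) * p%:R - s.
  by apply: shrink_exists; rewrite ?subr_gt0// divr_ge0// ltW.
exists ((p%:R - 1 / alpha) / d%:R), ((1 - eta) / alpha).
have dN : d%:R != 0 :> R by rewrite gt_eqF.
have aN : alpha != 0 by rewrite gt_eqF.
split.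
- by rewrite divr_ge0// subr_ge0.
- by rewrite divr_ge0 ?subr_ge0// ltW.
- split; last by rewrite mulrC divfK//; lra.
  rewrite mulrA ltr_pdivrMr// mul1r mulrC -ltr_pdivlMr//.
  by move: pQ; rewrite /Q; lra.
- rewrite mulrC divfK// mulrBl; have : 0 <= eta / alpha by rewrite divr_ge0// ltW.
  lra.
- have E : energy_exponent (d := d) alpha gamma true
      ((p%:R - 1 / alpha) / d%:R) ((1 - eta) / alpha) =
      d%:R + gamma / alpha + (1 - gamma) * p%:R - eta * (1 / alpha) + eta.
    by rewrite /energy_exponent; field; rewrite aN dN.
  by rewrite E; lra.
Qed.

(** Here space is filled up to its limit share [1 / gamma] per coordinate, again lowered by
    [1 - eta], and time takes the rest. *)
Lemma admissible_space_full (s : R) : gamma <= 1 -> d%:R / gamma <= p%:R -> p%:R < Q ->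
  s < d%:R * alpha / gamma + 1 + (1 - alpha) * p%:R -> admissible true s.
Proof.
move=> g1 pg pQ hs.
have [eta /andP[eta0 eta1] hgap] : exists2 eta : R, 0 < eta <= 1 &
    eta * (d%:R / gamma) < d%:R * alpha / gamma + 1 + (1 - alpha) * p%:R - s.
  by apply: shrink_exists; rewrite ?subr_gt0// divr_ge0// ltW.
exists ((1 - eta) / gamma), (p%:R - d%:R / gamma).
have gN : gamma != 0 by rewrite gt_eqF.
split.
- by rewrite divr_ge0 ?subr_ge0// ltW.
- by rewrite subr_ge0.
- split; first by rewrite mulrC divfK//; lra.
  rewrite mulrC -ltr_pdivlMr//.
  by move: pQ; rewrite /Q; lra.
- have -> : d%:R * ((1 - eta) / gamma) = d%:R / gamma - eta * (d%:R / gamma) by field.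
  have : 0 <= eta * (d%:R / gamma) by rewrite mulr_ge0 ?divr_ge0// ltW.
  lra.
- have E : energy_exponent (d := d) alpha gamma true ((1 - eta) / gamma) (p%:R - d%:R / gamma) =
      d%:R * alpha / gamma + 1 + (1 - alpha) * p%:R - eta * (d%:R / gamma) + eta * d%:R.
    by rewrite /energy_exponent; field.
  have : 0 < eta * d%:R by rewrite mulr_gt0.
  by rewrite E; lra.
Qed.

End Exponents.

Theorem proposition6p2 (R : realType) (d : nat) (hd : (1 <= d)%N)
    (sigma a c alpha beta gamma : R)
    (hsigma : 0 < sigma) (ha : 0 < a) (hc : 0 < c)
    (halpha : 0 < alpha <= 1) (hbeta : 0 < beta <= 1) (hgamma : 0 < gamma <= 1)
    (disp0 : measure_display) (T0 : measurableType disp0)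
    (P0 : probability T0 R) (X : 'rV[R]_d * R -> {RV P0 >-> R})
    (hXgauss : gaussian_field P0 X)
    (hXcent : centered_field P0 X)
    (hXstat : stationary_field P0 X)
    (hXcont : continuous_samples P0 X)
    (hXcov : forall (x y : 'rV[R]_d) (t s : R),
      ('E_P0[(fun w => X (x + y, t + s) w * X (y, s) w)%R] =
       (cov_fun sigma a c alpha beta gamma x t)%:E)%E)
    (p : nat) (hp : (1 <= p)%N)
    (disp : measure_display) (T : measurableType disp) (P : probability T R)
    (Xs : 'I_p -> 'rV[R]_d * R -> {RV P >-> R})
    (hXscopy : forall i, same_law P P0 (Xs i) X)
    (hXsindep : independent_fields P (fun i z => Xs i z))
    (hXscont : forall i, continuous_samples P (Xs i)) :
  [/\ {ae P, forall w,
        hausdorff_dim (cube_image (fun i z => Xs i z) w) =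
        (Num.min p%:R (d%:R / gamma + 1 / alpha))%:E},
      (alpha <= gamma -> gamma < 1 ->
       {ae P, forall w,
         hausdorff_dim (cube_graph (fun i z => Xs i z) w) =
         (if p%:R < 1 / alpha
          then d%:R + 1 + (1 - alpha) * p%:R
          else if p%:R < 1 / alpha + d%:R / gamma
          then d%:R + gamma / alpha + (1 - gamma) * p%:R
          else 1 / alpha + d%:R / gamma)%:E}) &
      (gamma <= alpha -> alpha < 1 ->
       {ae P, forall w,
         hausdorff_dim (cube_graph (fun i z => Xs i z) w) =
         (if p%:R < d%:R / gamma
          then d%:R + 1 + (1 - gamma) * p%:R
          else if p%:R < 1 / alpha + d%:R / gamma
          then d%:R * alpha / gamma + 1 + (1 - alpha) * p%:R
          else 1 / alpha + d%:R / gamma)%:E})].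
Proof.
have /andP[a0 a1] := halpha; have /andP[g0 g1] := hgamma; have /andP[b0 _] := hbeta.
have dR : 0 < d%:R :> R by rewrite ltr0n.
have pR : 0 < p%:R :> R by rewrite ltr0n.
have aN : alpha != 0 by rewrite gt_eqF.
have gN : gamma != 0 by rewrite gt_eqF.
have ai1 : 1 <= alpha^-1 by rewrite invf_ge1.
have gi1 : 1 <= gamma^-1 by rewrite invf_ge1.
have [K K0 tail] := incr_tail hsigma ha hc a0 b0 g0 hXgauss hXcent hXcov hXscopy.
have [C C0 ball] := incr_joint_small_ball hsigma ha hc a0 b0 g0 hXgauss hXcent hXcov
  hXscopy hXsindep.
pose C1 := Num.max C 1.
have C11 : 1 <= C1 by rewrite le_max lexx orbT.
have ball1 (y z : 'rV[R]_d * R) (q r : R) : close_pair y z ->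
    0 < q -> separated alpha gamma q y z -> 0 <= r ->
    (P [set w | forall i, (`|Xs i y w - Xs i z w| <= r)%R] <= ((C1 * r / q) ^+ p)%:E)%E.
  move=> cyz q0 sq r0; apply: (le_trans (ball y z q r cyz q0 sq r0)).
  have q10 : 0 <= q^-1 by rewrite invr_ge0 ltW.
  have h : C * r / q <= C1 * r / q by rewrite ler_wpM2r// ler_wpM2r// le_max lexx.
  have h0 : 0 <= C * r / q by rewrite !mulr_ge0// ltW.
  by rewrite lee_fin lerXn2r ?nnegrE// (le_trans h0).
have graph_le (theta : R) := ae_dim_le halpha hgamma K0 tail hXscont
  (theta := theta) (@graph_map_close R d p).
have graph_ge (s0 : R) := ae_dim_ge halpha hgamma hp C11 ball1 hXscont (graph := true)
  (s0 := s0) (@graph_map_continuous R d p)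
  (fun F y z => let: And3 h1 h2 h3 := graph_map_enorm F y z in
     conj (fun _ => conj h1 h2) h3).
(* Each case comes down to a [theta] whose cover exponent equals the energy bound [s0]. *)
have graph_eq (s0 theta : R) : 1 <= theta -> 0 < s0 ->
    (d%:R * Num.max theta gamma^-1 + Num.max theta alpha^-1 + p%:R * (theta - 1)) / theta = s0 ->
    (forall s, s < s0 -> admissible (d := d) (p := p) alpha gamma true s) ->
    {ae P, forall w, hausdorff_dim (cube_graph (fun i z => Xs i z) w) = s0%:E}.
  move=> th1 s00 ths adm; have := graph_le theta th1; rewrite ths.
  have := graph_ge s0 s00 adm; apply: filterS2 => w h1 h2.
  by apply/eqP; rewrite eq_le h1 h2.
have max1 (x : R) : 1 <= x -> Num.max 1 x = x by move=> h; apply/max_idPr.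
have Q0 : 0 < d%:R / gamma + 1 / alpha by rewrite addr_gt0 ?divr_gt0.
(* With [theta = 1] the boxes are not cut in the parameters, and in the values only by the vanishing
   loss [1 - e]. *)
have graph_Q : 1 / alpha + d%:R / gamma <= p%:R ->
    {ae P, forall w, hausdorff_dim (cube_graph (fun i z => Xs i z) w) =
      (1 / alpha + d%:R / gamma)%:E}.
  rewrite addrC => Qp; apply: (graph_eq _ 1) => //.
    by rewrite !max1// subrr mulr0 addr0 divr1 div1r.
  by move=> s sQ; apply: admissible_proportional => //; exact: lt_le_trans Qp.
split.
- have image_le := ae_dim_le halpha hgamma K0 tail hXscont (@image_map_close R d p)
    (lexx 1).
  have image_le_p := ae_image_dim_le_p halpha hgamma K0 tail hXscont.
  have s00 : 0 < Num.min p%:R (d%:R / gamma + 1 / alpha) by rewrite lt_min pR Q0.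
  have image_ge := ae_dim_ge halpha hgamma hp C11 ball1 hXscont (graph := false)
    (@image_map_continuous R d p)
    (fun F y z => conj (fun h : is_true false => False_ind _ (notF h)) (image_map_enorm F y z))
    s00.
  have {}image_ge : {ae P, forall w, (Num.min p%:R (d%:R / gamma + 1 / alpha))%:E <=
      hausdorff_dim (cube_image (fun i z => Xs i z) w)}%E.
    by apply: image_ge => s; rewrite lt_min => /andP[]; exact: admissible_proportional.
  rewrite !max1// subrr mulr0 addr0 divr1 in image_le.
  apply: filterS3 image_le image_le_p image_ge => w h1 h2 h3.
  apply/eqP; rewrite eq_le h3 andbT EFin_min le_min h2/= (le_trans h1)//.
  by rewrite lee_fin div1r.
- move=> ag _.
  have gia : gamma^-1 <= alpha^-1 by rewrite lef_pV2.
  case: ltP => [pa|ap].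
    (* Few components: the cubes have the time side of the boxes, and all the decay goes to time. *)
    apply: (graph_eq _ alpha^-1) => //.
    + by rewrite ltr_wpDr ?mulr_ge0 ?subr_ge0// addr_gt0.
    + rewrite (max_idPl gia) maxxx; field.
      by rewrite aN.
    + by move=> s; exact: admissible_time.
  case: ltP => [pQ|]; last exact: graph_Q.
  (* The cubes have the spatial side of the boxes, the larger one; time is saturated and space takes
     the rest. *)
  apply: (graph_eq _ gamma^-1) => //.
  + by rewrite ltr_wpDr ?mulr_ge0 ?subr_ge0// addr_gt0// divr_gt0.
  + rewrite (max_idPr gia) maxxx; field.
    by rewrite aN gN.
  + by move=> s; apply: admissible_time_full => //; rewrite addrC.
(* Time and space exchange roles. *)
- move=> ga _.
  have aig : alpha^-1 <= gamma^-1 by rewrite lef_pV2.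
  case: ltP => [pg|gp].
    apply: (graph_eq _ gamma^-1) => //.
    + by rewrite ltr_wpDr ?mulr_ge0 ?subr_ge0// addr_gt0.
    + rewrite (max_idPl aig) maxxx; field.
      by rewrite gN.
    + by move=> s; exact: admissible_space.
  case: ltP => [pQ|]; last exact: graph_Q.
  apply: (graph_eq _ alpha^-1) => //.
  + by rewrite ltr_wpDr ?mulr_ge0 ?subr_ge0// addr_gt0// divr_gt0// mulr_gt0.
  + rewrite (max_idPr aig) maxxx; field.
    by rewrite aN gN.
  + by move=> s; apply: admissible_space_full => //; rewrite addrC.
Qed.
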